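(* For $A,B\in\mathbb{Z}$ let $\Delta_{A,B}=4A^3+27B^2$, and for $X\ge 1$ let $$S(X)=\sum_{\substack{(A,B)\in\mathbb{Z}^2\\ |A|\le X^4,\ |B|\le X^6}}\mu^2(\Delta_{A,B}).$$ For $q\in\mathbb{N}$ let $\varrho(q)=\#\{(\alpha,\beta)\ \mathrm{mod}\ q:\ \Delta_{\alpha,\beta}\equiv 0\ (\mathrm{mod}\ q)\}$. Then for any $\varepsilon>0$, $$S(X)=4X^{10}\prod_p\left(1-\frac{\varrho(p^2)}{p^4}\right)+O_\varepsilon(X^{7+\varepsilon}).$$
   Context: $\mu$ is the Möbius function, with the conventions $\mu(0)=0$ and $\mu(-n)=\mu(n)$ for $n\in\mathbb{N}$. The product is over all primes $p$. *)

(* Defs.v *)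
From mathcomp Require Import all_boot.
From Stdlib Require Import ZArith Reals.

Definition mu_nat (n : nat) : Z :=
  if n == 0%N then 0%Z
  else if all (fun p => logn p n == 1%N) (primes n)
       then ((-1) ^ Z.of_nat (size (primes n)))%Z
       else 0%Z.

Definition mu (n : Z) : Z := mu_nat (Z.abs_nat n).

Definition Delta (A B : Z) : Z := (4 * A ^ 3 + 27 * B ^ 2)%Z.

Definition rho (q : nat) : nat :=
  \sum_(a < q) \sum_(b < q) (q %| 4 * a ^ 3 + 27 * b ^ 2)%N.

Definition Zrange (N : nat) : seq Z :=
  map (fun k => (Z.of_nat k - Z.of_nat N)%Z) (iota 0 (2 * N).+1).

(* S(X) = sum_{|A| <= X^4, |B| <= X^6} mu^2(Delta_{A,B}).  Every integer A with
   |A| <= X^4 lies in [-up(X^4), up(X^4)], so the filtered finite sums below range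
   over exactly the required pairs. *)
Definition S (X : R) : R :=
  let N4 := Z.to_nat (up (X ^ 4)) in
  let N6 := Z.to_nat (up (X ^ 6)) in
  foldr Rplus 0%R
    (map (fun A =>
       foldr Rplus 0%R
         (map (fun B =>
            if Rle_dec (Rabs (IZR A)) (X ^ 4) then
              if Rle_dec (Rabs (IZR B)) (X ^ 6) then
                IZR (mu (Delta A B) ^ 2)
              else 0%R
            else 0%R) (Zrange N6)))
       (Zrange N4)).

Definition euler_partial (N : nat) : R :=
  foldr Rmult 1%R
    (map (fun p => (1 - INR (rho (p ^ 2)) / INR (p ^ 4))%R)
         (filter prime (iota 0 N))).

(* Main.v *)
(** Expand [mu^2] of the discriminant over squarefree [d] with [d^2 | Delta], and let [T = X].

    For [d <= T^3] lattice points are counted directly: for fixed [A] the admissible [B] form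
    [r_A(d)] classes mod [d^2], and since [r_A(d)] depends only on [A] mod [d], summing over [A] costs
    only a further error [O(T^6 / d + d)].  Together these errors are [O(T^(7+eps))], and the tail
    [d > T^3] of the Euler product is of the same size.

    For [d > T^3] it suffices, by the divisor bound, to count the pairs [(A, B)] for which such a [d]
    exists.  Write [d = g e m] with [g | 6], [e | (A, B)] and [m] prime to [6 A].
    - If [m <= T^3], fix [e] and [m] and count [A], then [B].
    - If [m > T^3], then [x^3 + A x + B] has a double root [u] mod [m^2], the cubic form
      [F(x, y) = x^3 + A x y^2 + B y^3] is divisible by [m^2] on the lattice [x = u y] mod [m], and in a
      reduced basis of this lattice [F / m^2] has small integral coefficients.  The covariants of this
      form at the coordinates of [(m, 0)] give back [A] and [B].  Unless [F] has a linear factor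
      (which happens for [O(T^6)] pairs), its leading coefficient is nonzero, which keeps the first basis
      vector long, and counting coefficients and coordinates over dyadic ranges gives [O(T^7)] pairs
      for each of [O(log^2 T)] ranges. *)

From HB Require Import structures.
From Stdlib Require Import ZArith Reals Lra Lia Znumtheory Zpow_facts.
From mathcomp Require Import all_boot zify ssrZ.
Require Import Defs.
Delimit Scope Z_scope with Z.
Delimit Scope R_scope with R.
Open Scope R_scope.

(** The box is |A| <= L^2, |B| <= L^3 with L of order T^2, so x has weight L against y in the cubic
    form, and lattice vectors are measured by max(|x|, L |y|). Direct counting costs about T^4 for
    each d, from rounding in every class of A; this reaches T^7 at d = T^3, which fixes the cut. All
    sums over d run over the products of distinct primes below a cutoff N. For such a list the
    expansion of mu^2 and the partial Euler product are exact finite identities, so the two sides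
    are compared term by term at level N with an error independent of N, and only then does N go to
    infinity. Pairs of zero discriminant are divisible by every d^2, so they are removed before
    large d are counted. Logarithms and divisor counts are absorbed in powers of Y = T^s. The worst
    product has two divisor bounds Y^12 and two harmonic sums Y, hence s = min(eps, 1) / 26. *)

HB.instance Definition _ := Monoid.isComLaw.Build R 0 Rplus
  (fun x y z => esym (Rplus_assoc x y z)) Rplus_comm Rplus_0_l.
HB.instance Definition _ := Monoid.isComLaw.Build R 1 Rmult
  (fun x y z => esym (Rmult_assoc x y z)) Rmult_comm Rmult_1_l.
HB.instance Definition _ := Monoid.isMulLaw.Build R 0 Rmult Rmult_0_l Rmult_0_r.
HB.instance Definition _ := Monoid.isAddLaw.Build R Rmult Rplus
  (fun x y z => Rmult_plus_distr_r x y z) Rmult_plus_distr_l.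

Notation "\rsum_ ( i <- r ) F" := (\big[Rplus/0]_(i <- r) F)
  (at level 41, F at level 41, i, r at level 50).
Notation "\rsum_ ( i <- r | P ) F" := (\big[Rplus/0]_(i <- r | P) F)
  (at level 41, F at level 41, i, r at level 50).

(** * Finite sums of reals *)

Section RealSums.
Context {I : Type}.
Implicit Types (r : seq I) (P Q : pred I) (F G : I -> R).

Lemma rsum_ge0 r P F : (forall i, P i -> 0 <= F i) -> 0 <= \rsum_(i <- r | P i) F i.
Proof. by move=> H; elim/big_ind: _ => [||//] *; lra. Qed.

Lemma rsum_le r P F G : (forall i, P i -> F i <= G i) ->
  \rsum_(i <- r | P i) F i <= \rsum_(i <- r | P i) G i.
Proof. by move=> H; elim/big_ind2: _ => [||//] *; lra. Qed.

Lemma rsum_abs r P F :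
  Rabs (\rsum_(i <- r | P i) F i) <= \rsum_(i <- r | P i) Rabs (F i).
Proof.
apply: (big_ind2 (fun x y => Rabs x <= y)) => [|x1 y1 x2 y2 H1 H2|i _].
- rewrite Rabs_R0; lra.
- by apply: Rle_trans (Rabs_triang _ _) _; lra.
- lra.
Qed.

Lemma rsum_widen r P Q F : (forall i, P i -> Q i) -> (forall i, Q i -> 0 <= F i) ->
  \rsum_(i <- r | P i) F i <= \rsum_(i <- r | Q i) F i.
Proof.
move=> PQ F0; rewrite big_mkcond [X in _ <= X]big_mkcond /=.
apply: rsum_le => i _; case Pi: (P i); first by rewrite (PQ _ Pi); lra.
by case Qi: (Q i); [exact: F0 | lra].
Qed.

Lemma rsum_mull r P F c :
  \rsum_(i <- r | P i) (c * F i) = c * \rsum_(i <- r | P i) F i.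
Proof. by rewrite big_distrr. Qed.

Lemma rsum_mulr r P F c :
  \rsum_(i <- r | P i) (F i * c) = (\rsum_(i <- r | P i) F i) * c.
Proof. by rewrite big_distrl. Qed.

Lemma rsum_opp r P F :
  \rsum_(i <- r | P i) (- F i) = - \rsum_(i <- r | P i) F i.
Proof. by elim/big_ind2: _ => [||//] *; lra. Qed.

Lemma rsum_add r P F G :
  \rsum_(i <- r | P i) (F i + G i) =
  (\rsum_(i <- r | P i) F i) + \rsum_(i <- r | P i) G i.
Proof. exact: big_split. Qed.

Lemma rsum_cat r s P F :
  \rsum_(i <- r ++ s | P i) F i =
  (\rsum_(i <- r | P i) F i) + \rsum_(i <- s | P i) F i.
Proof. exact: big_cat. Qed.

Lemma rsum_sub r P F G :
  \rsum_(i <- r | P i) (F i - G i) =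
  (\rsum_(i <- r | P i) F i) - \rsum_(i <- r | P i) G i.
Proof. by rewrite /Rminus rsum_add rsum_opp. Qed.

Lemma rsum_const r c : \rsum_(i <- r) c = INR (size r) * c.
Proof.
elim: r => [|x r IH]; first by rewrite big_nil /=; lra.
by rewrite big_cons IH -[size (x :: r)]/((size r).+1) S_INR /=; lra.
Qed.

Lemma INR_sum r P (F : I -> nat) :
  INR (\sum_(i <- r | P i) F i) = \rsum_(i <- r | P i) INR (F i).
Proof. exact: (big_morph INR plus_INR). Qed.

End RealSums.

Lemma rsum_exchange (I J : Type) (r : seq I) (s : seq J) P Q (F : I -> J -> R) :
  \rsum_(i <- r | P i) \rsum_(j <- s | Q j) F i j =
  \rsum_(j <- s | Q j) \rsum_(i <- r | P i) F i j.
Proof. exact: exchange_big. Qed.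

Lemma rsum_le_seq (I : eqType) (r : seq I) (P : pred I) F G :
  (forall i, i \in r -> P i -> F i <= G i) ->
  \rsum_(i <- r | P i) F i <= \rsum_(i <- r | P i) G i.
Proof.
move=> H; rewrite big_seq_cond [X in _ <= X]big_seq_cond.
by apply: rsum_le => i /andP[]; exact: H.
Qed.

Lemma rsum_term_le (I : eqType) (r : seq I) (F : I -> R) i :
  (forall j, 0 <= F j) -> i \in r -> F i <= \rsum_(j <- r) F j.
Proof.
move=> F0; elim: r => [//|x r IH]; rewrite inE big_cons => /orP[/eqP->|/IH].
  by have := rsum_ge0 r xpredT F (fun j _ => F0 j); lra.
by have := F0 x; lra.
Qed.

Lemma rsum_subset_uniq (I : eqType) (r s : seq I) (F : I -> R) :
  uniq r -> {subset r <= s} -> (forall i, 0 <= F i) ->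
  \rsum_(i <- r) F i <= \rsum_(i <- s) F i.
Proof.
(* [s] may have repetitions; they only repeat nonnegative terms. *)
move=> ur rs F0; rewrite -(big_undup_iterop_count _ s) /= .
have [t rt] : exists t, perm_eq (undup s) (r ++ t).
  exists (filter (predC (mem r)) (undup s)); rewrite -(perm_filterC (mem r)).
  rewrite perm_cat2r uniq_perm ?filter_uniq ?undup_uniq // => x.
  by rewrite mem_filter mem_undup; apply/andP/idP => [[]//|xr]; split=> //; exact: rs.
apply: (Rle_trans _ (\rsum_(i <- undup s) F i)).
  rewrite (perm_big _ rt) rsum_cat.
  by have := rsum_ge0 t xpredT F (fun j _ => F0 j); lra.
apply: rsum_le_seq => i; rewrite mem_undup -has_pred1 has_count => c0 _.
case: (count_mem i s) c0 => // n _ /=.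
elim: n => [|n IH] /=; first by lra.
by have := F0 i; lra.
Qed.

(** * Squarefree numbers and multiplicative sums *)

(** Repeats the test inside [mu_nat], so that mu^2 is literally its indicator; [sqfP] is the form
    used in arguments. *)
Definition sqf (d : nat) : bool :=
  (0 < d)%N && all (fun p => logn p d == 1%N) (primes d).

Lemma sqf_gt0 d : sqf d -> (0 < d)%N. Proof. by case/andP. Qed.

Lemma sqfP d : reflect ((0 < d)%N /\ forall p, prime p -> ~~ (p ^ 2 %| d)%N) (sqf d).
Proof.
apply: (iffP andP) => [[d0 /allP H]|[d0 H]]; split=> //.
  move=> p pp; apply/negP => pd; have pd1 : (p %| d)%N by apply: dvdn_trans pd; exact: dvdn_exp.
  have := H p; rewrite mem_primes pp d0 pd1 => /(_ isT) /eqP lp.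
  by move: pd; rewrite pfactor_dvdn // lp.
apply/allP => p; rewrite mem_primes => /and3P[pp _ pd].
by have := H p pp; move: pd; rewrite -{1}(expn1 p) !pfactor_dvdn // => *; lia.
Qed.

Lemma sqf_dvd d e : sqf d -> (e %| d)%N -> sqf e.
Proof.
move=> /sqfP[d0 H] ed; apply/sqfP; split; first exact: dvdn_gt0 ed.
by move=> p pp; apply: contra (H p pp) => pe; exact: dvdn_trans pe ed.
Qed.

Lemma sqf_coprime m n : sqf (m * n) -> coprime m n.
Proof.
move=> /sqfP[d0 H]; apply/coprimeP.
  by rewrite muln_gt0 in d0; case/andP: d0.
have [m0 n0] : (0 < m)%N /\ (0 < n)%N by apply/andP; rewrite -muln_gt0.
have /eqP g1 : gcdn m n == 1%N.
  rewrite eqn_leq gcdn_gt0 m0 andbT leqNgt; apply/negP => g1.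
  have pp := pdiv_prime g1; have := H _ pp; rewrite expnS expn1 dvdn_mul //.
  - exact: dvdn_trans (pdiv_dvd _) (dvdn_gcdl _ _).
  - exact: dvdn_trans (pdiv_dvd _) (dvdn_gcdr _ _).
have /coprimeP : coprime m n by rewrite /coprime g1.
by apply.
Qed.

Lemma sqf_mulp p d : prime p -> ~~ (p %| d)%N -> sqf d -> sqf (p * d).
Proof.
move=> pp pd /sqfP[d0 H]; apply/sqfP; split; first by rewrite muln_gt0 prime_gt0.
move=> q qq; case: (eqVneq q p) => [->|qp].
  by rewrite expnS expn1 dvdn_pmul2l ?prime_gt0.
rewrite Gauss_dvdr ?H // coprimeXl //.
by rewrite prime_coprime // dvdn_prime2.
Qed.

(** Splitting off the least prime factor leaves a smaller squarefree number coprime to it, so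
    multiplicative facts need only one new prime at a time. *)
Lemma sqf_ind (P : nat -> Prop) : P 1%N ->
  (forall p d, prime p -> ~~ (p %| d)%N -> sqf d -> P d -> P (p * d)%N) ->
  forall d, sqf d -> P d.
Proof.
move=> P1 Pm d; elim/ltn_ind: d => d IH sd.
have d0 := sqf_gt0 _ sd.
case: (ltngtP d 1) => [|d1|->//]; first by case: d d0 {IH sd}.
have pp := pdiv_prime d1; have e := divnK (pdiv_dvd d).
set p := pdiv d in pp e *; set q := (d %/ p)%N in e *.
have sq : sqf q by apply: sqf_dvd sd _; rewrite -e dvdn_mulr.
rewrite -e mulnC; apply: Pm => //.
  by apply: contra (proj2 (sqfP _ sd) p pp) => h; rewrite -e mulnC expnS expn1 dvdn_pmul2l ?prime_gt0.
by apply: IH => //; rewrite ltn_Pdiv ?prime_gt1.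
Qed.

(** The subset products of [ps], that is, the index set obtained by expanding the product of the
    [1 + f p]. *)
Fixpoint sfprods (ps : seq nat) : seq nat :=
  if ps is p :: ps' then sfprods ps' ++ [seq (p * d)%N | d <- sfprods ps'] else [:: 1%N].

Lemma mem_sfprods ps d : uniq ps -> all prime ps -> d \in sfprods ps ->
  sqf d /\ (forall q, prime q -> (q %| d)%N -> q \in ps).
Proof.
elim: ps d => [|p ps IH] d /=.
  move=> _ _; rewrite inE => /eqP->; split=> // q /prime_gt1 q1.
  by rewrite dvdn1 => /eqP h; rewrite h in q1.
case/andP=> pps ups /andP[pp aps]; rewrite mem_cat => /orP[/IH[]// sd H|].
  by split=> // q qq qd; rewrite inE H ?orbT.
case/mapP=> e /IH[]// se H ->; split.
  by apply: sqf_mulp => //; apply: contra pps; exact: H.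
by move=> q qq; rewrite Euclid_dvdM // dvdn_prime2 // inE => /orP[->//|/H->]; rewrite ?orbT.
Qed.

Lemma sfprods_uniq ps : uniq ps -> all prime ps -> uniq (sfprods ps).
Proof.
elim: ps => [//|p ps IH] /= /andP[pps ups] /andP[pp aps].
rewrite cat_uniq IH //= map_inj_uniq ?IH // ?andbT; last first.
  by move=> x y /eqP; rewrite eqn_pmul2l ?prime_gt0 // => /eqP.
apply/hasPn => d /mapP[e _ ->]; apply/negP => /mem_sfprods[]// _ /(_ p pp).
by rewrite dvdn_mulr // => /(_ isT); rewrite (negPf pps).
Qed.

(** Multiplicativity restricted to what the expansion over [sfprods] uses: a new prime against a
    squarefree number. *)
Definition sfmult (f : nat -> R) : Prop :=
  f 1%N = 1 /\ forall p d, prime p -> ~~ (p %| d)%N -> sqf d -> f (p * d)%N = f p * f d.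

Lemma sum_sfprods (f : nat -> R) ps : sfmult f -> uniq ps -> all prime ps ->
  \rsum_(d <- sfprods ps) f d = \big[Rmult/1]_(p <- ps) (1 + f p).
Proof.
move=> [f1 fM]; elim: ps => [|p ps IH] /=; first by rewrite big_seq1 big_nil.
case/andP=> pps ups /andP[pp aps]; rewrite big_cat big_map big_cons /= -IH //.
rewrite Rmult_plus_distr_r Rmult_1_l -rsum_mull; congr Rplus.
apply: eq_big_seq => d /mem_sfprods[]// sd H; apply: fM => //.
by apply: contra pps; exact: H.
Qed.

(** The Möbius function at squarefree arguments, as a real number. *)
Definition sg (d : nat) : R := (-1) ^ size (primes d).

Lemma primes_mulp p d : prime p -> ~~ (p %| d)%N -> (0 < d)%N ->
  perm_eq (primes (p * d)) (p :: primes d).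
Proof.
move=> pp pd d0; apply: uniq_perm; first exact: primes_uniq.
  by rewrite /= primes_uniq mem_primes (negPf pd) !andbF.
by move=> q; rewrite (primesM q (prime_gt0 pp) d0) (primes_prime pp) !inE.
Qed.

Lemma sg_mulp p d : prime p -> ~~ (p %| d)%N -> (0 < d)%N -> sg (p * d) = - sg d.
Proof. by move=> pp pd d0; rewrite /sg (perm_size (primes_mulp _ _ pp pd d0)) /=; lra. Qed.

Lemma sg_prime p : prime p -> sg p = -1.
Proof. by move=> pp; rewrite /sg primes_prime //=; lra. Qed.

Lemma sg_abs d : Rabs (sg d) = 1.
Proof. by rewrite /sg -RPow_abs Rabs_Ropp Rabs_R1 pow1. Qed.

Lemma sum_sg_sfprods (f : nat -> R) ps : sfmult f -> uniq ps -> all prime ps ->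
  \rsum_(d <- sfprods ps) (sg d * f d) = \big[Rmult/1]_(p <- ps) (1 - f p).
Proof.
move=> [f1 fM] ups aps; rewrite sum_sfprods //.
  by apply: eq_big_seq => p /(allP aps) pp; rewrite sg_prime //; lra.
split; first by rewrite f1 /sg /=; lra.
by move=> p d pp pd sd /=; rewrite fM // sg_mulp ?sqf_gt0 // (sg_prime p) //; ring.
Qed.

(** * Divisor bound and elementary sums *)

Lemma INR_gt0 n : (0 < n)%N -> 0 < INR n.
Proof. by move=> n0; apply: lt_0_INR; lia. Qed.

Lemma INR_ge1 n : (0 < n)%N -> 1 <= INR n.
Proof. by move=> n0; rewrite -[1]/(INR 1); apply: le_INR; lia. Qed.

Lemma leq_INR m n : (m <= n)%N -> INR m <= INR n.
Proof. by move=> h; apply: le_INR; lia. Qed.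

Lemma INR_inv_ge0 n : 0 <= / INR n.
Proof.
case: n => [|n]; first by rewrite /= Rinv_0; lra.
by apply: Rlt_le; apply: Rinv_0_lt_compat; exact: INR_gt0.
Qed.

Lemma INR_divn m d : (0 < d)%N -> INR (m %/ d) <= INR m / INR d.
Proof.
move=> d0; have d0' := INR_gt0 _ d0.
apply: (Rmult_le_reg_r (INR d)) => //; rewrite /Rdiv Rmult_assoc Rinv_l; last lra.
by rewrite Rmult_1_r -mult_INR; apply: leq_INR; exact: leq_divM.
Qed.

Lemma INR_expn m n : INR (m ^ n) = INR m ^ n.
Proof. by elim: n => [//|n IH]; rewrite expnS [LHS]mult_INR IH. Qed.

Lemma Rpower_ge1 x s : 1 <= x -> 0 <= s -> 1 <= Rpower x s.
Proof.
move=> x1 s0; rewrite -(Rpower_O x); last lra.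
by case: (Req_dec x 1) => [->|?]; [rewrite /Rpower ln_1 !Rmult_0_r; lra | apply: Rle_Rpower].
Qed.

Lemma exp_le x y : x <= y -> exp x <= exp y.
Proof. by case=> [/exp_increasing/Rlt_le//|->]; lra. Qed.

Lemma ln_le_Rpower x s : 0 < x -> 0 < s -> ln x <= Rpower x s / s.
Proof.
move=> x0 s0; apply: (Rmult_le_reg_r s) => //.
rewrite /Rdiv Rmult_assoc Rinv_l; last lra.
by rewrite Rmult_1_r /Rpower; have := exp_ineq1_le (s * ln x); lra.
Qed.

Lemma inv_le_ln_diff n : (0 < n)%N -> / INR n.+1 <= ln (INR n.+1) - ln (INR n).
Proof.
move=> n0; have n0' := INR_gt0 _ n0; have n1 := INR_gt0 n.+1 isT.
have -> : ln (INR n) = ln (INR n.+1) + ln (INR n / INR n.+1).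
  rewrite -ln_mult //; last by apply: Rdiv_lt_0_compat.
  by congr ln; field; lra.
have h : ln (1 + - / INR n.+1) <= - / INR n.+1.
  rewrite -{2}(ln_exp (- / INR n.+1)).
  have h0 : 0 < 1 + - / INR n.+1.
    have : / INR n.+1 < 1 by rewrite -Rinv_1; apply: Rinv_lt_contravar; rewrite ?S_INR; lra.
    lra.
  case: (exp_ineq1_le (- / INR n.+1)) => [|->]; last lra.
  by move=> h1; apply: Rlt_le; apply: ln_increasing.
have e : INR n / INR n.+1 = 1 + - / INR n.+1 by rewrite S_INR in n1 *; field; lra.
by rewrite e; lra.
Qed.

Lemma iotaSr m n : iota m n.+1 = iota m n ++ [:: (m + n)%N].
Proof. by rewrite -addn1 iotaD. Qed.

Lemma harmonic_le n : (0 < n)%N -> \rsum_(d <- iota 1 n) (/ INR d) <= 1 + ln (INR n).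
Proof.
case: n => // n _; elim: n => [|n IH].
  by rewrite big_seq1 /= ln_1 Rinv_1; lra.
rewrite iotaSr rsum_cat big_seq1 add1n.
by have := inv_le_ln_diff n.+1 isT; lra.
Qed.

(** Telescoping in place of an integral: the term at d + 1 is at most the drop of x^(-s) / s from d
    to d + 1, because exp t >= 1 + t at t = s / (d + 1) <= s ln((d + 1) / d). The bound is uniform
    in [n]. *)
Lemma power_tail_le s z n : 0 < s -> (0 < z)%N ->
  \rsum_(d <- iota z.+1 n) Rpower (INR d) (- s - 1) <= Rpower (INR z) (- s) / s.
Proof.
move=> s0 z0.
have term d : (0 < d)%N -> Rpower (INR d.+1) (- s - 1) <=
    Rpower (INR d) (- s) / s - Rpower (INR d.+1) (- s) / s.
  move=> d0; apply: (Rmult_le_reg_r s) => //.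
  have -> x y : (x / s - y / s) * s = x - y by field; lra.
  have d1 := INR_gt0 d.+1 isT; have dd := inv_le_ln_diff d d0.
  have -> : Rpower (INR d.+1) (- s - 1) = Rpower (INR d.+1) (- s) * / INR d.+1.
    by rewrite /Rminus Rpower_plus (Rpower_Ropp _ 1) Rpower_1.
  have h : Rpower (INR d.+1) (- s) * (1 + s * / INR d.+1) <= Rpower (INR d) (- s).
    apply: (Rle_trans _ (Rpower (INR d.+1) (- s) * exp (s * / INR d.+1))).
      by apply: Rmult_le_compat_l; [exact: Rlt_le (exp_pos _) | exact: exp_ineq1_le].
    rewrite /Rpower -exp_plus; apply: exp_le.
    by have := Rmult_le_compat_l s _ _ (Rlt_le _ _ s0) dd; lra.
  lra.
have -> : Rpower (INR z) (- s) / s =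
    Rpower (INR (z + n)) (- s) / s + (Rpower (INR z) (- s) / s - Rpower (INR (z + n)) (- s) / s) by lra.
suff : \rsum_(d <- iota z.+1 n) Rpower (INR d) (- s - 1) <=
    Rpower (INR z) (- s) / s - Rpower (INR (z + n)) (- s) / s.
  have : 0 < Rpower (INR (z + n)) (- s) / s by apply: Rdiv_lt_0_compat => //; exact: exp_pos.
  lra.
elim: n => [|n IH]; first by rewrite big_nil addn0; lra.
rewrite iotaSr rsum_cat big_seq1 addnS addSn.
by have := term (z + n)%N; rewrite addn_gt0 z0 => /(_ isT); lra.
Qed.

Lemma prod_primes_le n : (0 < n)%N -> (\prod_(p <- primes n) p <= n)%N.
Proof.
move=> n0; rewrite {2}(prod_prime_decomp n0) prime_decompE big_map /=.
rewrite !(big_seq_cond predT) /=; apply: leq_prod => p; rewrite andbT => pn.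
by rewrite -{1}(expn1 p) leq_pexp2l ?logn_gt0 // prime_gt0 //; move: pn; rewrite mem_primes => /andP[].
Qed.

Lemma rprod_mul (I : Type) (r : seq I) (F G : I -> R) :
  \big[Rmult/1]_(i <- r) (F i * G i) =
  \big[Rmult/1]_(i <- r) F i * \big[Rmult/1]_(i <- r) G i.
Proof. exact: big_split. Qed.

Lemma rprod_ge0 (I : Type) (r : seq I) F : (forall i, 0 <= F i) -> 0 <= \big[Rmult/1]_(i <- r) F i.
Proof. by move=> H; elim/big_ind: _ => [|x y|//]; [lra | exact: Rmult_le_pos]. Qed.

Lemma rprod_le (I : eqType) (r : seq I) F G : (forall i, i \in r -> 0 <= F i <= G i) ->
  \big[Rmult/1]_(i <- r) F i <= \big[Rmult/1]_(i <- r) G i.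
Proof.
move=> H; rewrite big_seq_cond [X in _ <= X]big_seq_cond.
apply: (proj2 (A := 0 <= \big[Rmult/1]_(i <- r | (i \in r) && true) F i)).
elim/big_ind2: _ => [|x1 x2 y1 y2 [? ?] [? ?]|i /andP[/H //]]; first lra.
by split; [exact: Rmult_le_pos | apply: Rmult_le_compat].
Qed.

Lemma Rpower_prod (r : seq nat) s : (forall p, p \in r -> (0 < p)%N) ->
  \big[Rmult/1]_(p <- r) Rpower (INR p) s = Rpower (INR (\prod_(p <- r) p)) s.
Proof.
elim: r => [|p r IH] H; first by rewrite !big_nil /Rpower ln_1 Rmult_0_r exp_0.
rewrite !big_cons IH; last by move=> q qr; apply: H; rewrite inE qr orbT.
rewrite mult_INR Rpower_mult_distr //; apply: INR_gt0; first by apply: H; rewrite inE eqxx.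
by rewrite big_seq_cond; apply: prodn_cond_gt0 => q; rewrite andbT => qr; apply: H; rewrite inE qr orbT.
Qed.

(** A prime p >= 3^(1/s) satisfies p^s >= 3, and the product of p^s over the primes of n is at most
    n^s. The boundedly many smaller primes cost the constant 3^M. The base 3 is the one that appears
    in [totroots_le]. *)
Lemma omega_bound (s : R) : 0 < s -> exists C, 1 <= C /\
  forall n, (0 < n)%N -> 3 ^ size (primes n) <= C * Rpower (INR n) s.
Proof.
move=> s0; pose M := Z.to_nat (up (Rpower 3 (/ s))).
have HM p : (M <= p)%N -> 3 <= Rpower (INR p) s.
  move=> Mp; have h : Rpower 3 (/ s) <= INR p.
    have [h _] := archimed (Rpower 3 (/ s)).
    have h0 : 0 < Rpower 3 (/ s) by exact: exp_pos.
    have h1 : (0 <= up (Rpower 3 (/ s)))%Z by apply: le_IZR; lra.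
    by have := leq_INR _ _ Mp; rewrite /M INR_IZR_INZ Z2Nat.id //; lra.
  have e : Rpower (Rpower 3 (/ s)) s = 3.
    by rewrite Rpower_mult Rinv_l ?Rpower_1; lra.
  rewrite -{1}e; apply: Rle_Rpower_l; first lra.
  by split => //; exact: exp_pos.
exists (3 ^ M); split; first by apply: pow_R1_Rle; lra.
move=> n n0.
have e (r : seq nat) : 3 ^ size r = \big[Rmult/1]_(p <- r) 3.
  by elim: r => [|p r IH]; rewrite ?big_nil ?big_cons //= IH.
have hsmall : \big[Rmult/1]_(p <- primes n | (p < M)%N) 3 <= 3 ^ M.
  rewrite -big_filter -e; apply: Rle_pow; first lra.
  have : (size [seq p <- primes n | (p < M)%N] <= size (iota 0 M))%N.
    apply: uniq_leq_size; first by rewrite filter_uniq ?primes_uniq.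
    by move=> p; rewrite mem_filter mem_iota => /andP[-> _].
  rewrite size_iota; lia.
have hpow : \big[Rmult/1]_(p <- primes n) Rpower (INR p) s <= Rpower (INR n) s.
  rewrite Rpower_prod; last by move=> p; rewrite mem_primes => /andP[/prime_gt0].
  apply: Rle_Rpower_l; first lra.
  have h : (0 < \prod_(p <- primes n) p)%N.
    rewrite big_seq_cond; apply: prodn_cond_gt0 => p.
    by rewrite andbT mem_primes => /andP[/prime_gt0].
  by split; [exact: INR_gt0 | apply: leq_INR; exact: prod_primes_le].
apply: (Rle_trans _ (3 ^ M * \big[Rmult/1]_(p <- primes n) Rpower (INR p) s)); last first.
  by apply: Rmult_le_compat_l => //; apply: pow_le; lra.
apply: (Rle_trans _ ((\big[Rmult/1]_(p <- primes n | (p < M)%N) 3) *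
    \big[Rmult/1]_(p <- primes n) Rpower (INR p) s)); last first.
  by apply: Rmult_le_compat_r => //; apply: rprod_ge0 => p; exact: Rlt_le (exp_pos _).
rewrite e [X in X * _]big_mkcond -rprod_mul; apply: rprod_le => p; rewrite mem_primes => /andP[pp _].
have P1 : 1 <= Rpower (INR p) s by apply: Rpower_ge1; [exact: INR_ge1 (prime_gt0 pp) | lra].
by case: ltnP => [_|/HM]; lra.
Qed.

(** * Roots of the discriminant modulo squares *)

Definition dvZ (m : nat) (x : Z) : bool := (m %| Z.abs_nat x)%N.

Lemma dvZP m x : reflect (Z.of_nat m | x)%Z (dvZ m x).
Proof.
apply: (iffP idP) => [/dvdnP[k Hk]|[k Hk]].
  case: (Z.abs_eq_or_opp x) => h; [exists (Z.of_nat k)|exists (- Z.of_nat k)%Z]; lia.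
by apply/dvdnP; exists (Z.abs_nat k); rewrite Hk; lia.
Qed.

Lemma dvZ_congr m x y : (Z.of_nat m | x - y)%Z -> dvZ m x = dvZ m y.
Proof.
move=> [k Hk]; apply/dvZP/dvZP => -[l Hl]; [exists (l - k)%Z|exists (l + k)%Z]; lia.
Qed.

Lemma dvZ_mul m n x : coprime m n -> dvZ (m * n) x = dvZ m x && dvZ n x.
Proof. by move=> c; rewrite /dvZ Gauss_dvd. Qed.

(** Reduction modulo both factors is injective by the Chinese remainder theorem, hence bijective by
    cardinality. *)
Lemma crt_sum (q1 q2 : nat) (F1 F2 : nat -> nat) : (0 < q1)%N -> (0 < q2)%N -> coprime q1 q2 ->
  (forall a, F1 (a %% q1)%N = F1 a) -> (forall a, F2 (a %% q2)%N = F2 a) ->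
  (\sum_(b < q1 * q2) F1 b * F2 b = (\sum_(b < q1) F1 b) * (\sum_(b < q2) F2 b))%N.
Proof.
move=> q10 q20 co P1 P2.
pose h (b : 'I_(q1 * q2)) : 'I_q1 * 'I_q2 :=
  (Ordinal (ltn_pmod b q10), Ordinal (ltn_pmod b q20)).
have hinj : injective h.
  move=> x y [e1 e2]; apply: val_inj => /=.
  have := chinese_remainder co x y; rewrite e1 e2 !eqxx !modn_small //.
  by move/eqP.
have hbij : bijective h by apply: inj_card_bij hinj _; rewrite card_prod !card_ord.
rewrite big_distrlr /= pair_big /= (reindex h) /=; last exact: onW_bij.
by apply: eq_bigr => b _; rewrite P1 P2.
Qed.

Lemma sum_periodic (q k : nat) (F : nat -> nat) : (forall a, F (a + q)%N = F a) ->
  (\sum_(b < q * k) F b = k * \sum_(b < q) F b)%N.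
Proof.
move=> P; rewrite -!(big_mkord xpredT); elim: k => [|k IH]; first by rewrite muln0 big_geq.
rewrite mulnS addnC (@big_cat_nat _ _ _ (q * k)) ?leq_addr //= IH mulSn addnC; congr addn.
rewrite -{1}[(q * k)%N]add0n big_addn addKn; apply: eq_bigr => i _.
by elim: k {IH} => [|k IH]; rewrite ?muln0 ?addn0 // mulnS (addnC q) addnA P.
Qed.

Definition nroots (al ga : Z) (m : nat) : nat :=
  \sum_(b < m ^ 2) dvZ (m ^ 2) (al + ga * Z.of_nat b ^ 2)%Z.

Lemma dvZ_sq_mod q al ga b :
  dvZ q (al + ga * Z.of_nat (b %% q) ^ 2)%Z = dvZ q (al + ga * Z.of_nat b ^ 2)%Z.
Proof.
apply: dvZ_congr; exists (- ga * Z.of_nat (b %/ q) * (Z.of_nat b + Z.of_nat (b %% q)))%Z.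
have := divn_eq b q; set r := (b %% q)%N; set k := (b %/ q)%N => e.
by have -> : Z.of_nat b = (Z.of_nat k * Z.of_nat q + Z.of_nat r)%Z; [lia | ring].
Qed.

Lemma nroots_mul al ga m n : (0 < m)%N -> (0 < n)%N -> coprime m n ->
  nroots al ga (m * n) = (nroots al ga m * nroots al ga n)%N.
Proof.
move=> m0 n0 co; pose F q b : nat := dvZ q (al + ga * Z.of_nat b ^ 2)%Z.
rewrite /nroots expnMn -[RHS](crt_sum _ _ (F (m ^ 2)%N) (F (n ^ 2)%N)) /F.
- by apply: eq_bigr => b _; rewrite dvZ_mul ?coprimeXl ?coprimeXr // mulnb.
- by rewrite expn_gt0 m0.
- by rewrite expn_gt0 n0.
- by rewrite coprimeXl ?coprimeXr.
- by move=> a; rewrite dvZ_sq_mod.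
- by move=> a; rewrite dvZ_sq_mod.
Qed.

Lemma nroots1 al ga : nroots al ga 1 = 1%N.
Proof. by rewrite /nroots big_ord1 /dvZ dvd1n. Qed.

Lemma prime_gauss p x y : prime p -> dvZ p (x * y)%Z = dvZ p x || dvZ p y.
Proof. by move=> pp; rewrite /dvZ Zabs2Nat.inj_mul Euclid_dvdM. Qed.

(** Subtracting gives p^2 | ga (x - y) (x + y). If p divided both x - y and x + y, it would divide 2
    y, hence y, hence [al]; so p^2 divides one of the two factors. *)
Lemma root_pm al ga p x y : prime p -> ~~ dvZ p (2 * al * ga)%Z ->
  dvZ (p ^ 2) (al + ga * Z.of_nat x ^ 2)%Z -> dvZ (p ^ 2) (al + ga * Z.of_nat y ^ 2)%Z ->
  (x < p ^ 2)%N -> (y < p ^ 2)%N -> x = y \/ x = ((p ^ 2 - y) %% p ^ 2)%N.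
Proof.
move=> pp; rewrite !prime_gauss // !negb_or => /andP[/andP[p2 pal] pga] Hx Hy.
have px0 : ~~ dvZ p (Z.of_nat y).
  apply: contra pal => /dvZP[k Hk]; move/dvZP: Hy => [l Hl]; apply/dvZP.
  exists (l * Z.of_nat p - ga * k * Z.of_nat y)%Z.
  have -> : al = (l * Z.of_nat (p ^ 2) - ga * Z.of_nat y ^ 2)%Z by lia.
  by rewrite expnS expn1 Nat2Z.inj_mul Hk; ring.
have cq z : ~~ dvZ p z -> coprime (p ^ 2) (Z.abs_nat z).
  by move=> pz; rewrite coprimeXl // prime_coprime.
move: Hx Hy (cq _ pga) (cq (Z.of_nat x - Z.of_nat y)%Z) (cq (Z.of_nat x + Z.of_nat y)%Z).
set q := (p ^ 2)%N => Hx Hy cg cm cp lx ly.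
have Hd : dvZ q (ga * ((Z.of_nat x - Z.of_nat y) * (Z.of_nat x + Z.of_nat y)))%Z.
  by move/dvZP: Hx => [k Hk]; move/dvZP: Hy => [l Hl]; apply/dvZP; exists (k - l)%Z; lia.
move: Hd; rewrite /dvZ Zabs2Nat.inj_mul Gauss_dvdr // Zabs2Nat.inj_mul => Hd.
case pm: (dvZ p (Z.of_nat x - Z.of_nat y)%Z); [left|right].
  have pp' : ~~ dvZ p (Z.of_nat x + Z.of_nat y)%Z.
    apply/negP => /dvZP[k Hk]; move/dvZP: pm => [l Hl].
    have : dvZ p (2 * Z.of_nat y)%Z 
      by apply/dvZP; exists (k - l)%Z; rewrite Z.mul_sub_distr_r -Hk -Hl; ring.
    by rewrite prime_gauss // (negPf p2) (negPf px0).
  move: Hd; rewrite Gauss_dvdl ?cp // => H.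
  case e : (Z.abs_nat (Z.of_nat x - Z.of_nat y) == 0)%N; first by clear -e; lia.
  have /dvdn_leq : (0 < Z.abs_nat (Z.of_nat x - Z.of_nat y))%N by rewrite lt0n e.
  by move/(_ _ H); clear -lx ly; lia.
move: Hd; rewrite Gauss_dvdr ?cm ?pm // => H.
have Hs : (q %| x + y)%N by move: H; congr (_ %| _)%N; clear; lia.
have e : ((q - y) + (x + y) = q + x)%N by clear -ly; lia.
have : ((q - y) + (x + y) = q - y %[mod q])%N by rewrite -modnDmr (eqP Hs) addn0.
by rewrite e modnDl modn_small // => ->.
Qed.

Lemma nroots_prime_le2 al ga p : prime p -> ~~ dvZ p (2 * al * ga)%Z -> (nroots al ga p <= 2)%N.
Proof.
move=> pp pag; rewrite /nroots.
pose P (x : 'I_(p ^ 2)) := dvZ (p ^ 2) (al + ga * Z.of_nat x ^ 2)%Z.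
case: (pickP P) => [y Hy|none]; last first.
  by rewrite big1 // => b _; have := none b; rewrite /P => ->.
have q0 : (0 < p ^ 2)%N by rewrite expn_gt0 prime_gt0.
pose y' := Ordinal (ltn_pmod (p ^ 2 - y) q0).
rewrite -big_mkcond sum1_card.
apply: (leq_trans (n := #|[set y; y']|)); last by rewrite cards2; case: (_ != _).
apply: subset_leq_card; apply/subsetP => x Hx; rewrite !inE.
case: (root_pm al ga p x y pp pag Hx Hy (ltn_ord x) (ltn_ord y)) => e.
  by rewrite (val_inj e) eqxx.
by apply/orP; right; apply/eqP/val_inj.
Qed.

Lemma nroots_le_omega al ga m : sqf m -> coprime m (Z.abs_nat (2 * al * ga)) ->
  (nroots al ga m <= 2 ^ size (primes m))%N.
Proof.
move: m; apply: sqf_ind => [_|p d pp pd sd IH]; first by rewrite nroots1.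
rewrite coprimeMl => /andP[cp cd].
have d0 := sqf_gt0 _ sd.
have co : coprime p d by rewrite prime_coprime.
rewrite (nroots_mul _ _ _ _ (prime_gt0 pp) d0 co) (perm_size (primes_mulp _ _ pp pd d0)) expnS.
by apply: leq_mul; [apply: nroots_prime_le2; rewrite // -prime_coprime | exact: IH].
Qed.

(** The quantity r_A(m) of the overview. *)
Definition nrootsD (A : Z) (m : nat) : nat := nroots (4 * A ^ 3) 27 m.

Lemma nrootsD_cube A A' m : (Z.of_nat (m ^ 2) | 4 * (A' ^ 3 - A ^ 3))%Z -> nrootsD A' m = nrootsD A m.
Proof.
move=> [k Hk]; apply: eq_bigr => b _; congr nat_of_bool; apply: dvZ_congr.
by exists k; rewrite -Hk; ring.
Qed.

Lemma coprime_Zgcd m x : coprime m (Z.abs_nat x) -> Z.gcd (Z.of_nat m) x = 1%Z.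
Proof.
rewrite -(Z.gcd_abs_r _ x) -Zabs2Nat.id_abs; move: (Z.abs_nat x) => n /eqP h.
have -> : Z.gcd (Z.of_nat m) (Z.of_nat n) = Z.of_nat (gcdn m n) by lia.
by rewrite h.
Qed.

(* If A' = A s^2 mod p^2 with s = 1 mod p, then b |-> s^3 b maps roots for A to roots for A'. *)
Lemma nrootsD_prime_le A A' p : prime p -> (Z.of_nat p | A' - A)%Z -> ~~ dvZ p (2 * A)%Z ->
  (nrootsD A p <= nrootsD A' p)%N.
Proof.
move=> pp [t Ht] pA.
have [v [w Hvw]] : exists v w, (v * Z.of_nat p + w * (2 * A) = 1)%Z.
  by apply: Z.gcd_bezout; apply: coprime_Zgcd; rewrite prime_coprime.
(* [w] is inverse to 2 A mod p, so A s^2 = A + 2 A w p t = A + p t = A' mod p^2: the square root 1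
   of A' / A mod p is lifted to p^2. *)
pose s := (1 + Z.of_nat p * t * w)%Z.
have Hs : exists k, (A' = A * s ^ 2 + k * Z.of_nat (p ^ 2))%Z.
  exists (t * v - A * t ^ 2 * w ^ 2)%Z; rewrite expnS expn1 Nat2Z.inj_mul /s.
  have -> : A' = (A + t * Z.of_nat p * (v * Z.of_nat p + w * (2 * A)))%Z by rewrite Hvw; lia.
  ring.
have ps : ~~ dvZ p s.
  apply/negP => /dvZP[k Hk].
  have /dvZP : (Z.of_nat p | 1)%Z by exists (k - t * w)%Z; rewrite /s in Hk; lia.
  by rewrite /dvZ dvdn1 => /eqP p1; rewrite p1 in pp.
have q0 : (0 < p ^ 2)%N by rewrite expn_gt0 prime_gt0.
rewrite /nrootsD /nroots; set q := (p ^ 2)%N in Hs q0 *.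
have sig_lt (b : nat) : (Z.to_nat ((s ^ 3 * Z.of_nat b) mod Z.of_nat q) < q)%N.
  have := Z.mod_pos_bound (s ^ 3 * Z.of_nat b) (Z.of_nat q) ltac:(lia).
  move: (_ mod _)%Z => r; clear; lia.
have sigE (b : nat) : exists k, Z.of_nat (Z.to_nat ((s ^ 3 * Z.of_nat b) mod Z.of_nat q)) =
    (s ^ 3 * Z.of_nat b + k * Z.of_nat q)%Z.
  exists (- ((s ^ 3 * Z.of_nat b) / Z.of_nat q))%Z.
  have := Z.mod_pos_bound (s ^ 3 * Z.of_nat b) (Z.of_nat q) ltac:(lia).
  have := Z_div_mod_eq_full (s ^ 3 * Z.of_nat b) (Z.of_nat q).
  move: (Z.modulo _ _) (Z.div _ _) => r k; move: (s ^ 3 * Z.of_nat b)%Z => x; clear; lia.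
pose sig (b : 'I_q) := Ordinal (sig_lt b).
have sinj : injective sig.
  move=> b b' [e]; apply: val_inj => /=.
  have [k Hk] := sigE b; have [k' Hk'] := sigE b'; rewrite e Hk' in Hk.
  have : dvZ q (s ^ 3 * (Z.of_nat b - Z.of_nat b'))%Z.
    by apply/dvZP; exists (k' - k)%Z; clear -Hk; lia.
  rewrite /dvZ Zabs2Nat.inj_mul Gauss_dvdr; last first.
    have -> : Z.abs_nat (s ^ 3) = (Z.abs_nat s ^ 3)%N by clear; lia.
    by rewrite coprimeXl // coprimeXr // prime_coprime.
  move=> H; case b0 : (Z.abs_nat (Z.of_nat b - Z.of_nat b') == 0)%N; first by clear -b0; lia.
  have /dvdn_leq : (0 < Z.abs_nat (Z.of_nat b - Z.of_nat b'))%N by rewrite lt0n b0.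
  by move/(_ _ H); have := ltn_ord b; have := ltn_ord b'; clear; lia.
rewrite [X in (_ <= X)%N](reindex_inj sinj) /=; apply: leq_sum => b _.
case h : (dvZ q (4 * A ^ 3 + 27 * Z.of_nat b ^ 2)%Z) => //.
suff -> : dvZ q (4 * A' ^ 3 + 27 *
   Z.of_nat (Z.to_nat ((s ^ 3 * Z.of_nat b) mod Z.of_nat q)) ^ 2)%Z by [].
case: Hs => l ->; have [k ->] := sigE b; case/dvZP: h => m Hm; apply/dvZP.
move: (Z.of_nat b) (Z.of_nat q) Hm => B Q Hm.
exists (s ^ 6 * m + 4 * (3 * A ^ 2 * s ^ 4 * l + 3 * A * s ^ 2 * l ^ 2 * Q + l ^ 3 * Q ^ 2)
  + 27 * (2 * s ^ 3 * B * k + k ^ 2 * Q))%Z.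
have -> : (4 * (A * s ^ 2 + l * Q) ^ 3 + 27 * (s ^ 3 * B + k * Q) ^ 2 =
  s ^ 6 * (4 * A ^ 3 + 27 * B ^ 2)
  + (4 * (3 * A ^ 2 * s ^ 4 * l + 3 * A * s ^ 2 * l ^ 2 * Q + l ^ 3 * Q ^ 2) + 27 * (2 * s ^ 3 * B * k + k ^ 2 * Q)) * Q)%Z by ring.
rewrite Hm; ring.
Qed.

(** If p does not divide 2 A, the preceding injection exists in both directions. Otherwise 4 (A'^3 -
    A^3) is already divisible by p^2: through the factor 4 if p = 2, and through the two cubes if p
    | A. *)
Lemma nrootsD_prime_periodic A A' p : prime p -> (Z.of_nat p | A' - A)%Z -> nrootsD A' p = nrootsD A p.
Proof.
move=> pp pAA'; case pA: (dvZ p (2 * A)%Z); last first.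
  have pA' : dvZ p (2 * A')%Z = false.
    rewrite -pA; apply: dvZ_congr; case: pAA' => t Ht; exists (2 * t)%Z; lia.
  apply/eqP; rewrite eqn_leq !nrootsD_prime_le ?pA ?pA' //.
  by case: pAA' => t Ht; exists (- t)%Z; lia.
apply: nrootsD_cube; rewrite expnS expn1 Nat2Z.inj_mul; case: pAA' => t Ht.
move: pA; rewrite prime_gauss // => /orP[|/dvZP[k Hk]].
  rewrite /dvZ dvdn_prime2 // => /eqP ->.
  by exists (A' ^ 3 - A ^ 3)%Z; rewrite (_ : Z.of_nat _ = 2%Z) //; ring.
have -> : A' = ((t + k) * Z.of_nat p)%Z by lia.
by exists (4 * Z.of_nat p * ((t + k) ^ 3 - k ^ 3))%Z; rewrite Hk; ring.
Qed.

Lemma nrootsD_periodic A A' m : sqf m -> (Z.of_nat m | A' - A)%Z -> nrootsD A' m = nrootsD A m.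
Proof.
move: m; apply: sqf_ind => [|p d pp pd sd IH]; first by rewrite /nrootsD !nroots1.
move=> H; have co : coprime p d by rewrite prime_coprime.
rewrite Nat2Z.inj_mul in H; rewrite /nrootsD !(nroots_mul _ _ p d (prime_gt0 pp) (sqf_gt0 _ sd) co).
congr muln.
  apply: nrootsD_prime_periodic => //; apply: Z.divide_trans H; exact: Z.divide_factor_l.
by apply: IH; apply: Z.divide_trans H; exact: Z.divide_factor_r.
Qed.

(** * Total number of roots over a period, and local densities *)

Definition totroots (m : nat) : nat := \sum_(a < m) nrootsD (Z.of_nat a) m.

Lemma nrootsD_mod m a : sqf m -> nrootsD (Z.of_nat (a %% m)) m = nrootsD (Z.of_nat a) m.
Proof.
move=> sm; apply: nrootsD_periodic => //; exists (- Z.of_nat (a %/ m))%Z.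
by have := divn_eq a m; set r := (a %% m)%N; set k := (a %/ m)%N; clear => e; lia.
Qed.

Lemma totroots1 : totroots 1 = 1%N.
Proof. by rewrite /totroots big_ord1 /nrootsD nroots1. Qed.

Lemma totroots_mulp p d : prime p -> ~~ (p %| d)%N -> sqf d ->
  totroots (p * d) = (totroots p * totroots d)%N.
Proof.
move=> pp pd sd; have co : coprime p d by rewrite prime_coprime.
have d0 := sqf_gt0 _ sd; have sp : sqf p by rewrite -(muln1 p) sqf_mulp // dvdn1 neq_ltn prime_gt1 ?orbT.
pose F m a := nrootsD (Z.of_nat a) m.
rewrite /totroots -[RHS](crt_sum _ _ (F p) (F d)) /F //.
- by apply: eq_bigr => a _; rewrite /nrootsD nroots_mul // prime_gt0.
- exact: prime_gt0.
- by move=> a; exact: nrootsD_mod.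
- by move=> a; exact: nrootsD_mod.
Qed.

Lemma sqf_prime p : prime p -> sqf p.
Proof. by move=> pp; rewrite -(muln1 p) sqf_mulp // dvdn1 neq_ltn prime_gt1 ?orbT. Qed.

Lemma Nat_powE m n : Nat.pow m n = (m ^ n)%N.
Proof. by elim: n => [//|n IH]; rewrite expnS /= IH. Qed.

Lemma abs_Delta_nat (a b : nat) :
  Z.abs_nat (4 * Z.of_nat a ^ 3 + 27 * Z.of_nat b ^ 2) = (4 * a ^ 3 + 27 * b ^ 2)%N.
Proof. lia. Qed.

(** In [rho] the first coordinate runs mod p^2, which is p periods of r_A(p). *)
Lemma rho_prime_sq p : prime p -> rho (p ^ 2) = (p * totroots p)%N.
Proof.
move=> pp; rewrite /rho /totroots expnS expn1 -(sum_periodic p p (fun a => nrootsD (Z.of_nat a) p)).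
  apply: eq_bigr => a _; rewrite /nrootsD /nroots expnS expn1; apply: eq_bigr => b _.
  congr nat_of_bool; rewrite /dvZ; by rewrite abs_Delta_nat !Nat_powE.
move=> a; rewrite -[RHS]nrootsD_mod ?sqf_prime // -modnDr nrootsD_mod ?sqf_prime //.
Qed.

Lemma sum_dvd_mulself p : (0 < p)%N -> (\sum_(b < p * p) (p %| b) = p)%N.
Proof.
move=> p0; rewrite (sum_periodic p p (fun b => (p %| b) : nat)); last first.
  by move=> a; rewrite dvdn_addl.
rewrite -[RHS]muln1; congr muln; case: p p0 => // p _.
rewrite big_ord_recl dvdn0 big1 // => i _.
by rewrite gtnNdvd // /bump /= ltnS.
Qed.

(** Reduction mod p gives p | 27 b^2, hence p | b, and there are p multiples of p below p^2. *)
Lemma nrootsD_le_p A p : prime p -> (4 < p)%N -> dvZ p A -> (nrootsD A p <= p)%N.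
Proof.
move=> pp p4 pA; rewrite /nrootsD /nroots expnS expn1.
apply: (leq_trans (n := \sum_(b < p * p) (p %| b)%N)); last by rewrite sum_dvd_mulself ?prime_gt0.
apply: leq_sum => b _; case h : (dvZ _ _) => //; rewrite lt0b.
have h1 : dvZ p (27 * Z.of_nat b ^ 2)%Z.
  case/dvZP: pA => k Hk; case/dvZP: h => l; rewrite Nat2Z.inj_mul Hk => Hl; apply/dvZP.
  exists (l * Z.of_nat p - 4 * k ^ 3 * Z.of_nat p ^ 2)%Z; lia.
have h2 : dvZ p (3 * (3 * (3 * (Z.of_nat b * Z.of_nat b))))%Z.
  by move: h1; congr (dvZ p _); ring.
move: h2; rewrite !prime_gauss // orbb /dvZ Zabs2Nat.id.
have -> : (p %| Z.abs_nat 3)%N = false; last by [].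
by rewrite gtnNdvd //; clear -p4; lia.
Qed.

(** Compensates for 2 and 3, where only the trivial bound p^3 on [totroots p] is used: its value is
    2 at the prime 2, 3 at the prime 3, and 1 at other primes, so one factor 6 suffices for all
    m. *)
Definition small_factor (m : nat) : nat := ((1 + (2 %| m)) * (1 + (3 %| m).*2))%N.

Lemma small_factor_le6 m : (small_factor m <= 6)%N.
Proof. by rewrite /small_factor; case: (2 %| m)%N; case: (3 %| m)%N. Qed.

(** For p >= 5 the class A = 0 contributes at most p and each of the p - 1 other classes at most
    2. *)
Lemma totroots_prime_le p : prime p -> (totroots p <= 3 * p * small_factor p)%N.
Proof.
move=> pp; have p1 := prime_gt1 pp.
have triv A : (nrootsD A p <= p ^ 2)%N.
  by rewrite -[X in (_ <= X)%N]card_ord -sum1_card; apply: leq_sum => b _; case: (dvZ _ _).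
case: (ltnP 4 p) => [p4|p4]; last first.
  apply: (leq_trans (n := \sum_(a < p) p ^ 2)); first exact: leq_sum.
  rewrite sum_nat_const card_ord.
  by move: pp p1 p4 {triv}; case: p => [|[|[|[|[|p]]]]].
apply: (leq_trans (n := 3 * p)); last by rewrite leq_pmulr // /small_factor muln_gt0.
rewrite /totroots; case: p pp p1 triv p4 => // p pp p1 triv p4; rewrite big_ord_recl.
apply: (leq_trans (n := p.+1 + p * 2)); last by clear; lia.
apply: leq_add; first exact: nrootsD_le_p.
rewrite -[p in (p * 2)%N]card_ord -sum_nat_const; apply: leq_sum => i _.
apply: nroots_prime_le2 => //.
have small k : (0 < k < 5)%N -> dvZ p.+1 (Z.of_nat k) = false.
  by move=> kk; rewrite /dvZ Zabs2Nat.id gtnNdvd //; clear -p4 kk; lia.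
have h2 := small 2%N isT; have h3 := small 3%N isT; rewrite /= in h2 h3.
have pi : dvZ p.+1 (Z.of_nat (lift ord0 i)) = false.
  by rewrite /dvZ Zabs2Nat.id gtnNdvd // /= /bump /= add1n ltnS.
have pi3 : dvZ p.+1 (Z.of_nat (lift ord0 i) ^ 3)%Z = false.
  by rewrite (_ : _ ^ 3 = Z.of_nat (lift ord0 i) * (Z.of_nat (lift ord0 i) * Z.of_nat (lift ord0 i)))%Z
    ?prime_gauss ?pi //; ring.
have h27 : dvZ p.+1 27 = false by rewrite -[27%Z]/(3 * (3 * 3))%Z !prime_gauss // h3.
have h4 := small 4%N isT; rewrite /= in h4.
by rewrite (prime_gauss _ (2 * _) 27) // (prime_gauss _ 2) // (prime_gauss _ 4) // h2 h4 pi3 h27.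
Qed.

Lemma small_factor_mulp p d : prime p -> ~~ (p %| d)%N ->
  small_factor (p * d) = (small_factor p * small_factor d)%N.
Proof.
move=> pp pd; rewrite /small_factor !Euclid_dvdM // !(@dvdn_prime2 _ p) //.
case: (eqVneq 2%N p) pd => [<- pd|_ pd]; first by rewrite (negPf pd) orbF; case: (3 %| d)%N.
case: (eqVneq 3%N p) pd => [<- pd|_ pd]; first by rewrite (negPf pd) orbF; case: (2 %| d)%N.
by rewrite !addn0 !mul1n.
Qed.

Lemma totroots_le m : sqf m -> (totroots m <= 6 * 3 ^ size (primes m) * m)%N.
Proof.
move=> sm; apply: (leq_trans (n := 3 ^ size (primes m) * m * small_factor m)); last first.
  by rewrite -(mulnA 6%N) (mulnC 6%N) leq_mul2l small_factor_le6 orbT.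
move: m sm; apply: sqf_ind => [|p d pp pd sd IH]; first by rewrite totroots1.
have d0 := sqf_gt0 _ sd.
rewrite totroots_mulp // (perm_size (primes_mulp _ _ pp pd d0)) expnS small_factor_mulp //.
apply: leq_trans (leq_mul (totroots_prime_le p pp) IH) _.
apply: eq_leq; rewrite [size _]/=.
move: (3 ^ size (primes d))%N (small_factor p) (small_factor d); clear; lia.
Qed.

(** The density of the pairs with d^2 | Delta for squarefree d: A matters mod d and B mod d^2, which
    makes d^3 pairs of classes. At primes it is rho(p^2) / p^4. *)
Definition gdens (d : nat) : R := INR (totroots d) / INR d ^ 3.

Lemma gdens_sfmult : sfmult gdens.
Proof.
split; first by rewrite /gdens totroots1 /=; field.
move=> p d pp pd sd; rewrite /gdens totroots_mulp // !mult_INR.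
have := INR_gt0 _ (prime_gt0 pp); have := INR_gt0 _ (sqf_gt0 _ sd).
by move=> *; field; split; lra.
Qed.

Lemma gdens_prime p : prime p -> gdens p = INR (rho (Nat.pow p 2)) / INR (Nat.pow p 4).
Proof.
move=> pp; rewrite !Nat_powE rho_prime_sq // mult_INR INR_expn /gdens.
by have := INR_gt0 _ (prime_gt0 pp) => ?; field; lra.
Qed.

Lemma gdens_ge0 d : 0 <= gdens d.
Proof.
rewrite /gdens; case: d => [|d]; first by rewrite /totroots big_ord0 /Rdiv /=; lra.
have := INR_gt0 d.+1 isT => h; apply: Rmult_le_pos; first exact: pos_INR.
by apply: Rlt_le; apply: Rinv_0_lt_compat; apply: pow_lt.
Qed.

Lemma rho_le q : (rho q <= q ^ 2)%N.
Proof.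
rewrite /rho expnS expn1; apply: (leq_trans (n := \sum_(a < q) q)); last by rewrite sum_nat_const card_ord.
apply: leq_sum => a _; rewrite -[X in (_ <= X)%N]card_ord -sum1_card.
by apply: leq_sum => b _; case: (_ %| _)%N.
Qed.

Lemma gdens_prime_le1 p : prime p -> gdens p <= 1.
Proof.
move=> pp; rewrite gdens_prime // !Nat_powE.
have h := INR_gt0 _ (prime_gt0 pp); have h4 : 0 < INR (p ^ 4) by rewrite INR_expn; apply: pow_lt.
apply: (Rmult_le_reg_r (INR (p ^ 4))) => //; rewrite /Rdiv Rmult_assoc Rinv_l; last lra.
rewrite Rmult_1_r Rmult_1_l; apply: leq_INR.
by apply: leq_trans (rho_le _) _; rewrite -expnM.
Qed.

Lemma gdens_le d : sqf d -> gdens d <= 6 * 3 ^ size (primes d) / INR d ^ 2.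
Proof.
move=> sd; have h := INR_gt0 _ (sqf_gt0 _ sd).
have := leq_INR _ _ (totroots_le d sd); rewrite !mult_INR INR_expn => H.
apply: (Rmult_le_reg_r (INR d ^ 3)); first exact: pow_lt.
rewrite /gdens; have -> : INR (totroots d) / INR d ^ 3 * INR d ^ 3 = INR (totroots d) by field; lra.
have -> : 6 * 3 ^ size (primes d) / INR d ^ 2 * INR d ^ 3 = 6 * 3 ^ size (primes d) * INR d by field; lra.
move: H; have -> : INR 6 = 6 by rewrite /=; lra.
by have -> : INR 3 = 3 by rewrite /=; lra.
Qed.

(** * Lattice points in the box *)

Section PeriodicSum.
Context (f : Z -> R) (q : nat) (q0 : (0 < q)%N)
  (f0 : forall k, 0 <= f k) (fq : forall k, f (k + Z.of_nat q)%Z = f k).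

Let csum (s : Z) (n : nat) : R := \rsum_(i <- iota 0 n) f (s + Z.of_nat i)%Z.

Let csum_ge0 s n : 0 <= csum s n.
Proof. exact: rsum_ge0. Qed.

Let csumS s n : csum s n.+1 = csum s n + f (s + Z.of_nat n)%Z.
Proof. by rewrite /csum iotaSr rsum_cat big_seq1. Qed.

Let csumSl s n : csum s n.+1 = f s + csum (s + 1) n.
Proof.
elim: n => [|n IH]; first by rewrite csumS /csum !big_nil Z.add_0_r; lra.
rewrite csumS IH csumS; have -> : (s + Z.of_nat n.+1 = s + 1 + Z.of_nat n)%Z by lia.
lra.
Qed.

Let csum_shift s : csum (s + 1) q = csum s q.
Proof. by have := csumS s q; rewrite csumSl fq; lra. Qed.

Let csum_period s : csum s q = csum 0 q.
Proof.
elim/Z.peano_ind: s => [//|s IH|s IH]; first exact: etrans (csum_shift s) IH.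
by rewrite -(csum_shift (Z.pred s)) -IH; congr csum; lia.
Qed.

Let csum_add s m n : csum s (m + n) = csum s m + csum (s + Z.of_nat m) n.
Proof.
elim: n => [|n IH]; first by rewrite addn0 /csum big_nil; lra.
rewrite addnS !csumS IH; have -> : (s + Z.of_nat (m + n) = s + Z.of_nat m + Z.of_nat n)%Z by lia.
lra.
Qed.

Let csum_mul s k : csum s (k * q) = INR k * csum 0 q.
Proof.
elim: k => [|k IH]; first by rewrite /csum big_nil /=; lra.
by rewrite mulSn addnC csum_add IH csum_period S_INR; lra.
Qed.

Let csum_bounds s n : INR n / INR q * csum 0 q - csum 0 q <= csum s n
  <= INR n / INR q * csum 0 q + csum 0 q.
Proof.
have F0 := csum_ge0 0 q; have q0' := INR_gt0 _ q0.
have -> : csum s n = csum s (n %/ q * q + n %% q) by rewrite -divn_eq.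
rewrite csum_add csum_mul.
set r := (n %% q)%N; set k := (n %/ q)%N.
have rq : (r < q)%N by rewrite ltn_pmod.
set s' := (s + _)%Z.
have h1 : csum s' r <= csum 0 q.
  rewrite -(csum_period s') -(subnKC (ltnW rq)) csum_add.
  by have := csum_ge0 (s' + Z.of_nat r) (q - r); lra.
have h0 := csum_ge0 s' r.
have e : INR n / INR q = INR k + INR r / INR q.
  by rewrite {1}(divn_eq n q) plus_INR mult_INR -/r -/k; field; lra.
have hr : 0 <= INR r / INR q <= 1.
  split; first by apply: Rmult_le_pos; [exact: pos_INR | apply: Rlt_le; exact: Rinv_0_lt_compat].
  apply: (Rmult_le_reg_r (INR q)) => //; rewrite /Rdiv Rmult_assoc Rinv_l; last lra.
  by have := leq_INR _ _ (ltnW rq); lra.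
have hr1 : 0 <= INR r / INR q * csum 0 q by apply: Rmult_le_pos; lra.
have hr2 : INR r / INR q * csum 0 q <= 1 * csum 0 q by apply: Rmult_le_compat_r; lra.
rewrite e; lra.
Qed.

(** A window of 2 N + 1 terms consists of full periods and an incomplete one, which costs at most
    one period sum. Replacing 2 N + 1 by 2 x changes the main term by at most 1 / q of a period
    sum. *)
Lemma zsum_periodic (N : nat) (x : R) : INR N <= x < INR N + 1 ->
  Rabs (\rsum_(k <- Zrange N) f k - 2 * x / INR q * \rsum_(b <- iota 0 q) f (Z.of_nat b))
    <= 2 * \rsum_(b <- iota 0 q) f (Z.of_nat b).
Proof.
move=> Hx; have F0 := csum_ge0 0 q; have q1 := INR_ge1 _ q0.
have -> : \rsum_(b <- iota 0 q) f (Z.of_nat b) = csum 0 q by [].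
have -> : \rsum_(k <- Zrange N) f k = csum (- Z.of_nat N) (2 * N).+1.
  by rewrite /Zrange big_map /csum; apply: eq_bigr => i _; congr f; lia.
have [h1 h2] := csum_bounds (- Z.of_nat N) (2 * N).+1.
set F := csum 0 q in F0 h1 h2 *.
have i0 : 0 < / INR q by apply: Rinv_0_lt_compat; lra.
have i1 : / INR q <= 1 by rewrite -Rinv_1; apply: Rinv_le_contravar; lra.
have u0 : 0 <= / INR q * F by apply: Rmult_le_pos; lra.
have u1 : / INR q * F <= 1 * F by apply: Rmult_le_compat_r; lra.
have e1 y : y / INR q * F = y * (/ INR q * F) by rewrite /Rdiv; ring.
rewrite !e1 in h1 h2 *; rewrite S_INR mult_INR [INR 2]/= in h1 h2.
set u := / INR q * F in u0 u1 h1 h2 *.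
have h3 : 2 * x * u <= (2 * INR N + 2) * u by apply: Rmult_le_compat_r; lra.
have h4 : 2 * INR N * u <= 2 * x * u by apply: Rmult_le_compat_r; lra.
apply: Rabs_le; lra.
Qed.
End PeriodicSum.

Lemma dvZ_Delta_period (q : nat) A k : dvZ q (Delta A (k + Z.of_nat q)) = dvZ q (Delta A k).
Proof.
apply: dvZ_congr; exists (27 * (2 * k + Z.of_nat q))%Z; rewrite /Delta; ring.
Qed.

Lemma INR_nrootsD A d : INR (nrootsD A d) =
  \rsum_(b <- iota 0 (d ^ 2)) INR (dvZ (d ^ 2) (Delta A (Z.of_nat b))).
Proof.
pose F b := INR (dvZ (d ^ 2) (4 * A ^ 3 + 27 * Z.of_nat b ^ 2)%Z).
by rewrite /nrootsD /nroots INR_sum -(big_mkord xpredT F) /index_iota subn0.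
Qed.

Lemma INR_totroots d : INR (totroots d) = \rsum_(a <- iota 0 d) INR (nrootsD (Z.of_nat a) d).
Proof.
by rewrite /totroots INR_sum -(big_mkord xpredT (fun a => INR (nrootsD (Z.of_nat a) d))) /index_iota subn0.
Qed.

Section BoxCount.
Context (a4 a6 : nat) (x4 x6 : R) (H4 : INR a4 <= x4 < INR a4 + 1) (H6 : INR a6 <= x6 < INR a6 + 1).

Definition boxdiv (d : nat) : R :=
  \rsum_(A <- Zrange a4) \rsum_(B <- Zrange a6) INR (dvZ (d ^ 2) (Delta A B)).

Lemma boxdiv_approx d : sqf d ->
  Rabs (boxdiv d - 4 * (x4 * x6) * gdens d)
    <= INR (totroots d) * (4 * x6 / INR d ^ 2 + 4 * x4 / INR d + 4).
Proof.
move=> sd; have d0 := sqf_gt0 _ sd; have d1 := INR_ge1 _ d0.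
have x40 : 0 <= x4 by have := pos_INR a4; lra.
have x60 : 0 <= x6 by have := pos_INR a6; lra.
have col A : Rabs (\rsum_(B <- Zrange a6) INR (dvZ (d ^ 2) (Delta A B))
    - 2 * x6 / INR d ^ 2 * INR (nrootsD A d)) <= 2 * INR (nrootsD A d).
  rewrite INR_nrootsD -INR_expn.
  apply: (zsum_periodic (fun B => INR (dvZ (d ^ 2) (Delta A B)))) => //.
  - by rewrite expn_gt0 d0.
  - by move=> k; exact: pos_INR.
  - by move=> k; rewrite dvZ_Delta_period.
have row : Rabs (\rsum_(A <- Zrange a4) INR (nrootsD A d) - 2 * x4 / INR d * INR (totroots d))
    <= 2 * INR (totroots d).
  rewrite INR_totroots; apply: (zsum_periodic (fun A => INR (nrootsD A d))) => //.
  - by move=> k; exact: pos_INR.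
  - by move=> k; rewrite (nrootsD_periodic k) //; exists 1%Z; lia.
set SA := \rsum_(A <- Zrange a4) INR (nrootsD A d) in row.
have tot : Rabs (boxdiv d - 2 * x6 / INR d ^ 2 * SA) <= 2 * SA.
  rewrite /boxdiv /SA -!rsum_mull -rsum_sub; apply: Rle_trans (rsum_abs _ _ _) _.
  by apply: rsum_le => A _; exact: col.
have R0 := pos_INR (totroots d); set T := INR (totroots d) in row R0 *.
have c0 : 0 <= 2 * x6 / INR d ^ 2.
  by apply: Rmult_le_pos; [lra | apply: Rlt_le; apply: Rinv_0_lt_compat; apply: pow_lt; lra].
set c := 2 * x6 / INR d ^ 2 in tot c0.
have -> : 4 * (x4 * x6) * gdens d = c * (2 * x4 / INR d * T) by rewrite /gdens -/T /c; field; lra.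
have -> : 4 * x6 / INR d ^ 2 = 2 * c by rewrite /c; field; lra.
have h1 : Rabs (c * SA - c * (2 * x4 / INR d * T)) <= c * (2 * T).
  rewrite -Rmult_minus_distr_l Rabs_mult (Rabs_pos_eq c) //.
  by apply: Rmult_le_compat_l.
have h2 : SA <= 2 * x4 / INR d * T + 2 * T by have := Rle_abs (SA - 2 * x4 / INR d * T); lra.
have -> : T * (2 * c + 4 * x4 / INR d + 4) = 2 * (2 * x4 / INR d * T + 2 * T) + c * (2 * T) by field; lra.
have -> : boxdiv d - c * (2 * x4 / INR d * T) =
  (boxdiv d - c * SA) + (c * SA - c * (2 * x4 / INR d * T)) by ring.
by apply: Rle_trans (Rabs_triang _ _) _; lra.
Qed.
End BoxCount.

(** * Index forms *)

(** Over a field, a cubic x^3 + A x + B of discriminant zero with 2 A nonzero has the double root -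
    3 B / (2 A). Here (2 A)^3 f(u) = - B Delta and (2 A)^2 f'(u) = Delta mod d^2, and 2 A is
    invertible. For the derivative, divisibility by d is what the lattice uses. *)
Lemma double_root_exists (A B d : Z) :
  (Z.gcd (d ^ 2) (2 * A) = 1)%Z -> (d ^ 2 | Delta A B)%Z ->
  exists u, (d ^ 2 | u ^ 3 + A * u + B)%Z /\ (d | 3 * u ^ 2 + A)%Z.
Proof.
move=> g1 [k Hk].
have [v [w Hb]] : exists v w, (v * d ^ 2 + w * (2 * A) = 1)%Z.
  by have := Z.gcd_bezout (d ^ 2) (2 * A) 1 g1.
pose u := (- 3 * B * w)%Z.
have Hu : (2 * A * u = - 3 * B + d ^ 2 * (3 * B * v))%Z.
  have -> : (2 * A * u = - 3 * B * (w * (2 * A)))%Z by rewrite /u; ring.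
  have -> : (w * (2 * A) = 1 - v * d ^ 2)%Z by lia.
  ring.
have cop n : Z.gcd (d ^ 2) ((2 * A) ^ n) = 1%Z \/ (n < 0)%Z.
  case: (Z_lt_le_dec n 0) => [|n0]; [by right|left].
  apply/Zgcd_1_rel_prime; apply: rel_prime_Zpower_r => //.
  exact/Zgcd_1_rel_prime.
have gauss n x : (0 <= n)%Z -> (d ^ 2 | (2 * A) ^ n * x)%Z -> (d ^ 2 | x)%Z.
  by move=> n0 H; apply: Z.gauss H _; case: (cop n) => //; lia.
set t := (3 * B * v)%Z in Hu.
exists u; split.
  apply: (gauss 3%Z) => //.
  have -> : ((2 * A) ^ 3 * (u ^ 3 + A * u + B) =
    (2 * A * u) ^ 3 + 4 * A ^ 3 * (2 * A * u) + 8 * A ^ 3 * B)%Z by ring.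
  rewrite Hu; move: Hk; rewrite /Delta => Hk.
  exists (- B * k + 27 * B ^ 2 * t - 9 * B * t ^ 2 * d ^ 2 + t ^ 3 * d ^ 4 + 4 * A ^ 3 * t)%Z.
  by apply: (Z.add_reg_l (B * (4 * A ^ 3 + 27 * B ^ 2))); rewrite {2}Hk; ring.
apply: (Z.divide_trans _ (d ^ 2)); first by exists d; ring.
apply: (gauss 2%Z) => //.
have -> : ((2 * A) ^ 2 * (3 * u ^ 2 + A) = 3 * (2 * A * u) ^ 2 + 4 * A ^ 3)%Z by ring.
rewrite Hu; move: Hk; rewrite /Delta => Hk.
exists (k - 18 * B * t + 3 * t ^ 2 * d ^ 2)%Z.
by move: Hk; clear; lia.
Qed.

Definition cub (A B x y : Z) : Z := (x ^ 3 + A * x * y ^ 2 + B * y ^ 3)%Z.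

(* The polar form of [cub]: the coefficient of s^2 t in [cub] at s (x1, y1) + t (x2, y2). *)
Definition cub21 (A B x1 y1 x2 y2 : Z) : Z :=
  (3 * x1 ^ 2 * x2 + A * (x2 * y1 ^ 2 + 2 * x1 * y1 * y2) + 3 * B * y1 ^ 2 * y2)%Z.

Section IndexForm.
Variables A B d u : Z.
Context (fu : (d ^ 2 | u ^ 3 + A * u + B)%Z).
Context (fu' : (d | 3 * u ^ 2 + A)%Z).

(** Taylor expansion at u: the value is f(u) y^3 + f'(u) d z y^2 + 3 u d^2 z^2 y + d^3 z^3, and d^2
    divides every term. *)
Lemma cub_lattice y z : (d ^ 2 | cub A B (u * y + d * z) y)%Z.
Proof.
case: fu fu' => g Hg [h Hh].
exists (d * z ^ 3 + 3 * u * z ^ 2 * y + h * z * y ^ 2 + g * y ^ 3)%Z.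
have -> : A = (h * d - 3 * u ^ 2)%Z by lia.
have -> : B = (g * d ^ 2 - u ^ 3 - (h * d - 3 * u ^ 2) * u)%Z by rewrite -Hg -Hh; ring.
rewrite /cub; ring.
Qed.

Lemma cub21_lattice y1 z1 y2 z2 :
  (d ^ 2 | cub21 A B (u * y1 + d * z1) y1 (u * y2 + d * z2) y2)%Z.
Proof.
case: fu fu' => g Hg [h Hh].
exists (d * (3 * z1 ^ 2 * z2) + 3 * u * (2 * z1 * z2 * y1 + z1 ^ 2 * y2)
        + h * (z2 * y1 ^ 2 + 2 * z1 * y1 * y2) + g * (3 * y1 ^ 2 * y2))%Z.
have -> : A = (h * d - 3 * u ^ 2)%Z by lia.
have -> : B = (g * d ^ 2 - u ^ 3 - (h * d - 3 * u ^ 2) * u)%Z by rewrite -Hg -Hh; ring.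
rewrite /cub21; ring.
Qed.
End IndexForm.

(* The quadratic and cubic covariants of a x^3 + b x^2 y + c x y^2 + e y^3, normalized so that for
   x^3 + A x y^2 + B y^3 their leading coefficients are - 3 A and 27 B. *)
Definition hess (a b c e x y : Z) : Z :=
  ((b ^ 2 - 3 * a * c) * x ^ 2 + (b * c - 9 * a * e) * (x * y) + (c ^ 2 - 3 * b * e) * y ^ 2)%Z.

Definition jcov (a b c e x y : Z) : Z :=
  ((2 * b ^ 3 - 9 * a * b * c + 27 * a ^ 2 * e) * x ^ 3
   + 3 * (b ^ 2 * c + 9 * a * b * e - 6 * a * c ^ 2) * (x ^ 2 * y)
   - 3 * (b * c ^ 2 + 9 * a * c * e - 6 * b ^ 2 * e) * (x * y ^ 2)
   - (2 * c ^ 3 - 9 * b * c * e + 27 * a * e ^ 2) * y ^ 3)%Z.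

(** With v1, v2 the two vectors and D their determinant, y2 v1 - y1 v2 = (D, 0). The Hessian has
    weight 2 under the change of basis and is quadratic in the variables, which gives D^2 times - 3
    A D^2. The cubic covariant has weight 3, hence D^6 in [jcov_cub]. *)
Lemma hess_cub A B x1 y1 x2 y2 :
  (hess (cub A B x1 y1) (cub21 A B x1 y1 x2 y2) (cub21 A B x2 y2 x1 y1) (cub A B x2 y2)
     y2 (- y1) = - 3 * A * (x1 * y2 - x2 * y1) ^ 4)%Z.
Proof. rewrite /hess /cub /cub21; ring. Qed.

Lemma jcov_cub A B x1 y1 x2 y2 :
  (jcov (cub A B x1 y1) (cub21 A B x1 y1 x2 y2) (cub21 A B x2 y2 x1 y1) (cub A B x2 y2)
     y2 (- y1) = 27 * B * (x1 * y2 - x2 * y1) ^ 6)%Z.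
Proof. rewrite /jcov /cub /cub21; ring. Qed.

(** * Reduced lattice bases and the size of the index form *)

Definition bnorm (L x y : Z) : Z := Z.max (Z.abs x) (L * Z.abs y).

Lemma nearest_multiple (a b : Z) : b <> 0%Z ->
  exists k, (2 * Z.abs (a - k * b) <= Z.abs b)%Z.
Proof.
move=> b0; have Hb : (0 < Z.abs b)%Z by lia.
have H := Z_div_mod_eq_full (2 * a + Z.abs b) (2 * Z.abs b).
have [H1 H2] := Z.mod_pos_bound (2 * a + Z.abs b) (2 * Z.abs b) ltac:(lia).
set q := ((_ + _) / _)%Z in H; set m := ((_ + _) mod _)%Z in H H1 H2.
have H3 : (2 * Z.abs (a - q * Z.abs b) <= Z.abs b)%Z by nia.
case: (Z_lt_le_dec b 0) => b1; [exists (- q)%Z|exists q].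
  by have <- : (a - q * Z.abs b = a - - q * b)%Z by nia.
by have <- : (a - q * Z.abs b = a - q * b)%Z by nia.
Qed.

(** The norms are |x1| and L |y2|, since |x2| is too small to be the norm of the second vector. From
    2 |x2| L |y1| <= x1^2 <= |x1| L |y2| the cross term in the determinant is at most half of |x1
    y2|, so d >= |x1 y2| / 2. *)
Lemma reduced_det_x (L d x1 y1 x2 y2 : Z) : (0 < L)%Z ->
  Z.abs (x1 * y2 - x2 * y1) = d -> (L * Z.abs y1 <= Z.abs x1)%Z ->
  (2 * Z.abs x2 <= Z.abs x1)%Z -> (bnorm L x1 y1 <= bnorm L x2 y2)%Z -> x1 <> 0%Z ->
  (bnorm L x1 y1 * bnorm L x2 y2 <= 2 * d * L)%Z.
Proof.
rewrite /bnorm => L0 Hd H1 H2 H3 x0.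
have e1 : Z.max (Z.abs x1) (L * Z.abs y1) = Z.abs x1 by lia.
rewrite e1 in H3 *.
have e2 : Z.max (Z.abs x2) (L * Z.abs y2) = (L * Z.abs y2)%Z by lia.
rewrite e2 in H3 *.
have Hd' : (Z.abs x1 * Z.abs y2 - Z.abs x2 * Z.abs y1 <= d)%Z by rewrite -!Z.abs_mul; lia.
have : (L * (Z.abs x1 * Z.abs y2 - Z.abs x2 * Z.abs y1) <= L * d)%Z by apply: Z.mul_le_mono_nonneg_l; lia.
have : (2 * Z.abs x2 * (L * Z.abs y1) <= Z.abs x1 * Z.abs x1)%Z by apply: Z.mul_le_mono_nonneg; lia.
have : (Z.abs x1 * Z.abs x1 <= Z.abs x1 * (L * Z.abs y2))%Z by apply: Z.mul_le_mono_nonneg_l; lia.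
lia.
Qed.

Lemma reduced_det_y (L d x1 y1 x2 y2 : Z) : (0 < L)%Z ->
  Z.abs (x1 * y2 - x2 * y1) = d -> (Z.abs x1 <= L * Z.abs y1)%Z ->
  (2 * Z.abs y2 <= Z.abs y1)%Z -> (bnorm L x1 y1 <= bnorm L x2 y2)%Z -> y1 <> 0%Z ->
  (bnorm L x1 y1 * bnorm L x2 y2 <= 2 * d * L)%Z.
Proof.
rewrite /bnorm => L0 Hd H1 H2 H3 x0.
have e1 : Z.max (Z.abs x1) (L * Z.abs y1) = (L * Z.abs y1)%Z by lia.
rewrite e1 in H3 *.
have Hy : (L * (2 * Z.abs y2) <= L * Z.abs y1)%Z by apply: Z.mul_le_mono_nonneg_l; lia.
have Hy1 : (0 < L * Z.abs y1)%Z by apply: Z.mul_pos_pos; lia.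
have e2 : Z.max (Z.abs x2) (L * Z.abs y2) = (Z.abs x2)%Z by lia.
rewrite e2 in H3 *.
have Hd' : (Z.abs x2 * Z.abs y1 - Z.abs x1 * Z.abs y2 <= d)%Z by rewrite -!Z.abs_mul; lia.
have : (L * (Z.abs x2 * Z.abs y1 - Z.abs x1 * Z.abs y2) <= L * d)%Z by apply: Z.mul_le_mono_nonneg_l; lia.
have : (Z.abs x1 * (L * (2 * Z.abs y2)) <= L * Z.abs y1 * (L * Z.abs y1))%Z.
  by apply: Z.mul_le_mono_nonneg; lia.
have : (L * Z.abs y1 * (L * Z.abs y1) <= L * Z.abs y1 * Z.abs x2)%Z by apply: Z.mul_le_mono_nonneg_l; lia.
lia.
Qed.

(* Gauss reduction for the sup norm: repeatedly subtract from the longer vector the multiple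
   of the shorter one that at least halves its dominant coordinate. *)
Lemma reduced_basis (L d u : Z) : (0 < L)%Z -> (0 < d)%Z ->
  exists y1 z1 y2 z2, let x1 := (u * y1 + d * z1)%Z in let x2 := (u * y2 + d * z2)%Z in
  [/\ Z.abs (z1 * y2 - z2 * y1) = 1%Z, (bnorm L x1 y1 <= bnorm L x2 y2)%Z
    & (bnorm L x1 y1 * bnorm L x2 y2 <= 2 * d * L)%Z].
Proof.
move=> L0 d0.
suff red : forall (n : nat) y1 z1 y2 z2,
    (Z.to_nat (bnorm L (u * y1 + d * z1) y1 + bnorm L (u * y2 + d * z2) y2) <= n)%N ->
    Z.abs (z1 * y2 - z2 * y1) = 1%Z ->
    exists y1 z1 y2 z2, let x1 := (u * y1 + d * z1)%Z in let x2 := (u * y2 + d * z2)%Z in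
    [/\ Z.abs (z1 * y2 - z2 * y1) = 1%Z, (bnorm L x1 y1 <= bnorm L x2 y2)%Z
      & (bnorm L x1 y1 * bnorm L x2 y2 <= 2 * d * L)%Z].
  (* The starting basis is (d, 0), (u, 1). *)
  by apply: (red _ 0%Z 1%Z 1%Z 0%Z (leqnn _)).
elim/ltn_ind => n IH.
(* By symmetry the first vector may be taken as the shorter one. *)
suff main : forall y1 z1 y2 z2,
    (Z.to_nat (bnorm L (u * y1 + d * z1) y1 + bnorm L (u * y2 + d * z2) y2) <= n)%N ->
    Z.abs (z1 * y2 - z2 * y1) = 1%Z ->
    (bnorm L (u * y1 + d * z1) y1 <= bnorm L (u * y2 + d * z2) y2)%Z ->
    exists y1 z1 y2 z2, let x1 := (u * y1 + d * z1)%Z in let x2 := (u * y2 + d * z2)%Z in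
    [/\ Z.abs (z1 * y2 - z2 * y1) = 1%Z, (bnorm L x1 y1 <= bnorm L x2 y2)%Z
      & (bnorm L x1 y1 * bnorm L x2 y2 <= 2 * d * L)%Z].
  move=> y1 z1 y2 z2 Hn Hd.
  case: (Z_le_gt_dec (bnorm L (u * y1 + d * z1) y1) (bnorm L (u * y2 + d * z2) y2)) => [|] Hc.
    exact: (main y1 z1 y2 z2).
  by apply: (main y2 z2 y1 z1); lia.
move=> y1 z1 y2 z2 Hn Hd Hle.
have nn x y : (0 <= bnorm L x y)%Z by rewrite /bnorm; lia.
set x1 := (u * y1 + d * z1)%Z in Hn Hle; set x2 := (u * y2 + d * z2)%Z in Hn Hle.
have Hv1 : (x1 <> 0 \/ y1 <> 0)%Z.
  case: (Z.eq_dec y1 0) => [y10|]; [left|by right].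
  by rewrite /x1 y10 => ?; have z10 : (z1 = 0)%Z; [nia | move: Hd; rewrite z10 y10; lia].
(* Either the shortened vector drops below the first one and the sum of the norms, the induction
   measure, decreases ([step]), or the pair is already reduced ([done]). *)
have step k : (bnorm L (x2 - k * x1) (y2 - k * y1) < bnorm L x1 y1)%Z ->
    exists y1 z1 y2 z2, let x1 := (u * y1 + d * z1)%Z in let x2 := (u * y2 + d * z2)%Z in
    [/\ Z.abs (z1 * y2 - z2 * y1) = 1%Z, (bnorm L x1 y1 <= bnorm L x2 y2)%Z
      & (bnorm L x1 y1 * bnorm L x2 y2 <= 2 * d * L)%Z].
  move=> Hk; have ex : (x2 - k * x1 = u * (y2 - k * y1) + d * (z2 - k * z1))%Z by rewrite /x1 /x2; ring.
  have Hlt : (Z.to_nat (bnorm L x1 y1 + bnorm L (x2 - k * x1) (y2 - k * y1)) < n)%N.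
    by have := nn x1 y1; have := nn (x2 - k * x1)%Z (y2 - k * y1)%Z; lia.
  apply: (IH _ Hlt y1 z1 (y2 - k * y1)%Z (z2 - k * z1)%Z); first by rewrite -/x1 -ex.
  by rewrite -Hd; congr Z.abs; ring.
have done k : (bnorm L x1 y1 <= bnorm L (x2 - k * x1) (y2 - k * y1))%Z ->
    (bnorm L x1 y1 * bnorm L (x2 - k * x1) (y2 - k * y1) <= 2 * d * L)%Z ->
    exists y1 z1 y2 z2, let x1 := (u * y1 + d * z1)%Z in let x2 := (u * y2 + d * z2)%Z in
    [/\ Z.abs (z1 * y2 - z2 * y1) = 1%Z, (bnorm L x1 y1 <= bnorm L x2 y2)%Z
      & (bnorm L x1 y1 * bnorm L x2 y2 <= 2 * d * L)%Z].
  move=> H1 H2; have ex : (x2 - k * x1 = u * (y2 - k * y1) + d * (z2 - k * z1))%Z by rewrite /x1 /x2; ring.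
  exists y1, z1, (y2 - k * y1)%Z, (z2 - k * z1)%Z; rewrite /= -/x1 -ex; split=> //.
  by rewrite -Hd; congr Z.abs; ring.
have Hdet k : Z.abs (x1 * (y2 - k * y1) - (x2 - k * x1) * y1) = d.
  have -> : (x1 * (y2 - k * y1) - (x2 - k * x1) * y1 = d * (z1 * y2 - z2 * y1))%Z by rewrite /x1 /x2; ring.
  by rewrite Z.abs_mul Hd; lia.
case: (Z_le_gt_dec (L * Z.abs y1) (Z.abs x1)) => Hc.
  have x10 : x1 <> 0%Z by move=> x10; case: Hv1 => // y10; nia.
  have [k Hk] := nearest_multiple x2 x1 x10.
  case: (Z_lt_le_dec (bnorm L (x2 - k * x1) (y2 - k * y1)) (bnorm L x1 y1)) => [/step//|Hb].
  by apply: (done k) => //; apply: reduced_det_x.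
have y10 : y1 <> 0%Z by move=> y10; rewrite y10 in Hc; lia.
have [k Hk] := nearest_multiple y2 y1 y10.
case: (Z_lt_le_dec (bnorm L (x2 - k * x1) (y2 - k * y1)) (bnorm L x1 y1)) => [/step//|Hb].
by apply: (done k) => //; apply: reduced_det_y => //; lia.
Qed.

(** The rational root theorem: after removing the gcd, y' divides x'^3 and is coprime to x', so y'
    is 1 or -1 and x' / y' is an integral root. *)
Lemma cub_neq0 (A B x y : Z) : (forall r, r ^ 3 + A * r + B <> 0)%Z ->
  (x <> 0 \/ y <> 0)%Z -> cub A B x y <> 0%Z.
Proof.
rewrite /cub => nr xy; case: (Z.eq_dec y 0) => [y0|y0 H].
  have x0 : x <> 0%Z by case: xy => // /(_ y0).
  by rewrite y0 => H; apply: x0; apply: (Z.pow_eq_0 _ 3); lia.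
have g0 : Z.gcd x y <> 0%Z by move=> /Z.gcd_eq_0_r.
case: (Z.gcd_divide_l x y) => x' Hx; case: (Z.gcd_divide_r x y) => y' Hy.
set g := Z.gcd x y in g0 Hx Hy.
have cop : Z.gcd x' y' = 1%Z.
  apply: (Z.mul_reg_r _ _ g) => //.
  rewrite -Z.gcd_mul_mono_r_nonneg; last exact: Z.gcd_nonneg.
  by rewrite -Hx -Hy Z.mul_1_l.
have H' : (x' ^ 3 + A * x' * y' ^ 2 + B * y' ^ 3 = 0)%Z.
  apply: (Z.mul_reg_r _ _ (g ^ 3)); first exact: Z.pow_nonzero.
  by rewrite Z.mul_0_l -H Hx Hy; ring.
have yx : (y' | x' ^ 3 * 1)%Z by exists (- A * x' * y' - B * y' ^ 2)%Z; lia.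
have y1 : (y' | 1)%Z.
  apply: (Z.gauss _ _ _ yx); apply/Zgcd_1_rel_prime; apply: rel_prime_Zpower_r => //.
  by apply/Zgcd_1_rel_prime; rewrite Z.gcd_comm.
have [e|e] : (y' = 1 \/ y' = -1)%Z by have := Z.divide_1_r_abs _ y1; lia.
  by apply: (nr x'); rewrite e in H'; lia.
by apply: (nr (- x')%Z); rewrite e in H'; lia.
Qed.

Lemma mul3_le (a b c a' b' c' : Z) : (0 <= a <= a')%Z -> (0 <= b <= b')%Z -> (0 <= c <= c')%Z ->
  (a * b * c <= a' * b' * c')%Z.
Proof.
move=> *; have ab : (0 <= a * b)%Z by apply: Z.mul_nonneg_nonneg; lia.
have : (a * b <= a' * b')%Z by apply: Z.mul_le_mono_nonneg; lia.
by move=> *; apply: Z.mul_le_mono_nonneg; lia.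
Qed.

Lemma bnorm_gt0 L x y : (0 < L)%Z -> (x <> 0 \/ y <> 0)%Z -> (0 < bnorm L x y)%Z.
Proof.
rewrite /bnorm => L0 [x0|y0]; first by lia.
have : (0 < L * Z.abs y)%Z by apply: Z.mul_pos_pos; lia.
lia.
Qed.

Section FormBounds.
Context (A B L : Z) (L0 : (0 < L)%Z) (HA : (Z.abs A <= L ^ 2)%Z) (HB : (Z.abs B <= L ^ 3)%Z).

(** The factor L^2 bounding A is distributed over the two y-coordinates; likewise L^3 over three of
    them in [coefB_le]. Thus [cub] and its polar form are bounded by cubic monomials in the
    norms. *)
Lemma coefA_le x y y' X Y Y' : (Z.abs x <= X)%Z -> (L * Z.abs y <= Y)%Z ->
  (L * Z.abs y' <= Y')%Z -> (Z.abs (A * x * y * y') <= X * Y * Y')%Z.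
Proof.
move=> Hx Hy Hy'; rewrite !Z.abs_mul.
have h : (Z.abs A * (Z.abs x * Z.abs y * Z.abs y') <= L ^ 2 * (Z.abs x * Z.abs y * Z.abs y'))%Z.
  by apply: Z.mul_le_mono_nonneg_r => //; rewrite -!Z.abs_mul; lia.
have : (Z.abs x * (L * Z.abs y) * (L * Z.abs y') <= X * Y * Y')%Z by apply: mul3_le; lia.
lia.
Qed.

Lemma coefB_le y y' y'' Y Y' Y'' : (L * Z.abs y <= Y)%Z -> (L * Z.abs y' <= Y')%Z ->
  (L * Z.abs y'' <= Y'')%Z -> (Z.abs (B * y * y' * y'') <= Y * Y' * Y'')%Z.
Proof.
move=> Hy Hy' Hy''; rewrite !Z.abs_mul.
have h : (Z.abs B * (Z.abs y * Z.abs y' * Z.abs y'') <= L ^ 3 * (Z.abs y * Z.abs y' * Z.abs y''))%Z.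
  by apply: Z.mul_le_mono_nonneg_r => //; rewrite -!Z.abs_mul; lia.
have : (L * Z.abs y * (L * Z.abs y') * (L * Z.abs y'') <= Y * Y' * Y'')%Z by apply: mul3_le; lia.
lia.
Qed.

Lemma cub21_le x1 y1 x2 y2 N1 N2 :
  (bnorm L x1 y1 <= N1)%Z -> (bnorm L x2 y2 <= N2)%Z ->
  (Z.abs (cub21 A B x1 y1 x2 y2) <= 9 * (N1 ^ 2 * N2))%Z.
Proof.
rewrite /bnorm /cub21 => H1 H2.
have t1 : (Z.abs (x1 * x1 * x2) <= N1 * N1 * N2)%Z by rewrite !Z.abs_mul; apply: mul3_le; lia.
have t2 : (Z.abs (A * x2 * y1 * y1) <= N2 * N1 * N1)%Z by apply: coefA_le; lia.
have t3 : (Z.abs (A * x1 * y1 * y2) <= N1 * N1 * N2)%Z by apply: coefA_le; lia.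
have t4 : (Z.abs (B * y1 * y1 * y2) <= N1 * N1 * N2)%Z by apply: coefB_le; lia.
rewrite (_ : _ + _ = 3 * (x1 * x1 * x2) + A * x2 * y1 * y1 + 2 * (A * x1 * y1 * y2)
  + 3 * (B * y1 * y1 * y2))%Z; last by ring.
have e3 : (N2 * N1 * N1 = N1 * N1 * N2)%Z by ring.
rewrite (_ : N1 ^ 2 * N2 = N1 * N1 * N2)%Z; last by ring.
rewrite e3 in t2; move: t1 t2 t3 t4; clear.
move: (x1 * x1 * x2)%Z (A * x2 * y1 * y1)%Z (A * x1 * y1 * y2)%Z (B * y1 * y1 * y2)%Z (N1 * N1 * N2)%Z.
lia.
Qed.

Lemma cub_le x y N : (bnorm L x y <= N)%Z -> (Z.abs (cub A B x y) <= 3 * N ^ 3)%Z.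
Proof.
rewrite /bnorm /cub => H.
have t1 : (Z.abs (x * x * x) <= N * N * N)%Z by rewrite !Z.abs_mul; apply: mul3_le; lia.
have t2 : (Z.abs (A * x * y * y) <= N * N * N)%Z by apply: coefA_le; lia.
have t4 : (Z.abs (B * y * y * y) <= N * N * N)%Z by apply: coefB_le; lia.
rewrite (_ : _ + _ = x * x * x + A * x * y * y + B * y * y * y)%Z; last by ring.
rewrite (_ : N ^ 3 = N * N * N)%Z; last by ring.
move: t1 t2 t4; clear.
move: (x * x * x)%Z (A * x * y * y)%Z (B * y * y * y)%Z (N * N * N)%Z.
lia.
Qed.
End FormBounds.

(* If d^2 divides the discriminant then x^3 + A x + B is, up to scaling, represented by an integral
   binary cubic form of discriminant smaller by d^2 (the index form of an overring of index d),
   and A and B are recovered from the covariants of that form. *)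
Lemma index_form_exists (A B L d : Z) : (0 < L)%Z -> (0 < d)%Z ->
  (Z.abs A <= L ^ 2)%Z -> (Z.abs B <= L ^ 3)%Z ->
  (Z.gcd (d ^ 2) (2 * A) = 1)%Z -> (d ^ 2 | Delta A B)%Z ->
  (forall r, r ^ 3 + A * r + B <> 0)%Z ->
  exists a b c e y1 y2 N1 N2,
  [/\ [/\ a <> 0%Z, (0 < N1)%Z, (N1 <= N2)%Z & (N1 * N2 <= 2 * d * L)%Z],
      [/\ (Z.abs a * d ^ 2 <= 3 * N1 ^ 3)%Z, (Z.abs b * d ^ 2 <= 9 * (N1 ^ 2 * N2))%Z,
          (Z.abs c * d ^ 2 <= 9 * (N2 ^ 2 * N1))%Z & (Z.abs e * d ^ 2 <= 3 * N2 ^ 3)%Z],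
      (L * Z.abs y1 <= N1)%Z /\ (L * Z.abs y2 <= N2)%Z,
      hess a b c e y2 (- y1) = (- 3 * A)%Z & jcov a b c e y2 (- y1) = (27 * B)%Z].
Proof.
move=> L0 d0 HA HB Hg Hd nr.
have [u [fu fu']] := double_root_exists A B d Hg Hd.
have [y1 [z1 [y2 [z2 [Hdet H12 HN]]]]] := reduced_basis L d u L0 d0.
have [a Ha] := cub_lattice A B d u fu fu' y1 z1.
have [e He] := cub_lattice A B d u fu fu' y2 z2.
have [b Hb] := cub21_lattice A B d u fu fu' y1 z1 y2 z2.
have [c Hc] := cub21_lattice A B d u fu fu' y2 z2 y1 z1.
set x1 := (u * y1 + d * z1)%Z in H12 HN Ha Hb Hc.
set x2 := (u * y2 + d * z2)%Z in H12 HN He Hb Hc.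
have D : (x1 * y2 - x2 * y1 = d * (z1 * y2 - z2 * y1))%Z by rewrite /x1 /x2; ring.
have Hdet2 : ((z1 * y2 - z2 * y1) ^ 2 = 1)%Z.
  move: (z1 * y2 - z2 * y1)%Z Hdet; clear => s Hs.
  by have [->|->] : (s = 1 \/ s = -1)%Z by lia.
have Hv1 : (x1 <> 0 \/ y1 <> 0)%Z.
  case: (Z.eq_dec y1 0) => [y10|]; [left|by right].
  rewrite /x1 y10 Z.mul_0_r => /Z.mul_eq_0[|z10]; first by lia.
  by rewrite z10 y10 in Hdet; lia.
have d2 : (0 < d ^ 2)%Z by apply: Z.pow_pos_nonneg.
have absd q : (Z.abs q * d ^ 2 = Z.abs (q * d ^ 2))%Z.
  by rewrite Z.abs_mul (Z.abs_eq (d ^ 2)) //; exact: Z.lt_le_incl.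
exists a, b, c, e, y1, y2, (bnorm L x1 y1), (bnorm L x2 y2); split.
- split=> //.
  by move=> a0; apply: (cub_neq0 A B x1 y1 nr Hv1); rewrite Ha a0.
  exact: bnorm_gt0.
- rewrite !absd -Ha -Hb -Hc -He; split.
  + by apply: (cub_le _ _ L) => //; exact: Z.le_refl.
  + by apply: (cub21_le _ _ L) => //; exact: Z.le_refl.
  + by apply: (cub21_le _ _ L) => //; exact: Z.le_refl.
  + by apply: (cub_le _ _ L) => //; exact: Z.le_refl.
- by split; exact: Z.le_max_r.
(* The coefficients were divided by d^2 and [hess] is quadratic in them, which cancels the fourth
   power of the determinant, equal to d up to sign. The cubic [jcov] cancels the sixth. *)
- have := hess_cub A B x1 y1 x2 y2; rewrite Ha Hb Hc He D => H.
  apply: (Z.mul_reg_r _ _ (d ^ 4)); first by apply: Z.pow_nonzero => // d00; rewrite d00 in d0.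
  transitivity (hess (a * d ^ 2) (b * d ^ 2) (c * d ^ 2) (e * d ^ 2) y2 (- y1)).
    by rewrite /hess; ring.
  rewrite H.
  have -> : ((d * (z1 * y2 - z2 * y1)) ^ 4 = d ^ 4 * ((z1 * y2 - z2 * y1) ^ 2) ^ 2)%Z by ring.
  by rewrite Hdet2; ring.
- have := jcov_cub A B x1 y1 x2 y2; rewrite Ha Hb Hc He D => H.
  apply: (Z.mul_reg_r _ _ (d ^ 6)); first by apply: Z.pow_nonzero => // d00; rewrite d00 in d0.
  transitivity (jcov (a * d ^ 2) (b * d ^ 2) (c * d ^ 2) (e * d ^ 2) y2 (- y1)).
    by rewrite /jcov; ring.
  rewrite H.
  have -> : ((d * (z1 * y2 - z2 * y1)) ^ 6 = d ^ 6 * ((z1 * y2 - z2 * y1) ^ 2) ^ 3)%Z by ring.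
  by rewrite Hdet2; ring.
Qed.

(** * Dyadic cells *)

Lemma mem_Zrange N k : (k \in Zrange N) = (Z.abs_nat k <= N)%N.
Proof.
apply/mapP/idP => [[i]|H].
  rewrite mem_iota => /andP[_ Hi] ->; lia.
exists (Z.to_nat (k + Z.of_nat N)); last by lia.
by rewrite mem_iota; lia.
Qed.

Lemma size_Zrange N : size (Zrange N) = (2 * N).+1.
Proof. by rewrite size_map size_iota. Qed.

Lemma Zrange_uniq N : uniq (Zrange N).
Proof. by rewrite map_inj_uniq ?iota_uniq // => x y; lia. Qed.

(* The ranges of (a, b, c, e, y1, y2) that [index_form_exists] allows when D <= d < 2 D and
   M <= N1 < 2 M; [cell_ok] collects the necessary conditions on (D, M), and a <> 0 gives the first. *)
Definition cell_ok (L D M : nat) : bool :=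
  [&& D ^ 2 <= 24 * M ^ 3, D ^ 2 <= 31 * L ^ 6, M ^ 2 <= 4 * D * L & L ^ 3 <= 32 * D ^ 2]%N.

Definition cell (L D M : nat) : seq (Z * (Z * (Z * (Z * (Z * Z))))) :=
  let pairs {T U : Type} (s : seq T) (t : seq U) := [seq (x, y) | x <- s, y <- t] in
  pairs (Zrange (24 * M ^ 3 %/ D ^ 2)) (pairs (Zrange (36 * M * L %/ D))
  (pairs (Zrange (36 * L ^ 2 %/ M)) (pairs (Zrange (48 * D * L ^ 3 %/ M ^ 3))
  (pairs (Zrange (2 * M %/ L)) (Zrange (4 * D %/ M)))))).

(** Inverts the passage to the index form, so a cell accounts for at most [size (cell L D M)]
    pairs. *)
Definition cell_point (t : Z * (Z * (Z * (Z * (Z * Z))))) : Z * Z :=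
  let: (a, (b, (c, (e, (y1, y2))))) := t in
  ((- hess a b c e y2 (- y1)) / 3, jcov a b c e y2 (- y1) / 27)%Z.

Lemma cell_point_in (L D M : nat) (a b c e y1 y2 A B : Z) :
  (0 < L)%N -> (0 < D)%N -> (0 < M)%N ->
  (Z.abs a * Z.of_nat D ^ 2 <= 24 * Z.of_nat M ^ 3)%Z ->
  (Z.abs b * Z.of_nat D <= 36 * Z.of_nat M * Z.of_nat L)%Z ->
  (Z.abs c * Z.of_nat M <= 36 * Z.of_nat L ^ 2)%Z ->
  (Z.abs e * Z.of_nat M ^ 3 <= 48 * Z.of_nat D * Z.of_nat L ^ 3)%Z ->
  (Z.abs y1 * Z.of_nat L <= 2 * Z.of_nat M)%Z ->
  (Z.abs y2 * Z.of_nat M <= 4 * Z.of_nat D)%Z ->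
  hess a b c e y2 (- y1) = (- 3 * A)%Z -> jcov a b c e y2 (- y1) = (27 * B)%Z ->
  (A, B) \in [seq cell_point t | t <- cell L D M].
Proof.
move=> L0 D0 M0 Ha Hb Hc He Hy1 Hy2 HA HB.
have -> : (A, B) = cell_point (a, (b, (c, (e, (y1, y2))))).
  rewrite /cell_point HA HB; congr pair.
    by rewrite (_ : - (- 3 * A) = A * 3)%Z ?Z.div_mul //; ring.
  by rewrite Z.mul_comm Z.div_mul.
apply: map_f; rewrite /cell.
do 5 (apply: allpairs_f; first (rewrite mem_Zrange leq_divRL ?expn_gt0 ?M0 ?D0 //; lia)).
by rewrite mem_Zrange leq_divRL //; lia.
Qed.

Lemma Zmul_le_cancel p x y : (0 < p)%Z -> (x * p <= y * p)%Z -> (x <= y)%Z.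
Proof. by move=> p0 H; apply/(Z.mul_le_mono_pos_r x y p p0). Qed.

Lemma sq_le_double (z D : Z) : (0 <= z)%Z -> (z <= 2 * D)%Z -> (z ^ 2 <= 4 * D ^ 2)%Z.
Proof. by move=> z0 zD; have : (z ^ 2 <= (2 * D) ^ 2)%Z; [apply: Z.pow_le_mono_l; lia | lia]. Qed.

Section CellBounds.
Context (l z D M N1 N2 : Z) (l0 : (0 < l)%Z) (D0 : (0 < D)%Z) (Dz : (D <= z)%Z)
  (zD : (z <= 2 * D)%Z) (M0 : (0 < M)%Z) (MN : (M <= N1)%Z) (NM : (N1 <= 2 * M)%Z).

Let z2 : (0 < z ^ 2)%Z. Proof. by apply: Z.pow_pos_nonneg => //; lia. Qed.

Lemma cell_bound_a a : (0 <= a)%Z -> (a * z ^ 2 <= 3 * N1 ^ 3)%Z -> (a * D ^ 2 <= 24 * M ^ 3)%Z.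
Proof.
move=> a0 H.
have h1 : (a * D ^ 2 <= a * z ^ 2)%Z by apply: Z.mul_le_mono_nonneg_l => //; apply: Z.pow_le_mono_l; lia.
have h2 : (N1 ^ 3 <= (2 * M) ^ 3)%Z by apply: Z.pow_le_mono_l; lia.
by rewrite Z.pow_mul_l in h2; lia.
Qed.

Context (HN : (N1 * N2 <= 2 * z * l)%Z).

(** N2 gets no dyadic range of its own: here and below it is eliminated through N1 N2 <= 2 z l,
    after multiplication by a power of N1 where needed. *)
Lemma cell_bound_b b : (0 <= b)%Z -> (b * z ^ 2 <= 9 * (N1 ^ 2 * N2))%Z -> (b * D <= 36 * M * l)%Z.
Proof.
move=> b0 H.
have h2 : (N1 * (N1 * N2) <= N1 * (2 * z * l))%Z by apply: Z.mul_le_mono_nonneg_l; lia.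
have h1 : (b * z <= 18 * (N1 * l))%Z.
  by apply: (Zmul_le_cancel z); [lia | rewrite -Z.mul_assoc -Z.pow_2_r; lia].
have h3 : (b * D <= b * z)%Z by apply: Z.mul_le_mono_nonneg_l; lia.
have : (N1 * l <= 2 * M * l)%Z by apply: Z.mul_le_mono_nonneg_r; lia.
lia.
Qed.

Context (N2p : (0 <= N2)%Z).

Let NN0 : (0 <= N1 * N2)%Z. Proof. by apply: Z.mul_nonneg_nonneg; lia. Qed.

Lemma cell_bound_c c : (0 <= c)%Z -> (c * z ^ 2 <= 9 * (N2 ^ 2 * N1))%Z -> (c * M <= 36 * l ^ 2)%Z.
Proof.
move=> c0 H.
have h2 : ((N1 * N2) ^ 2 <= (2 * z * l) ^ 2)%Z by apply: Z.pow_le_mono_l; lia.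
have h3 : (N1 * (c * z ^ 2) <= N1 * (9 * (N2 ^ 2 * N1)))%Z by apply: Z.mul_le_mono_nonneg_l; lia.
have h1 : (c * N1 <= 36 * l ^ 2)%Z.
  apply: (Zmul_le_cancel (z ^ 2)) => //; move: h2 h3; clear.
  have -> : ((2 * z * l) ^ 2 = 4 * (l ^ 2 * z ^ 2))%Z by ring.
  have -> : (N1 * (9 * (N2 ^ 2 * N1)) = 9 * (N1 * N2) ^ 2)%Z by ring.
  have -> : (c * N1 * z ^ 2 = N1 * (c * z ^ 2))%Z by ring.
  lia.
have : (c * M <= c * N1)%Z by apply: Z.mul_le_mono_nonneg_l; lia.
lia.
Qed.

Lemma cell_bound_e e : (0 <= e)%Z -> (e * z ^ 2 <= 3 * N2 ^ 3)%Z -> (e * M ^ 3 <= 48 * D * l ^ 3)%Z.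
Proof.
move=> e0 H; have l3 : (0 < l ^ 3)%Z by apply: Z.pow_pos_nonneg.
have n3 : (0 < N1 ^ 3)%Z by apply: Z.pow_pos_nonneg; lia.
have h3 : ((N1 * N2) ^ 3 <= (2 * z * l) ^ 3)%Z by apply: Z.pow_le_mono_l; lia.
have h4 : (N1 ^ 3 * (e * z ^ 2) <= N1 ^ 3 * (3 * N2 ^ 3))%Z by apply: Z.mul_le_mono_nonneg_l => //; lia.
have h1 : (e * N1 ^ 3 <= 24 * z * l ^ 3)%Z.
  apply: (Zmul_le_cancel (z ^ 2)) => //; move: h3 h4; clear.
  have -> : ((2 * z * l) ^ 3 = 8 * (z * l ^ 3 * z ^ 2))%Z by ring.
  have -> : (N1 ^ 3 * (3 * N2 ^ 3) = 3 * (N1 * N2) ^ 3)%Z by ring.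
  have -> : (e * N1 ^ 3 * z ^ 2 = N1 ^ 3 * (e * z ^ 2))%Z by ring.
  lia.
have h2 : (M ^ 3 <= N1 ^ 3)%Z by apply: Z.pow_le_mono_l; lia.
have h5 : (e * M ^ 3 <= e * N1 ^ 3)%Z by apply: Z.mul_le_mono_nonneg_l; lia.
apply: (Z.le_trans _ _ _ h5); apply: (Z.le_trans _ _ _ h1).
have -> : (48 * D * l ^ 3 = 24 * (2 * D) * l ^ 3)%Z by ring.
by apply: Z.mul_le_mono_nonneg_r; [exact: Z.lt_le_incl | clear -zD; lia].
Qed.

Lemma cell_bound_y y : (0 <= y)%Z -> (l * y <= N2)%Z -> (y * M <= 4 * D)%Z.
Proof.
move=> y0 H.
have h : (N1 * (l * y) <= N1 * N2)%Z by apply: Z.mul_le_mono_nonneg_l; lia.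
have h1 : (y * N1 <= 2 * z)%Z by apply: (Zmul_le_cancel l); lia.
have : (y * M <= y * N1)%Z by apply: Z.mul_le_mono_nonneg_l; lia.
lia.
Qed.

Lemma cell_bound_M : (N1 <= N2)%Z -> (M ^ 2 <= 4 * D * l)%Z.
Proof.
move=> H.
have h1 : (M * M <= N1 * N2)%Z by apply: Z.mul_le_mono_nonneg; lia.
have : (z * l <= 2 * D * l)%Z by apply: Z.mul_le_mono_nonneg_r; lia.
lia.
Qed.
End CellBounds.

Lemma Delta_abs_le (l A B : Z) : (0 <= l)%Z -> (Z.abs A <= l ^ 2)%Z -> (Z.abs B <= l ^ 3)%Z ->
  (Z.abs (Delta A B) <= 31 * l ^ 6)%Z.
Proof.
move=> l0 HA HB.
have hA : (Z.abs A ^ 3 <= (l ^ 2) ^ 3)%Z by apply: Z.pow_le_mono_l; lia.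
have hB : (Z.abs B ^ 2 <= (l ^ 3) ^ 2)%Z by apply: Z.pow_le_mono_l; lia.
rewrite (_ : (l ^ 2) ^ 3 = l ^ 6)%Z in hA; last by ring.
rewrite (_ : (l ^ 3) ^ 2 = l ^ 6)%Z in hB; last by ring.
rewrite -Z.abs_pow in hA; rewrite -Z.abs_pow in hB; rewrite /Delta.
move: (A ^ 3)%Z (B ^ 2)%Z (l ^ 6)%Z hA hB; clear; lia.
Qed.

(** The exponents i and j are the binary logarithms of d and N1. The conditions in [cell_ok] come
    from a <> 0, from d^2 <= |Delta|, from N1^2 <= N1 N2, and from L^3 <= 8 d^2, which encodes d >
    T^3. *)
Lemma bad_in_cell (L d : nat) (A B : Z) : (0 < L)%N -> (0 < d)%N ->
  (L ^ 3 <= 8 * d ^ 2)%N ->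
  (Z.abs A <= Z.of_nat L ^ 2)%Z -> (Z.abs B <= Z.of_nat L ^ 3)%Z ->
  (Z.gcd (Z.of_nat d ^ 2) (2 * A) = 1)%Z -> (Z.of_nat d ^ 2 | Delta A B)%Z -> Delta A B <> 0%Z ->
  (forall r, r ^ 3 + A * r + B <> 0)%Z ->
  exists i j, cell_ok L (2 ^ i) (2 ^ j) /\
    (A, B) \in [seq cell_point t | t <- cell L (2 ^ i) (2 ^ j)].
Proof.
move=> L0 d0 Ld HA HB Hg Hd D0 nr.
have [a [b [c [e [y1 [y2 [N1 [N2 [[a0 N10 N12 HN] [Ha Hb Hc He] [Hy1 Hy2] Hh Hj]]]]]]]]] :=
  index_form_exists A B (Z.of_nat L) (Z.of_nat d) ltac:(lia) ltac:(lia) HA HB Hg Hd nr.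
have N1n : (0 < Z.to_nat N1)%N by clear -N10; lia.
have /andP[Di1 Di2] := trunc_log_bounds (isT : (1 < 2)%N) d0.
have /andP[Mj1 Mj2] := trunc_log_bounds (isT : (1 < 2)%N) N1n.
set i := trunc_log 2 d in Di1 Di2; set j := trunc_log _ _ in Mj1 Mj2.
exists i, j; set D := (2 ^ i)%N in Di1 Di2 *; set M := (2 ^ j)%N in Mj1 Mj2 *.
rewrite expnS -/D in Di2; rewrite expnS -/M in Mj2.
have Dp : (0 < D)%N by rewrite /D expn_gt0.
have Mp : (0 < M)%N by rewrite /M expn_gt0.
have l0 : (0 < Z.of_nat L)%Z by clear -L0; lia.
have D1 : (0 < Z.of_nat D)%Z by clear -Dp; lia.
have M1 : (0 < Z.of_nat M)%Z by clear -Mp; lia.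
have Dz : (Z.of_nat D <= Z.of_nat d)%Z by clear -Di1; lia.
have zD : (Z.of_nat d <= 2 * Z.of_nat D)%Z by clear -Di2; lia.
have MN : (Z.of_nat M <= N1)%Z by clear -Mj1 N10; lia.
have NM : (N1 <= 2 * Z.of_nat M)%Z by clear -Mj2; lia.
have N20 : (0 <= N2)%Z by clear -N12 N10; lia.
have Ha1 : (Z.abs a * Z.of_nat D ^ 2 <= 24 * Z.of_nat M ^ 3)%Z.
  by apply: cell_bound_a Ha => //; exact: Z.abs_nonneg.
have Hb1 : (Z.abs b * Z.of_nat D <= 36 * Z.of_nat M * Z.of_nat L)%Z.
  apply: (cell_bound_b (Z.of_nat L) (Z.of_nat d) (Z.of_nat D) (Z.of_nat M) N1 N2) Hb => //.
  exact: Z.abs_nonneg.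
have Hc1 : (Z.abs c * Z.of_nat M <= 36 * Z.of_nat L ^ 2)%Z.
  apply: (cell_bound_c (Z.of_nat L) (Z.of_nat d) (Z.of_nat D) (Z.of_nat M) N1 N2) Hc => //.
  exact: Z.abs_nonneg.
have He1 : (Z.abs e * Z.of_nat M ^ 3 <= 48 * Z.of_nat D * Z.of_nat L ^ 3)%Z.
  apply: (cell_bound_e (Z.of_nat L) (Z.of_nat d) (Z.of_nat D) (Z.of_nat M) N1 N2) He => //.
  exact: Z.abs_nonneg.
have Hy : (Z.abs y2 * Z.of_nat M <= 4 * Z.of_nat D)%Z.
  apply: (cell_bound_y (Z.of_nat L) (Z.of_nat d) (Z.of_nat D) (Z.of_nat M) N1 N2) Hy2 => //.
  exact: Z.abs_nonneg.
split.
  have h1 : (Z.of_nat M ^ 2 <= 4 * Z.of_nat D * Z.of_nat L)%Z.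
    by apply: (cell_bound_M _ (Z.of_nat d) _ _ N1 N2).
  have h2 : (Z.of_nat d ^ 2 <= 4 * Z.of_nat D ^ 2)%Z by exact: sq_le_double (Nat2Z.is_nonneg d) zD.
  have h3 : (Z.of_nat D ^ 2 <= 24 * Z.of_nat M ^ 3)%Z.
    have : (1 * Z.of_nat D ^ 2 <= Z.abs a * Z.of_nat D ^ 2)%Z.
      by apply: Z.mul_le_mono_nonneg_r; [exact: Z.pow_nonneg (Z.lt_le_incl _ _ D1) | clear -a0; lia].
    clear -Ha1; lia.
  have h4 : (Z.of_nat d ^ 2 <= 31 * Z.of_nat L ^ 6)%Z.
    apply: Z.le_trans (Delta_abs_le _ A B (Z.lt_le_incl _ _ l0) HA HB).
    by apply: Z.divide_pos_le; [clear -D0; lia | exact/Z.divide_abs_r].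
  have h5 : (Z.of_nat D ^ 2 <= Z.of_nat d ^ 2)%Z by apply: Z.pow_le_mono_l; clear -D1 Dz; lia.
  apply/and4P; split.
  - clear -h3; lia.
  - clear -h4 h5; lia.
  - clear -h1; lia.
  - clear -h2 Ld; lia.
apply: (cell_point_in L D M a b c e y1 y2) => //.
by clear -Hy1 NM; lia.
Qed.

(** * Cardinality of a cell *)

Lemma pow_le_inv n x y : 0 <= y -> x ^ n.+1 <= y ^ n.+1 -> x <= y.
Proof.
move=> y0 H; case: (Rle_lt_dec x y) => // yx; exfalso.
suff : y ^ n.+1 < x ^ n.+1 by lra.
elim: n {H} => [|n IH]; first by rewrite !pow_1.
rewrite -![_ ^ n.+2]/(_ * _ ^ n.+1); apply: Rmult_le_0_lt_compat => //.
by apply: pow_le.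
Qed.

Lemma Rmult_le_range x x' y y' : 0 <= x <= x' -> 0 <= y <= y' -> 0 <= x * y <= x' * y'.
Proof. by move=> [? ?] [? ?]; split; [apply: Rmult_le_pos | apply: Rmult_le_compat]. Qed.

Section CellSize.
Context (T L D M : R) (T1 : 1 <= T) (L1 : T ^ 2 <= L) (L2 : L <= 2 * T ^ 2) (D1 : 1 <= D) (M1 : 1 <= M)
  (HDM : D ^ 2 <= 24 * M ^ 3) (HDL : D ^ 2 <= 31 * L ^ 6) (HMD : M ^ 2 <= 4 * (D * L))
  (HLD : L ^ 3 <= 32 * D ^ 2).

Let L0 : 0 < L. Proof. have : 0 < T ^ 2 by apply: pow_lt; lra. lra. Qed.

(** A range |t| <= x has up to 2 x + 1 elements, and the 1 is absorbed once x is bounded below. This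
    lemma and the next three provide that for b, c, e and y2. Each extracts a root from an
    inequality of monomials, here D^6 = D^2 (D^2)^2 << L^6 (M^3)^2. *)
Lemma cell_D_le : D <= 6 * (M * L).
Proof.
have ml : 0 < M * L by apply: Rmult_lt_0_compat; lra.
apply: (pow_le_inv 5); first lra.
have h : (D ^ 2) ^ 2 <= (24 * M ^ 3) ^ 2 by apply: pow_incr; split=> //; apply: pow_le; lra.
have h1 : D ^ 2 * (D ^ 2) ^ 2 <= 31 * L ^ 6 * (24 * M ^ 3) ^ 2.
  by apply: Rmult_le_compat => //; repeat apply: pow_le; lra.
have h2 : 0 < (M * L) ^ 6 by apply: pow_lt.
have -> : D ^ 6 = D ^ 2 * (D ^ 2) ^ 2 by ring.
have -> : (6 * (M * L)) ^ 6 = 46656 * (M * L) ^ 6 by ring.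
have e : 31 * L ^ 6 * (24 * M ^ 3) ^ 2 = 17856 * (M * L) ^ 6 by ring.
lra.
Qed.

Lemma cell_M_le : M <= 5 * L ^ 2.
Proof.
apply: (pow_le_inv 3); first by apply: Rmult_le_pos; [lra | apply: pow_le; lra].
have h : (M ^ 2) ^ 2 <= (4 * (D * L)) ^ 2 by apply: pow_incr; split=> //; apply: pow_le; lra.
have h1 : D ^ 2 * L ^ 2 <= 31 * L ^ 6 * L ^ 2 by apply: Rmult_le_compat_r => //; apply: pow_le; lra.
have -> : M ^ 4 = (M ^ 2) ^ 2 by ring.
have e : (4 * (D * L)) ^ 2 = 16 * (D ^ 2 * L ^ 2) by ring.
have -> : (5 * L ^ 2) ^ 4 = 625 * (L ^ 6 * L ^ 2) by ring.
have : 0 < L ^ 6 * L ^ 2 by apply: Rmult_lt_0_compat; apply: pow_lt.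
lra.
Qed.

Lemma cell_M3_le : M ^ 3 <= 19 * (D * L ^ 3).
Proof.
have l3 : 0 < L ^ 3 by apply: pow_lt.
have dl : 0 < D * L ^ 3 by apply: Rmult_lt_0_compat; lra.
apply: (pow_le_inv 3); first lra.
have h : (M ^ 2) ^ 6 <= (4 * (D * L)) ^ 6 by apply: pow_incr; split=> //; apply: pow_le; lra.
have h1 : D ^ 4 * L ^ 6 * D ^ 2 <= D ^ 4 * L ^ 6 * (31 * L ^ 6).
  by apply: Rmult_le_compat_l => //; apply: Rmult_le_pos; apply: pow_le; lra.
have -> : (M ^ 3) ^ 4 = (M ^ 2) ^ 6 by ring.
have e : (4 * (D * L)) ^ 6 = 4096 * (D ^ 4 * L ^ 6 * D ^ 2) by ring.
have e2 : D ^ 4 * L ^ 6 * (31 * L ^ 6) = 31 * (D * L ^ 3) ^ 4 by ring.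
have -> : (19 * (D * L ^ 3)) ^ 4 = 130321 * (D * L ^ 3) ^ 4 by ring.
have : 0 < (D * L ^ 3) ^ 4 by apply: pow_lt.
lra.
Qed.

Lemma cell_M_le_D : M <= 4 * D.
Proof.
apply: (pow_le_inv 5); first lra.
have h : (M ^ 2) ^ 3 <= (4 * (D * L)) ^ 3 by apply: pow_incr; split=> //; apply: pow_le; lra.
have d3 : 0 < D ^ 3 by apply: pow_lt; lra.
have h1 : D ^ 3 * L ^ 3 <= D ^ 3 * (32 * D ^ 2) by apply: Rmult_le_compat_l; lra.
have -> : M ^ 6 = (M ^ 2) ^ 3 by ring.
have e : (4 * (D * L)) ^ 3 = 64 * (D ^ 3 * L ^ 3) by ring.
have e2 : D ^ 3 * (32 * D ^ 2) = 32 * D ^ 5 by ring.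
have -> : (4 * D) ^ 6 = 4096 * (D * D ^ 5) by ring.
have d5 : 0 < D ^ 5 by apply: pow_lt; lra.
have : 1 * D ^ 5 <= D * D ^ 5 by apply: Rmult_le_compat_r; lra.
lra.
Qed.

Lemma cell_D_ge : T ^ 3 <= 6 * D.
Proof.
apply: (pow_le_inv 1); first lra.
have h : (T ^ 2) ^ 3 <= L ^ 3 by apply: pow_incr; split=> //; apply: pow_le; lra.
have -> : (T ^ 3) ^ 2 = (T ^ 2) ^ 3 by ring.
have -> : (6 * D) ^ 2 = 36 * D ^ 2 by ring.
have : 0 < D ^ 2 by apply: pow_lt; lra.
lra.
Qed.

(** T^15 << D^5 = D^3 D^2 << (D M)^3, where D^2 << M^3 is the condition coming from a <> 0. *)
Lemma cell_DM_ge : T ^ 5 <= 58 * (D * M).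
Proof.
have dm : 0 < D * M by apply: Rmult_lt_0_compat; lra.
apply: (pow_le_inv 2); first lra.
have h : (T ^ 3) ^ 5 <= (6 * D) ^ 5 by apply: pow_incr; split; [apply: pow_le; lra | exact: cell_D_ge].
have h1 : D ^ 3 * D ^ 2 <= D ^ 3 * (24 * M ^ 3) by apply: Rmult_le_compat_l => //; apply: pow_le; lra.
have -> : (T ^ 5) ^ 3 = (T ^ 3) ^ 5 by ring.
have e : (6 * D) ^ 5 = 7776 * (D ^ 3 * D ^ 2) by ring.
have e2 : D ^ 3 * (24 * M ^ 3) = 24 * (D * M) ^ 3 by ring.
have -> : (58 * (D * M)) ^ 3 = 195112 * (D * M) ^ 3 by ring.
have : 0 < (D * M) ^ 3 by apply: pow_lt.
lra.
Qed.

(* The product is of order L^6 / (D M) + L^5 / D, and T^3 << D, D^2 << M^3 make both terms O(T^7). *)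
Lemma cell_volume_le :
  (2 * (24 * M ^ 3 / D ^ 2) + 1) * ((2 * (36 * M * L / D) + 1) * ((2 * (36 * L ^ 2 / M) + 1) *
  ((2 * (48 * D * L ^ 3 / M ^ 3) + 1) * ((2 * (2 * M / L) + 1) * (2 * (4 * D / M) + 1)))))
  <= 3 * 10 ^ 12 * T ^ 7.
Proof.
have D0 : 0 < D by lra. have M0 : 0 < M by lra.
have le1 x y k : 0 < y -> y <= k * x -> 1 <= k * (x / y).
  move=> y0 h; apply: (Rmult_le_reg_r y) => //.
  have -> : k * (x / y) * y = k * x by field; lra.
  lra.
have M3 : 0 < M ^ 3 by apply: pow_lt.
have D2 : 0 < D ^ 2 by apply: pow_lt.
have f1 := le1 (M ^ 3) (D ^ 2) 24 D2 HDM.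
have f2 := le1 (M * L) D 6 D0 cell_D_le.
have f3 := le1 (L ^ 2) M 5 M0 cell_M_le.
have f4 := le1 (D * L ^ 3) (M ^ 3) 19 M3 cell_M3_le.
have f6 := le1 D M 4 M0 cell_M_le_D.
have p5 : 0 <= 2 * (2 * M / L) + 1.
  have : 0 <= M / L by apply: Rlt_le; apply: Rdiv_lt_0_compat.
  have -> : 2 * M / L = 2 * (M / L) by field; lra.
  lra.
(* Each factor 2 (k r) + 1 with 1 <= k' r becomes (2 k + k') r: 72 = 48 + 24, 78 = 72 + 6, 77 = 72 +
   5, 115 = 96 + 19, 12 = 8 + 4. The factor of y1 keeps its 1, since M may be smaller than L; it
   produces the two terms that follow. *)
apply: (Rle_trans _ (72 * (M ^ 3 / D ^ 2) * (78 * (M * L / D) * (77 * (L ^ 2 / M) *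
  (115 * (D * L ^ 3 / M ^ 3) * ((2 * (2 * M / L) + 1) * (12 * (D / M)))))))).
  have -> : 24 * M ^ 3 / D ^ 2 = 24 * (M ^ 3 / D ^ 2) by field; lra.
  have -> : 36 * M * L / D = 36 * (M * L / D) by field; lra.
  have -> : 36 * L ^ 2 / M = 36 * (L ^ 2 / M) by field; lra.
  have -> : 48 * D * L ^ 3 / M ^ 3 = 48 * (D * L ^ 3 / M ^ 3) by field; lra.
  have -> : 4 * D / M = 4 * (D / M) by field; lra.
  have g6 : 0 <= (2 * (2 * M / L) + 1) * (2 * (4 * (D / M)) + 1) <=
    (2 * (2 * M / L) + 1) * (12 * (D / M)).
    by split; [apply: Rmult_le_pos; lra | apply: Rmult_le_compat_l; lra].
  have g : 0 <= (2 * (24 * (M ^ 3 / D ^ 2)) + 1) * ((2 * (36 * (M * L / D)) + 1) *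
    ((2 * (36 * (L ^ 2 / M)) + 1) * ((2 * (48 * (D * L ^ 3 / M ^ 3)) + 1) *
    ((2 * (2 * M / L) + 1) * (2 * (4 * (D / M)) + 1))))) <=
    72 * (M ^ 3 / D ^ 2) * (78 * (M * L / D) * (77 * (L ^ 2 / M) *
  (115 * (D * L ^ 3 / M ^ 3) * ((2 * (2 * M / L) + 1) * (12 * (D / M)))))).
    by do 4 (apply: Rmult_le_range; first lra).
  by case: g.
have -> : 72 * (M ^ 3 / D ^ 2) * (78 * (M * L / D) * (77 * (L ^ 2 / M) *
  (115 * (D * L ^ 3 / M ^ 3) * ((2 * (2 * M / L) + 1) * (12 * (D / M)))))) =
  596756160 * (4 * (L ^ 5 / D) + L ^ 6 / (D * M)) by field; lra.
have T0 : 0 < T by lra.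
have T3 : 0 < T ^ 3 by apply: pow_lt. have T5 : 0 < T ^ 5 by apply: pow_lt.
have h5 : L ^ 5 / D <= 192 * T ^ 7.
  apply: (Rmult_le_reg_r D) => //; have -> : L ^ 5 / D * D = L ^ 5 by field; lra.
  have a1 : L ^ 5 <= (2 * T ^ 2) ^ 5 by apply: pow_incr; lra.
  have a2 : T ^ 7 * T ^ 3 <= T ^ 7 * (6 * D).
    by apply: Rmult_le_compat_l; [apply: pow_le; lra | exact: cell_D_ge].
  have e1 : (2 * T ^ 2) ^ 5 = 32 * (T ^ 7 * T ^ 3) by ring.
  lra.
have h6 : L ^ 6 / (D * M) <= 3712 * T ^ 7.
  have dm : 0 < D * M by apply: Rmult_lt_0_compat.
  apply: (Rmult_le_reg_r (D * M)) => //; have -> : L ^ 6 / (D * M) * (D * M) = L ^ 6 by field; lra.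
  have a1 : L ^ 6 <= (2 * T ^ 2) ^ 6 by apply: pow_incr; lra.
  have a2 : T ^ 7 * T ^ 5 <= T ^ 7 * (58 * (D * M)).
    by apply: Rmult_le_compat_l; [apply: pow_le; lra | exact: cell_DM_ge].
  have e1 : (2 * T ^ 2) ^ 6 = 64 * (T ^ 7 * T ^ 5) by ring.
  lra.
have : 0 < T ^ 7 by apply: pow_lt.
lra.
Qed.
End CellSize.

Lemma size_cell (L D M : nat) (T : R) : 1 <= T -> T ^ 2 <= INR L <= 2 * T ^ 2 ->
  (0 < D)%N -> (0 < M)%N -> cell_ok L D M -> INR (size (cell L D M)) <= 3 * 10 ^ 12 * T ^ 7.
Proof.
move=> T1 [L1 L2] D0 M0 /and4P[c1 c2 c3 c4].
have L0 : (0 < L)%N.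
  rewrite lt0n; apply/eqP => l0; rewrite l0 /= in L1; have : 0 < T ^ 2 by apply: pow_lt; lra.
  lra.
have sz m (x : R) : INR m <= x -> 0 <= INR (2 * m).+1 <= 2 * x + 1.
  by move=> h; rewrite S_INR mult_INR [INR 2]/=; have := pos_INR m; lra.
have e2 : INR 2 = 2 by [].
have e4 : INR 4 = 4 by rewrite /=; lra.
have e24 : INR 24 = 24 by rewrite /=; lra.
have e31 : INR 31 = 31 by rewrite /=; lra.
have e32 : INR 32 = 32 by rewrite /=; lra.
have e36 : INR 36 = 36 by rewrite /=; lra.
have e48 : INR 48 = 48 by rewrite /=; lra.
have := leq_INR _ _ c1; have := leq_INR _ _ c2; have := leq_INR _ _ c3; have := leq_INR _ _ c4.
rewrite !(mult_INR, INR_expn) e24 e31 e32 e4 => r4 r3 r2 r1.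
have D1 := INR_ge1 _ D0; have M1 := INR_ge1 _ M0; have Ml := INR_ge1 _ L0.
apply: Rle_trans (cell_volume_le T (INR L) (INR D) (INR M) T1 L1 L2 D1 M1 _ _ _ _); try lra.
rewrite /cell !size_allpairs !size_Zrange !mult_INR.
apply: (proj2 (A := 0 <= _)).
do 5 (apply: Rmult_le_range; first (apply: sz; apply: Rle_trans (INR_divn _ _ _) _;
  [by rewrite ?expn_gt0 ?M0 ?D0 ?L0 | by rewrite !(mult_INR, INR_expn) ?e2 ?e4 ?e24 ?e36 ?e48; lra])).
apply: sz; apply: Rle_trans (INR_divn _ _ _) _ => //.
by rewrite !(mult_INR, INR_expn) ?e2 ?e4; lra.
Qed.

(** * Pairs with a large square divisor *)

Lemma INRb_ge0 (b : bool) : 0 <= INR b. Proof. exact: pos_INR. Qed.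

Lemma INRb_le1 (b : bool) : INR b <= 1. Proof. by case: b => /=; lra. Qed.

(* d is split into a part dividing 6, a part e dividing A (hence B), and the rest m. *)
Lemma sqf_divisor_split d A B : sqf d -> A <> 0%Z -> dvZ (d ^ 2) (Delta A B) ->
  exists e m, [/\ (0 < e <= Z.abs_nat A)%N, sqf m /\ (d <= 6 * e * m)%N,
    coprime m (6 * Z.abs_nat A), coprime e (m ^ 2) &
    [/\ dvZ e A, dvZ e B & dvZ (m ^ 2) (Delta A B)]].
Proof.
move=> sd A0 dD; have d0 := sqf_gt0 _ sd.
have A0' : (0 < Z.abs_nat A)%N by clear -A0; lia.
pose g := gcdn d 6; pose d' := (d %/ g)%N; pose e := gcdn d' (Z.abs_nat A); pose m := (d' %/ e)%N.
have dE : (d' * g)%N = d by rewrite /d' divnK ?dvdn_gcdl.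
have d'E : (m * e)%N = d' by rewrite /m divnK ?dvdn_gcdl.
have sd' : sqf d' by apply: sqf_dvd sd _; rewrite -dE dvdn_mulr.
have sm : sqf m by apply: sqf_dvd sd' _; rewrite -d'E dvdn_mulr.
have cdg : coprime d' g by apply: sqf_coprime; rewrite dE.
have cme : coprime m e by apply: sqf_coprime; rewrite d'E.
have md : (m %| d)%N by rewrite -dE -d'E -mulnA dvdn_mulr.
have ed' : (e %| d')%N by exact: dvdn_gcdl.
have c6 : coprime d' 6.
  have : (gcdn d' 6 %| gcdn d' g)%N.
    by rewrite !dvdn_gcd dvdn_gcdl dvdn_gcdr (dvdn_trans (dvdn_gcdl _ _)) // -dE dvdn_mulr.
  by rewrite (eqP cdg) dvdn1.
have cmA : coprime m (Z.abs_nat A).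
  have : (gcdn m (Z.abs_nat A) %| gcdn m e)%N.
    by rewrite !dvdn_gcd dvdn_gcdl dvdn_gcdr (dvdn_trans (dvdn_gcdl _ _)) // -d'E dvdn_mulr.
  by rewrite (eqP cme) dvdn1.
have g6 : (g <= 6)%N by apply: dvdn_leq => //; exact: dvdn_gcdr.
exists e, m; split.
- by rewrite gcdn_gt0 (sqf_gt0 _ sd') /= dvdn_leq ?dvdn_gcdr.
- split=> //; rewrite -dE -d'E.
  by rewrite mulnC (mulnC m) -mulnA leq_mul2r g6 orbT.
- by rewrite coprimeMr cmA andbT; apply: coprime_dvdl c6; rewrite -d'E dvdn_mulr.
- by rewrite coprimeXr // coprime_sym.
- have eA : dvZ e A by exact: dvdn_gcdr.
  have e27 : coprime (e ^ 2) 27.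
    by rewrite coprimeXl // (coprime_dvdl ed') // (_ : 27 = 3 ^ 3)%N // coprimeXr //
      (coprime_dvdr _ c6).
  split=> //; last first.
    by rewrite /dvZ (dvdn_trans _ dD) // dvdn_exp2r.
  (* Since e | A, the term 4 A^3 is divisible by e^2, hence so is 27 B^2; as e is prime to 3, e |
     B. *)
  have : dvZ (e ^ 2) (27 * B ^ 2)%Z.
    have : dvZ (e ^ 2) (Delta A B).
      by rewrite /dvZ (dvdn_trans _ dD) // dvdn_exp2r // -dE (dvdn_trans ed') // dvdn_mulr.
    case/dvZP: eA => k ->; rewrite /Delta; move=> /dvZP[l Hl]; apply/dvZP.
    exists (l - 4 * k ^ 3 * Z.of_nat e)%Z; move: Hl.
    have -> : Z.of_nat (e ^ 2) = (Z.of_nat e ^ 2)%Z by clear; lia.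
    clear; move: (Z.of_nat e) => E Hl.
    have -> : ((l - 4 * k ^ 3 * E) * E ^ 2 = l * E ^ 2 - 4 * (k * E) ^ 3)%Z by ring.
    rewrite -Hl; ring.
  rewrite /dvZ Zabs2Nat.inj_mul multE Gauss_dvdr //.
  have -> : Z.abs_nat (B ^ 2) = (Z.abs_nat B ^ 2)%N by clear; lia.
  by rewrite dvdn_pexp2r.
Qed.

Lemma integral_root_bound (L A B r : Z) : (0 < L)%Z -> (Z.abs A <= L ^ 2)%Z -> (Z.abs B <= L ^ 3)%Z ->
  (r ^ 3 + A * r + B = 0)%Z -> (Z.abs r <= 2 * L)%Z.
Proof.
move=> L0 HA HB Hr; case: (Z_le_gt_dec (Z.abs r) (2 * L)) => // h; exfalso.
have r3 : (Z.abs r ^ 3 <= Z.abs A * Z.abs r + Z.abs B)%Z.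
  rewrite -Z.abs_pow -Z.abs_mul.
  have -> : (r ^ 3 = - (A * r + B))%Z by clear -Hr; lia.
  by move: (A * r)%Z; clear; lia.
have h1 : (Z.abs A * Z.abs r <= L ^ 2 * Z.abs r)%Z by apply: Z.mul_le_mono_nonneg_r; clear -HA; lia.
move: (Z.abs r) h r3 h1 => s h r3 h1.
have h2 : (L ^ 2 * s + L ^ 3 < s ^ 3)%Z.
  have e : (s ^ 3 = s * s * s)%Z by ring.
  have h3 : (2 * L * (2 * L) <= s * s)%Z by apply: Z.mul_le_mono_nonneg; clear -h L0; lia.
  have h4 : (2 * L * (2 * L) * s <= s * s * s)%Z by apply: Z.mul_le_mono_nonneg_r; clear -h h3 L0; lia.
  have l2 : (0 < L * L)%Z by apply: Z.mul_pos_pos.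
  have h5 : (L * L * (2 * L) <= L * L * s)%Z by apply: Z.mul_le_mono_nonneg_l; clear -h l2; lia.
  have l3 : (0 < L * L * L)%Z by apply: Z.mul_pos_pos.
  clear -e h4 h5 l3; lia.
clear -h2 h1 r3 HB; lia.
Qed.

Section BadPairs.
Context (T W H : R) (a4 a6 z L n : nat).
Context (T1 : 1 <= T) (H4 : INR a4 <= T ^ 4 < INR a4 + 1) (H6 : INR a6 <= T ^ 6 < INR a6 + 1)
  (Hz : INR z <= T ^ 3 < INR z + 1) (L1 : T ^ 2 <= INR L <= 2 * T ^ 2)
  (Hn : (6 * L ^ 3 < 2 ^ n)%N)
  (HW : forall m, (0 < m <= z)%N -> 3 ^ size (primes m) <= W)
  (HH : \rsum_(e <- iota 1 a4) (/ INR e) <= H).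

(** The outcome of [sqf_divisor_split] when m <= z. The inequality z < 6 e m is what remains of d >
    z and supplies the saving in [medium_fixed_le]. *)
Definition medium (A B : Z) (m e : nat) : bool :=
  [&& sqf m, coprime m (6 * Z.abs_nat A), coprime e (m ^ 2), (z < 6 * e * m)%N,
      dvZ e A, dvZ e B & dvZ (m ^ 2) (Delta A B)].

Definition in_cell (A B : Z) (i j : nat) : bool :=
  cell_ok L (2 ^ i) (2 ^ j) && ((A, B) \in [seq cell_point t | t <- cell L (2 ^ i) (2 ^ j)]).

Let L0 : (0 < L)%N.
Proof.
rewrite lt0n; apply/eqP => l0; case: L1; rewrite l0 /= => L1' _.
have : 0 < T ^ 2 by apply: pow_lt; lra.
lra.
Qed.

Let abs_le_L2 (A : Z) : A \in Zrange a4 -> (Z.abs A <= Z.of_nat L ^ 2)%Z.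
Proof.
rewrite mem_Zrange => HA.
have : (a4 <= L ^ 2)%N; last by clear -HA; lia.
apply/leP; apply: INR_le; rewrite INR_expn.
have : (T ^ 2) ^ 2 <= INR L ^ 2 by apply: pow_incr; split; [apply: pow_le; lra | lra].
have -> : (T ^ 2) ^ 2 = T ^ 4 by ring.
lra.
Qed.

Let abs_le_L3 (B : Z) : B \in Zrange a6 -> (Z.abs B <= Z.of_nat L ^ 3)%Z.
Proof.
rewrite mem_Zrange => HA.
have : (a6 <= L ^ 3)%N; last by clear -HA; lia.
apply/leP; apply: INR_le; rewrite INR_expn.
have : (T ^ 2) ^ 3 <= INR L ^ 3 by apply: pow_incr; split; [apply: pow_le; lra | lra].
have -> : (T ^ 2) ^ 3 = T ^ 6 by ring.
lra.
Qed.

(** Four cases: A = 0, to which the splitting of d does not apply; m <= z; m > z with an integral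
    root of the cubic, which is at most 2 L in size; and m > z without a root, caught by a dyadic
    cell. As a sum of indicators it turns into a union bound over the box. *)
Lemma bad_pair_cover A B d : A \in Zrange a4 -> B \in Zrange a6 -> Delta A B <> 0%Z ->
  sqf d -> (z < d)%N -> dvZ (d ^ 2) (Delta A B) ->
  1 <= INR (A == 0%Z) + \rsum_(r <- Zrange (2 * L)) INR (r ^ 3 + A * r + B == 0)%Z
    + \rsum_(m <- iota 1 z) \rsum_(e <- iota 1 a4) INR (medium A B m e)
    + \rsum_(i <- iota 0 n) \rsum_(j <- iota 0 n) INR (in_cell A B i j).
Proof.
move=> HA HB D0 sd zd dD.
have HA2 := abs_le_L2 A HA; have HB3 := abs_le_L3 B HB.
set t1 := \rsum_(r <- _) _; set t2 := \rsum_(m <- iota 1 z) _; set t3 := \rsum_(i <- iota 0 n) _.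
have p1 : 0 <= t1 by apply: rsum_ge0 => *; exact: INRb_ge0.
have p2 : 0 <= t2 by apply: rsum_ge0 => *; apply: rsum_ge0 => *; exact: INRb_ge0.
have p3 : 0 <= t3 by apply: rsum_ge0 => *; apply: rsum_ge0 => *; exact: INRb_ge0.
case: (eqVneq A 0%Z) => [A0|/eqP A0].
  have -> : INR true = 1 by [].
  lra.
have [e [m [/andP[e0 eA] [sm dem] cm ce [eA' eB mD]]]] := sqf_divisor_split d A B sd A0 dD.
have -> : INR false = 0 by [].
have m0 := sqf_gt0 _ sm.
case: (leqP m z) => mz.
  have hm : medium A B m e by rewrite /medium sm cm ce (leq_trans zd dem) eA' eB mD.
  have : 1 <= t2; last lra.
  have mi : m \in iota 1 z by rewrite mem_iota m0 add1n ltnS.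
  have ei : e \in iota 1 a4.
    by rewrite mem_iota e0 add1n ltnS; move: HA; rewrite mem_Zrange; exact: leq_trans.
  apply: Rle_trans (rsum_term_le _ _ _ _ _ mi); last by move=> *; apply: rsum_ge0 => *; exact: INRb_ge0.
  apply: Rle_trans (rsum_term_le _ _ _ _ _ ei); last by move=> *; exact: INRb_ge0.
  by rewrite hm /=; lra.
case nr : (has (fun r => r ^ 3 + A * r + B == 0)%Z (Zrange (2 * L))).
  have : 1 <= t1; last lra.
  case/hasP: nr => r ri Hr; apply: Rle_trans (rsum_term_le _ _ _ _ _ ri).
    by rewrite Hr /=; lra.
  by move=> *; exact: INRb_ge0.
have nr' r : (r ^ 3 + A * r + B <> 0)%Z.
  move=> Hr; have := integral_root_bound (Z.of_nat L) A B r ltac:(clear -L0; lia) HA2 HB3 Hr => rb.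
  have ri : r \in Zrange (2 * L) by rewrite mem_Zrange; clear -rb; lia.
  by move/negbT/hasPn/(_ r ri)/eqP: nr; apply.
have Lm : (L ^ 3 <= 8 * m ^ 2)%N.
  apply/leP; apply: INR_le; rewrite INR_expn (mult_INR 8) INR_expn.
  have -> : INR 8 = 8 by rewrite /=; lra.
  have h1 : INR L ^ 3 <= (2 * T ^ 2) ^ 3 by apply: pow_incr; split; [exact: pos_INR | lra].
  have h2 : INR z.+1 <= INR m by exact: leq_INR.
  rewrite S_INR in h2.
  have h3 : (T ^ 3) ^ 2 <= INR m ^ 2 by apply: pow_incr; split; [apply: pow_le; lra | lra].
  have e1 : (2 * T ^ 2) ^ 3 = 8 * (T ^ 3) ^ 2 by ring.
  lra.
have cg : (Z.gcd (Z.of_nat m ^ 2) (2 * A) = 1)%Z.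
  have -> : (Z.of_nat m ^ 2 = Z.of_nat (m ^ 2))%Z by clear; lia.
  apply: coprime_Zgcd; rewrite coprimeXl //; apply: coprime_dvdr cm.
  by rewrite Zabs2Nat.inj_mul multE; apply: dvdn_mul.
have mD' : (Z.of_nat m ^ 2 | Delta A B)%Z.
  have -> : (Z.of_nat m ^ 2 = Z.of_nat (m ^ 2))%Z by clear; lia.
  exact/dvZP.
have [i [j [ok inc]]] := bad_in_cell L m A B L0 m0 Lm HA2 HB3 cg mD' D0 nr'.
have : 1 <= t3; last lra.
have [il jl] : (i < n)%N /\ (j < n)%N.
  case/and4P: ok => c1 c2 c3 c4.
  (* D^2 <= 31 L^6 <= (6 L^3)^2, and then M^2 <= 4 D L <= 24 L^4 <= (6 L^3)^2, so [n] bounds both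
     exponents. *)
  have dl : (2 ^ i <= 6 * L ^ 3)%N.
    rewrite -(@leq_exp2r _ _ 2) // (leq_trans c2) // expnMn -expnM.
    by rewrite leq_mul2r orbT.
  have h1 : (2 ^ i < 2 ^ n)%N by exact: leq_ltn_trans dl Hn.
  have h2 : (2 ^ j < 2 ^ n)%N.
    apply: leq_ltn_trans Hn; rewrite -(@leq_exp2r _ _ 2) // (leq_trans c3) //.
    apply: (leq_trans (n := 4 * (6 * L ^ 3) * L)); first by rewrite leq_mul2r leq_mul2l dl !orbT.
    have -> : (4 * (6 * L ^ 3) * L = 24 * L ^ 4)%N by rewrite (expnSr L 3); clear; lia.
    rewrite expnMn -expnM; apply: leq_mul => //.
    by rewrite leq_pexp2l.
  by rewrite !ltn_exp2l // in h1 h2.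
have ii : i \in iota 0 n by rewrite mem_iota.
have ji : j \in iota 0 n by rewrite mem_iota.
apply: Rle_trans (rsum_term_le _ _ _ _ _ ii); last by move=> *; apply: rsum_ge0 => *; exact: INRb_ge0.
apply: Rle_trans (rsum_term_le _ _ _ _ _ ji); last by move=> *; exact: INRb_ge0.
by rewrite /in_cell ok inc /=; lra.
Qed.

Lemma rsum_mem_le (I : eqType) (s t : seq I) : uniq s ->
  \rsum_(x <- s) INR (x \in t) <= INR (size t).
Proof.
move=> us; rewrite -INR_sum -big_mkcond sum1_count -size_filter; apply: leq_INR.
apply: uniq_leq_size; first exact: filter_uniq.
by move=> x; rewrite mem_filter => /andP[].
Qed.

Lemma zeroA_pairs_le : \rsum_(A <- Zrange a4) \rsum_(B <- Zrange a6) INR (A == 0%Z) <= 3 * T ^ 7.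
Proof.
have -> : \rsum_(A <- Zrange a4) \rsum_(B <- Zrange a6) INR (A == 0%Z) =
    INR (size (Zrange a6)) * (\rsum_(A <- Zrange a4) INR (A \in [:: 0%Z])).
  by rewrite -rsum_mull; apply: eq_bigr => A _; rewrite rsum_const inE.
have h := rsum_mem_le _ (Zrange a4) [:: 0%Z] (Zrange_uniq a4).
rewrite [INR (size [:: _])]/= in h.
rewrite size_Zrange S_INR mult_INR [INR 2]/=.
have h0 : 0 <= \rsum_(A <- Zrange a4) INR (A \in [:: 0%Z]) by apply: rsum_ge0 => *; exact: INRb_ge0.
have a60 := pos_INR a6.
have h1 : (2 * INR a6 + 1) * (\rsum_(A <- Zrange a4) INR (A \in [:: 0%Z])) <= (2 * INR a6 + 1) * 1.
  by apply: Rmult_le_compat_l; [lra | exact: h].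
have t6 : 1 <= T ^ 6 by apply: pow_R1_Rle.
have : T ^ 6 <= T ^ 7 by apply: Rle_pow => //; lia.
lra.
Qed.

(** A and the root r determine B, which leaves O(T^4 L) = O(T^6) pairs. *)
Lemma root_pairs_le :
  \rsum_(A <- Zrange a4) \rsum_(B <- Zrange a6) \rsum_(r <- Zrange (2 * L))
    INR (r ^ 3 + A * r + B == 0)%Z <= 27 * T ^ 7.
Proof.
have t1 : 1 <= T ^ 2 by apply: pow_R1_Rle.
have t4 : 1 <= T ^ 4 by apply: pow_R1_Rle.
have h : \rsum_(A <- Zrange a4) \rsum_(B <- Zrange a6) \rsum_(r <- Zrange (2 * L))
    INR (r ^ 3 + A * r + B == 0)%Z <= \rsum_(A <- Zrange a4) \rsum_(r <- Zrange (2 * L)) 1.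
  apply: rsum_le => A _; rewrite rsum_exchange; apply: rsum_le => r _.
  apply: Rle_trans (rsum_mem_le _ (Zrange a6) [:: - (r ^ 3 + A * r)]%Z (Zrange_uniq a6)).
  apply: rsum_le => B _; rewrite inE; apply: leq_INR.
  by case: eqP => // hB; rewrite (_ : B = - (r ^ 3 + A * r))%Z ?eqxx //; lia.
apply: Rle_trans h _.
rewrite !rsum_const !size_Zrange !S_INR !mult_INR [INR 2]/= Rmult_1_r.
have a40 := pos_INR a4; have l0 := pos_INR L.
have h1 : (2 * INR a4 + 1) * (2 * (2 * INR L) + 1) <= (3 * T ^ 4) * (9 * T ^ 2).
  by apply: Rmult_le_compat; lra.
have e : (3 * T ^ 4) * (9 * T ^ 2) = 27 * T ^ 6 by ring.
have : T ^ 6 <= T ^ 7 by apply: Rle_pow => //; lia.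
lra.
Qed.

Lemma cell_pairs_le :
  \rsum_(A <- Zrange a4) \rsum_(B <- Zrange a6) \rsum_(i <- iota 0 n) \rsum_(j <- iota 0 n)
    INR (in_cell A B i j) <= 3 * 10 ^ 12 * T ^ 7 * INR n ^ 2.
Proof.
have t7 : 0 < T ^ 7 by apply: pow_lt; lra.
have -> : \rsum_(A <- Zrange a4) \rsum_(B <- Zrange a6) \rsum_(i <- iota 0 n) \rsum_(j <- iota 0 n)
    INR (in_cell A B i j) = \rsum_(i <- iota 0 n) \rsum_(j <- iota 0 n)
    \rsum_(A <- Zrange a4) \rsum_(B <- Zrange a6) INR (in_cell A B i j).
  under eq_bigr => A _ do rewrite rsum_exchange.
  rewrite rsum_exchange; apply: eq_bigr => i _.
  under eq_bigr => A _ do rewrite rsum_exchange.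
  by rewrite rsum_exchange.
have -> : 3 * 10 ^ 12 * T ^ 7 * INR n ^ 2 = INR n * (INR n * (3 * 10 ^ 12 * T ^ 7)) by ring.
set K := 3 * 10 ^ 12 * T ^ 7.
apply: (Rle_trans _ (\rsum_(i <- iota 0 n) (INR n * K))); last by rewrite rsum_const size_iota; lra.
apply: rsum_le => i _.
apply: (Rle_trans _ (\rsum_(j <- iota 0 n) K)); last by rewrite rsum_const size_iota; lra.
rewrite /K; apply: rsum_le => j _.
rewrite /in_cell; case ok: (cell_ok _ _ _) => /=; last first.
  by rewrite big1 => [|A _]; [lra | rewrite big1].
have -> : \rsum_(A <- Zrange a4) \rsum_(B <- Zrange a6)
    INR ((A, B) \in [seq cell_point t | t <- cell L (2 ^ i) (2 ^ j)]) =
    \rsum_(x <- [seq (A, B) | A <- Zrange a4, B <- Zrange a6])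
      INR (x \in [seq cell_point t | t <- cell L (2 ^ i) (2 ^ j)]).
  by rewrite big_allpairs.
apply: Rle_trans (rsum_mem_le _ _ _ _) _.
  by apply: allpairs_uniq; rewrite ?Zrange_uniq // => -[? ?] [? ?].
by rewrite size_map; apply: size_cell => //; rewrite expn_gt0.
Qed.

(** Since e is coprime to m^2, the admissible B form exactly r_A(m) classes mod e m^2, and r_A(m) is
    at most 2 to the number of primes of m. *)
Lemma column_le A m e : (0 < e)%N -> (0 < m <= z)%N -> sqf m ->
  coprime m (6 * Z.abs_nat A) -> coprime e (m ^ 2) ->
  \rsum_(B <- Zrange a6) INR (dvZ e B && dvZ (m ^ 2) (Delta A B))
    <= W * (2 * T ^ 6 / (INR e * INR m ^ 2) + 2).
Proof.
move=> e0 mz sm cm ce; have /andP[m0 _] := mz.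
have q0 : (0 < e * m ^ 2)%N by rewrite muln_gt0 e0 expn_gt0 m0.
have per (k : Z) :
    INR (dvZ e (k + Z.of_nat (e * m ^ 2)) && dvZ (m ^ 2) (Delta A (k + Z.of_nat (e * m ^ 2))))
    = INR (dvZ e k && dvZ (m ^ 2) (Delta A k)).
  congr (INR (nat_of_bool (_ && _))); apply: dvZ_congr.
    by exists (Z.of_nat (m ^ 2)); rewrite Nat2Z.inj_mul; ring.
  exists (27 * (2 * k + Z.of_nat (e * m ^ 2)) * Z.of_nat e)%Z; rewrite /Delta Nat2Z.inj_mul; ring.
have hh := zsum_periodic (fun B => INR (dvZ e B && dvZ (m ^ 2) (Delta A B))) (e * m ^ 2) q0
  (fun k => INRb_ge0 _) per a6 (T ^ 6) H6.
have e1 : \rsum_(b <- iota 0 (e * m ^ 2)) INR (dvZ e (Z.of_nat b) && dvZ (m ^ 2) (Delta A (Z.of_nat b)))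
    = INR (nrootsD A m).
  rewrite -INR_sum; congr INR.
  pose F1 b : nat := dvZ e (Z.of_nat b).
  pose F2 b : nat := dvZ (m ^ 2) (4 * A ^ 3 + 27 * Z.of_nat b ^ 2)%Z.
  have -> : nrootsD A m = ((\sum_(b < e) F1 b) * (\sum_(b < m ^ 2) F2 b))%N.
    rewrite -[LHS]mul1n; congr muln; rewrite /F1; move: e0; clear; case: e => // e _.
    rewrite big_ord_recl big1 /dvZ ?dvdn0 // => i _.
    by rewrite Zabs2Nat.id gtnNdvd // /= /bump /= ltnS.
  rewrite -crt_sum ?expn_gt0 ?m0 //.
  - rewrite -(big_mkord xpredT (fun b => F1 b * F2 b)%N) /index_iota subn0.
    by apply: eq_bigr => b _; rewrite mulnb.
  - by move=> a; rewrite /F1 /dvZ !Zabs2Nat.id /dvdn modn_mod.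
  - by move=> a; rewrite /F2 dvZ_sq_mod.
have rW : INR (nrootsD A m) <= W.
  apply: Rle_trans (HW m mz).
  apply: (Rle_trans _ (2 ^ size (primes m))); last by apply: pow_incr; lra.
  have -> : 2 = INR 2 by [].
  rewrite -INR_expn; apply: leq_INR; apply: nroots_le_omega => //.
  have -> : Z.abs_nat (2 * (4 * A ^ 3) * 27) = ((6 * Z.abs_nat A) ^ 3)%N by clear; lia.
  by rewrite coprimeXr.
rewrite e1 mult_INR INR_expn in hh.
have c0 : 0 <= 2 * T ^ 6 / (INR e * INR m ^ 2) + 2.
  have : 0 <= 2 * T ^ 6 / (INR e * INR m ^ 2); last lra.
  apply: Rmult_le_pos; first by have := pos_INR a6; lra.
  apply: Rlt_le; apply: Rinv_0_lt_compat; apply: Rmult_lt_0_compat; first exact: INR_gt0.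
  by apply: pow_lt; exact: INR_gt0.
have h2 := Rmult_le_compat_r _ _ _ c0 rW.
apply: Rle_trans h2.
move: hh; set X := bigop _ _ _; set c := 2 * T ^ 6 / _; set r := INR _ => hh.
by have := Rle_abs (X - c * r); lra.
Qed.

(** At most 4 T^4 / e values of A are multiples of e, each with the column bound. In the main term 8
    T^10 W / (e m)^2 one factor 1 / (e m) is replaced by 6 / T^3, because T^3 <= 6 e m. *)
Lemma medium_fixed_le m e : (0 < m <= z)%N -> (0 < e <= a4)%N ->
  \rsum_(A <- Zrange a4) \rsum_(B <- Zrange a6) INR (medium A B m e)
  <= 48 * T ^ 7 * W * (/ INR m * / INR e) + 8 * T ^ 4 * W * / INR e.
Proof.
move=> mz /andP[e0 ea]; have /andP[m0 _] := mz.
have e1 := INR_ge1 _ e0; have m1 := INR_ge1 _ m0.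
have ie : 0 < / INR e by apply: Rinv_0_lt_compat; lra.
have im : 0 < / INR m by apply: Rinv_0_lt_compat; lra.
have W1 : 1 <= W by apply: Rle_trans (HW m mz); apply: pow_R1_Rle; lra.
have t4 : 1 <= T ^ 4 by apply: pow_R1_Rle.
have t7 : 0 < T ^ 7 by apply: pow_lt; lra.
have rhs0 : 0 <= 48 * T ^ 7 * W * (/ INR m * / INR e) + 8 * T ^ 4 * W * / INR e.
  by apply: Rplus_le_le_0_compat; repeat apply: Rmult_le_pos; lra.
case zem : (z < 6 * e * m)%N; last first.
  rewrite big1 // => A _; rewrite big1 // => B _.
  by rewrite /medium zem !andbF.
have zem' : T ^ 3 <= 6 * INR e * INR m.
  have := leq_INR _ _ zem; rewrite S_INR !mult_INR.
  have -> : INR 6 = 6 by rewrite /=; lra.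
  lra.
set c := W * (2 * T ^ 6 / (INR e * INR m ^ 2) + 2).
have c0 : 0 <= c.
  apply: Rmult_le_pos; first lra.
  have : 0 <= 2 * T ^ 6 / (INR e * INR m ^ 2); last lra.
  apply: Rmult_le_pos; first by have := pos_INR a6; lra.
  by apply: Rlt_le; apply: Rinv_0_lt_compat; apply: Rmult_lt_0_compat; [lra | apply: pow_lt; lra].
have h1 : \rsum_(A <- Zrange a4) \rsum_(B <- Zrange a6) INR (medium A B m e)
    <= \rsum_(A <- Zrange a4) (INR (dvZ e A) * c).
  apply: rsum_le => A _.
  case cond : [&& sqf m, coprime m (6 * Z.abs_nat A), coprime e (m ^ 2) & dvZ e A].
    case/and4P: cond => sm cm ce eA.
    have -> : INR (dvZ e A) * c = c by rewrite eA /=; lra.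
    apply: Rle_trans (column_le A m e e0 mz sm cm ce).
    apply: rsum_le => B _; apply: leq_INR; rewrite /medium.
    by case: (dvZ e B); case: (dvZ _ (Delta A B)); rewrite ?andbF //; case: (_ && _).
  rewrite big1 => [|B _]; first by apply: Rmult_le_pos => //; exact: INRb_ge0.
  rewrite /medium; move: cond; case: (sqf m) => //; case: (coprime m _) => //.
  by case: (coprime e _) => //=; case: (dvZ e A) => //; rewrite !andbF.
have h2 : \rsum_(A <- Zrange a4) INR (dvZ e A) <= 4 * T ^ 4 * / INR e.
  have per (k : Z) : INR (dvZ e (k + Z.of_nat e)) = INR (dvZ e k).
    by congr (INR (nat_of_bool _)); apply: dvZ_congr; exists 1%Z; ring.
  have hh := zsum_periodic (fun B => INR (dvZ e B)) e e0 (fun k => INRb_ge0 _) per a4 (T ^ 4) H4.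
  have e2 : \rsum_(b <- iota 0 e) INR (dvZ e (Z.of_nat b)) = 1.
    move: e0; clear; case: e => // e _; rewrite /= big_cons big_seq_cond big1 => [|i].
      by rewrite /dvZ dvdn0 /=; lra.
    rewrite mem_iota => /andP[/andP[i0 ie] _].
    by rewrite /dvZ Zabs2Nat.id gtnNdvd //; rewrite add1n in ie.
  rewrite e2 in hh.
  have h3 : 1 <= T ^ 4 * / INR e.
    apply: (Rmult_le_reg_r (INR e)); first lra.
    rewrite Rmult_assoc Rinv_l; last lra.
    by have := leq_INR _ _ ea; lra.
  have := Rle_abs (\rsum_(k <- Zrange a4) INR (dvZ e k) - 2 * T ^ 4 / INR e * 1).
  rewrite /Rdiv in hh *; lra.
apply: Rle_trans h1 _; rewrite rsum_mulr.
apply: (Rle_trans _ (4 * T ^ 4 * / INR e * c)); first exact: Rmult_le_compat_r.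
have -> : 4 * T ^ 4 * / INR e * c =
    8 * T ^ 10 * W * (/ INR m * / INR e) * (/ INR m * / INR e) + 8 * T ^ 4 * W * / INR e.
  by rewrite /c; field; lra.
apply: Rplus_le_compat_r.
have h4 : T ^ 3 * (/ INR m * / INR e) <= 6.
  apply: (Rmult_le_reg_r (INR e * INR m)); first by apply: Rmult_lt_0_compat; lra.
  have -> : T ^ 3 * (/ INR m * / INR e) * (INR e * INR m) = T ^ 3 by field; lra.
  lra.
have -> : 8 * T ^ 10 * W * (/ INR m * / INR e) * (/ INR m * / INR e) =
  (8 * T ^ 7 * W * (/ INR m * / INR e)) * (T ^ 3 * (/ INR m * / INR e)) by ring.
have -> : 48 * T ^ 7 * W * (/ INR m * / INR e) = 8 * T ^ 7 * W * (/ INR m * / INR e) * 6 by ring.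
by apply: Rmult_le_compat_l => //; repeat apply: Rmult_le_pos; lra.
Qed.

(** The first term of [medium_fixed_le] is summed by two harmonic sums. The second is harmonic in e
    only, and the z <= T^3 values of m raise its T^4 to T^7. *)
Lemma medium_pairs_le : (0 < z <= a4)%N ->
  \rsum_(A <- Zrange a4) \rsum_(B <- Zrange a6) \rsum_(m <- iota 1 z) \rsum_(e <- iota 1 a4)
    INR (medium A B m e) <= 56 * T ^ 7 * W * H ^ 2.
Proof.
move=> /andP[z0 za].
have t7 : 0 < T ^ 7 by apply: pow_lt; lra.
have W1 : 1 <= W by apply: Rle_trans (HW 1 _); rewrite ?z0 //=; lra.
have -> : \rsum_(A <- Zrange a4) \rsum_(B <- Zrange a6) \rsum_(m <- iota 1 z) \rsum_(e <- iota 1 a4)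
    INR (medium A B m e) = \rsum_(m <- iota 1 z) \rsum_(e <- iota 1 a4)
    \rsum_(A <- Zrange a4) \rsum_(B <- Zrange a6) INR (medium A B m e).
  under eq_bigr => A _ do rewrite rsum_exchange.
  rewrite rsum_exchange; apply: eq_bigr => i _.
  under eq_bigr => A _ do rewrite rsum_exchange.
  by rewrite rsum_exchange.
have ipos := INR_inv_ge0.
have Hz' : \rsum_(m <- iota 1 z) (/ INR m) <= H.
  apply: Rle_trans HH; apply: rsum_subset_uniq => //; first exact: iota_uniq.
  by move=> i; rewrite !mem_iota !add1n !ltnS => /andP[-> iz]; exact: leq_trans za.
have H1 : 1 <= H.
  apply: Rle_trans Hz'; apply: Rle_trans (rsum_term_le _ _ (fun m => / INR m) 1%N ipos _).
    by rewrite /= Rinv_1; lra.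
  by rewrite mem_iota; clear -z0; lia.
apply: (Rle_trans _ (\rsum_(m <- iota 1 z) \rsum_(e <- iota 1 a4)
    (48 * T ^ 7 * W * (/ INR m * / INR e) + 8 * T ^ 4 * W * / INR e))).
  apply: rsum_le_seq => m; rewrite mem_iota add1n ltnS => mz _.
  apply: rsum_le_seq => e; rewrite mem_iota add1n ltnS => ea _.
  exact: medium_fixed_le.
apply: (Rle_trans _ (\rsum_(m <- iota 1 z) (48 * T ^ 7 * W * H * / INR m + 8 * T ^ 4 * W * H))).
  apply: rsum_le => m _; rewrite rsum_add !rsum_mull; have hm := ipos m.
  apply: Rplus_le_compat; last first.
    by apply: Rmult_le_compat_l => //; repeat apply: Rmult_le_pos; try lra; apply: pow_le; lra.
  have -> : 48 * T ^ 7 * W * H * / INR m = 48 * T ^ 7 * W * (/ INR m * H) by ring.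
  apply: Rmult_le_compat_l; first by repeat apply: Rmult_le_pos; lra.
  exact: Rmult_le_compat_l.
rewrite rsum_add rsum_mull rsum_const size_iota.
have h1 : 48 * T ^ 7 * W * H * (\rsum_(m <- iota 1 z) (/ INR m)) <= 48 * T ^ 7 * W * H * H.
  by apply: Rmult_le_compat_l => //; repeat apply: Rmult_le_pos; lra.
have h2 : INR z * (8 * T ^ 4 * W * H) <= T ^ 3 * (8 * T ^ 4 * W * H).
  apply: Rmult_le_compat_r; last lra.
  by repeat apply: Rmult_le_pos; try lra; apply: pow_le; lra.
have h3 : 8 * T ^ 7 * W * H * 1 <= 8 * T ^ 7 * W * H * H.
  by apply: Rmult_le_compat_l => //; repeat apply: Rmult_le_pos; lra.
have e3 : T ^ 3 * (8 * T ^ 4 * W * H) = 8 * T ^ 7 * W * H * 1 by ring.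
have -> : 56 * T ^ 7 * W * H ^ 2 = 48 * T ^ 7 * W * H * H + 8 * T ^ 7 * W * H * H by ring.
lra.
Qed.

Definition bad (D : seq nat) (A B : Z) : bool :=
  (Delta A B != 0%Z) && has (fun d => (z < d)%N && dvZ (d ^ 2) (Delta A B)) D.

Lemma bad_pairs_le D : (0 < z <= a4)%N -> (forall d, d \in D -> sqf d) ->
  \rsum_(A <- Zrange a4) \rsum_(B <- Zrange a6) INR (bad D A B)
  <= T ^ 7 * (30 + 56 * W * H ^ 2 + 3 * 10 ^ 12 * INR n ^ 2).
Proof.
move=> za sD.
have h : \rsum_(A <- Zrange a4) \rsum_(B <- Zrange a6) INR (bad D A B) <=
  \rsum_(A <- Zrange a4) \rsum_(B <- Zrange a6)
   (INR (A == 0%Z) + \rsum_(r <- Zrange (2 * L)) INR (r ^ 3 + A * r + B == 0)%Z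
    + \rsum_(m <- iota 1 z) \rsum_(e <- iota 1 a4) INR (medium A B m e)
    + \rsum_(i <- iota 0 n) \rsum_(j <- iota 0 n) INR (in_cell A B i j)).
  apply: rsum_le_seq => A HA _; apply: rsum_le_seq => B HB _.
  case b : (bad D A B); last first.
    do 3 (apply: Rplus_le_le_0_compat; last by do ?(apply: rsum_ge0; move=> ? _); exact: INRb_ge0).
    exact: INRb_ge0.
  case/andP: b => /eqP D0 /hasP[d dD /andP[zd dd]].
  exact: (bad_pair_cover A B d HA HB D0 (sD d dD) zd dd).
apply: Rle_trans h _.
have -> : \rsum_(A <- Zrange a4) \rsum_(B <- Zrange a6)
   (INR (A == 0%Z) + \rsum_(r <- Zrange (2 * L)) INR (r ^ 3 + A * r + B == 0)%Z
    + \rsum_(m <- iota 1 z) \rsum_(e <- iota 1 a4) INR (medium A B m e)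
    + \rsum_(i <- iota 0 n) \rsum_(j <- iota 0 n) INR (in_cell A B i j)) =
  (\rsum_(A <- Zrange a4) \rsum_(B <- Zrange a6) INR (A == 0%Z)) +
  (\rsum_(A <- Zrange a4) \rsum_(B <- Zrange a6) \rsum_(r <- Zrange (2 * L))
     INR (r ^ 3 + A * r + B == 0)%Z) +
  (\rsum_(A <- Zrange a4) \rsum_(B <- Zrange a6) \rsum_(m <- iota 1 z) \rsum_(e <- iota 1 a4)
     INR (medium A B m e)) +
  (\rsum_(A <- Zrange a4) \rsum_(B <- Zrange a6) \rsum_(i <- iota 0 n) \rsum_(j <- iota 0 n)
     INR (in_cell A B i j)).
  by rewrite -!rsum_add; apply: eq_bigr => A _; rewrite -!rsum_add.
have := zeroA_pairs_le; have := root_pairs_le; have := medium_pairs_le za; have := cell_pairs_le.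
lra.
Qed.

End BadPairs.

(** * The main estimate *)

Lemma mu_sq n : IZR (mu n ^ 2) = INR (sqf (Z.abs_nat n)).
Proof.
rewrite /mu /mu_nat /sqf lt0n; case: eqP => // _ /=.
case: (all _ _) => //=.
have [->|->] : ((-1) ^ Z.of_nat (size (primes (Z.abs_nat n))) = 1 \/
   (-1) ^ Z.of_nat (size (primes (Z.abs_nat n))) = -1)%Z; rewrite ?Rmult_1_r //.
elim: (size _) => [|k IH]; [by left | rewrite Nat2Z.inj_succ Z.pow_succ_r; last lia].
by case: IH => ->; [right|left].
Qed.

Definition primes_below N := [seq p <- iota 0 N | prime p].

Lemma primes_below_uniq N : uniq (primes_below N).
Proof. by rewrite filter_uniq ?iota_uniq. Qed.

Lemma primes_below_prime N : all prime (primes_below N).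
Proof. exact: filter_all. Qed.

Lemma sqdiv_sfmult m : sfmult (fun d => INR (d ^ 2 %| m)%N).
Proof.
split=> [|p d pp pd sd]; first by rewrite dvd1n.
have co : coprime (p ^ 2) (d ^ 2) by rewrite coprimeXl // coprimeXr // prime_coprime.
by rewrite expnMn Gauss_dvd // -mulnb mult_INR.
Qed.

Lemma rprod_eq0 (I : eqType) (r : seq I) (F : I -> R) i : i \in r -> F i = 0 ->
  \big[Rmult/1]_(j <- r) F j = 0.
Proof.
move=> + Fi; elim: r => [//|x r IH]; rewrite inE big_cons => /orP[/eqP<-|/IH->].
  by rewrite Fi Rmult_0_l.
by rewrite Rmult_0_r.
Qed.

(** The sum is the product of 1 - [p^2 | m] over p < N, which vanishes exactly when some such p^2
    divides m. The case m = 0 is included, through p = 2. *)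
Lemma sqf_expand m N : (m < N)%N -> (2 < N)%N ->
  INR (sqf m) = \rsum_(d <- sfprods (primes_below N)) (sg d * INR (d ^ 2 %| m)%N).
Proof.
move=> mN N2; have := sum_sg_sfprods _ _ (sqdiv_sfmult m) (primes_below_uniq N) (primes_below_prime N).
move=> /= ->.
case sm : (sqf m).
  rewrite big_seq_cond big1 // => p; rewrite andbT mem_filter => /andP[pp _].
  by case/sqfP: sm => _ /(_ p pp) /negPf ->; rewrite /=; lra.
have [p pp pm] : exists2 p, p \in primes_below N & (p ^ 2 %| m)%N.
  case: (posnP m) => [m0|m0].
    by exists 2%N; rewrite ?m0 ?dvdn0 // mem_filter mem_iota.
  move: sm; rewrite /sqf m0 /= => /negbT /allPn[p]; rewrite mem_primes => /and3P[pp _ pm] lp.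
  exists p; first by rewrite mem_filter pp mem_iota (leq_ltn_trans _ mN) // dvdn_leq.
  rewrite pfactor_dvdn //; have : (0 < logn p m)%N by rewrite logn_gt0 mem_primes pp m0 pm.
  by move: lp; case: (logn p m) => [|[|k]].
by rewrite (rprod_eq0 _ _ _ p) // pm /=; lra.
Qed.

(** The count is a product of 1 + [p^2 | m], where only primes of m give more than 1. The factor 2
    is relaxed to 3 so that the bound [W] applies. *)
Lemma sqdiv_count m N : (0 < m)%N ->
  \rsum_(d <- sfprods (primes_below N)) INR (d ^ 2 %| m)%N <= 3 ^ size (primes m).
Proof.
move=> m0; rewrite sum_sfprods ?primes_below_uniq ?primes_below_prime //; last exact: sqdiv_sfmult.
apply: (Rle_trans _ (\big[Rmult/1]_(p <- primes_below N) (if p \in primes m then 3 else 1))).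
  apply: rprod_le => p; rewrite mem_filter => /andP[pp _].
  have := INRb_ge0 (p ^ 2 %| m)%N; have := INRb_le1 (p ^ 2 %| m)%N.
  case pm : (p \in primes m); first by lra.
  move=> _ _.
  have -> : (p ^ 2 %| m)%N = false; last by rewrite /=; lra.
  apply/negP => h; move: pm; rewrite mem_primes pp m0 (dvdn_trans _ h) //.
  by rewrite dvdn_exp.
rewrite -big_mkcond -big_filter.
have e (r : seq nat) : \big[Rmult/1]_(p <- r) 3 = 3 ^ size r.
  by elim: r => [|p r IH]; rewrite ?big_nil ?big_cons //= IH.
rewrite e; apply: Rle_pow; first lra.
apply/leP; apply: uniq_leq_size; first by rewrite filter_uniq // primes_below_uniq.
by move=> p; rewrite mem_filter => /andP[].
Qed.

Lemma foldr_rsum (I : Type) (r : seq I) F : foldr Rplus 0 (map F r) = \rsum_(i <- r) F i.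
Proof. by elim: r => [|x r IH]; rewrite ?big_nil ?big_cons //= IH. Qed.

Lemma foldr_rprod (I : Type) (r : seq I) F : foldr Rmult 1 (map F r) = \big[Rmult/1]_(i <- r) F i.
Proof. by elim: r => [|x r IH]; rewrite ?big_nil ?big_cons //= IH. Qed.

Lemma euler_partialE N : euler_partial N = \big[Rmult/1]_(p <- primes_below N) (1 - gdens p).
Proof.
rewrite /euler_partial foldr_rprod; apply: eq_big_seq => p; rewrite mem_filter => /andP[pp _].
by rewrite gdens_prime.
Qed.

Lemma euler_partial_sum N :
  euler_partial N = \rsum_(d <- sfprods (primes_below N)) (sg d * gdens d).
Proof.
by rewrite euler_partialE sum_sg_sfprods ?primes_below_uniq ?primes_below_prime //; exact: gdens_sfmult.
Qed.

Lemma euler_partial_ge0 N : 0 <= euler_partial N.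
Proof.
rewrite euler_partialE big_seq_cond; elim/big_ind: _ => [|x y|p]; [lra | exact: Rmult_le_pos |].
by rewrite andbT mem_filter => /andP[/gdens_prime_le1]; lra.
Qed.

Lemma euler_partial_cv : exists P, Un_cv euler_partial P.
Proof.
have dec : Un_decreasing euler_partial.
  move=> N; rewrite !euler_partialE /primes_below iotaSr add0n filter_cat /=.
  case pN : (prime N); last by rewrite cats0; lra.
  have -> : \big[Rmult/1]_(p <- [seq p <- iota 0 N | prime p] ++ [:: N]) (1 - gdens p) =
      \big[Rmult/1]_(p <- primes_below N) (1 - gdens p) * (1 - gdens N).
    by rewrite big_cat big_seq1.
  have := euler_partial_ge0 N; rewrite euler_partialE => h.
  have h1 := gdens_ge0 N.
  have : 0 <= (\big[Rmult/1]_(p <- primes_below N) (1 - gdens p)) * gdens N by apply: Rmult_le_pos.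
  rewrite -/(primes_below N); lra.
have lb : has_lb euler_partial.
  by exists 0 => x [N ->]; rewrite /opp_seq; have := euler_partial_ge0 N; lra.
by have [P HP] := decreasing_cv _ dec lb; exists P.
Qed.

Lemma Un_cv_bound u l s c B N0 : Un_cv u l ->
  (forall N, (N0 <= N)%N -> Rabs (s - c * u N) <= B) -> Rabs (s - c * l) <= B.
Proof.
move=> Hu HB; apply: le_epsilon => e e0.
have c0 := Rabs_pos c; have e1 : 0 < e / (Rabs c + 1) by apply: Rdiv_lt_0_compat; lra.
have [N1 HN1] := Hu _ e1.
have h1 := HB (maxn N0 N1) (leq_maxl _ _).
have h2 : Rabs (u (maxn N0 N1) - l) < e / (Rabs c + 1).
  by apply: HN1; apply/leP; exact: leq_maxr.
set v := u _ in h1 h2.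
have -> : s - c * l = (s - c * v) + c * (v - l) by ring.
apply: Rle_trans (Rabs_triang _ _) _; rewrite Rabs_mult.
have h3 : Rabs c * Rabs (v - l) <= Rabs c * (e / (Rabs c + 1)) by apply: Rmult_le_compat_l; lra.
have h4 : Rabs c * (e / (Rabs c + 1)) <= (Rabs c + 1) * (e / (Rabs c + 1)).
  by apply: Rmult_le_compat_r; lra.
have h5 : (Rabs c + 1) * (e / (Rabs c + 1)) = e by field; lra.
lra.
Qed.

(** [up x] exceeds the integer part by one, even at integers, so the ranges in [S] are longer by one
    at each end; the tests [Rle_dec] discard the excess. *)
Lemma S_sqf X a4 a6 : 0 <= X -> INR a4 <= X ^ 4 < INR a4 + 1 -> INR a6 <= X ^ 6 < INR a6 + 1 ->
  S X = \rsum_(A <- Zrange a4) \rsum_(B <- Zrange a6) INR (sqf (Z.abs_nat (Delta A B))).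
Proof.
move=> X0 H4 H6.
have upE a x : INR a <= x < INR a + 1 -> Z.to_nat (up x) = a.+1.
  move=> [h1 h2]; suff <- : (Z.of_nat a + 1)%Z = up x by lia.
  by apply: tech_up; rewrite plus_IZR -INR_IZR_INZ; lra.
have cond a x (A : Z) : INR a <= x < INR a + 1 ->
    (if Rle_dec (Rabs (IZR A)) x then true else false) = (Z.abs_nat A <= a)%N.
  move=> [h1 h2]; rewrite -abs_IZR -(Zabs2Nat.id_abs A) -INR_IZR_INZ.
  case: Rle_dec => h; apply/esym.
    have : INR (Z.abs_nat A) < INR a.+1 by rewrite S_INR; lra.
    by move/INR_lt; lia.
  by apply/negP => h3; apply: h; apply: Rle_trans h1; exact: leq_INR.
have shrink a (F : Z -> R) : \rsum_(A <- Zrange a.+1) (if (Z.abs_nat A <= a)%N then F A else 0)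
    = \rsum_(A <- Zrange a) F A.
  rewrite -big_mkcond -big_filter; apply: perm_big; apply: uniq_perm.
  - by rewrite filter_uniq // Zrange_uniq.
  - exact: Zrange_uniq.
  by move=> A; rewrite mem_filter !mem_Zrange; apply/andP/idP => [[]|h]; last by split=> //; exact: leqW.
rewrite /S (upE a4 _ H4) (upE a6 _ H6) foldr_rsum -[RHS]shrink; apply: eq_bigr => A _.
rewrite foldr_rsum -(cond a4 (X ^ 4) A H4).
case: (Rle_dec (Rabs (IZR A)) (X ^ 4)) => ?; last by rewrite big1.
rewrite -[RHS]shrink; apply: eq_bigr => B _; rewrite -(cond a6 (X ^ 6) B H6).
by case: (Rle_dec (Rabs (IZR B)) (X ^ 6)) => ? //; rewrite mu_sq.
Qed.

(** A determines B^2, hence B up to sign. *)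
Lemma zero_disc_column_le A (s : seq Z) : uniq s -> \rsum_(B <- s) INR (Delta A B == 0%Z) <= 2.
Proof.
move=> us; case h : (has (fun B => Delta A B == 0%Z) s); last first.
  rewrite big_seq_cond big1 => [|B]; first lra.
  by rewrite andbT => /(hasPn (negbT h)) /negPf ->.
case/hasP: h => C _ /eqP HC.
apply: Rle_trans (rsum_mem_le _ s [:: C; (- C)%Z] us).
apply: rsum_le => B _; apply: leq_INR; case: eqP => // HB.
have : ((B - C) * (B + C) = 0)%Z by move: HB HC; rewrite /Delta; clear; lia.
move=> /Z.mul_eq_0 h; suff -> : B \in [:: C; (- C)%Z] by [].
by rewrite !inE; case: h => h; apply/orP; [left|right]; apply/eqP; lia.
Qed.

(** * Comparison with a partial Euler product *)

Lemma Rdiv_ge0 x y : 0 <= x -> 0 < y -> 0 <= x / y.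
Proof. by move=> x0 y0; apply: Rmult_le_pos => //; apply: Rlt_le; exact: Rinv_0_lt_compat. Qed.

Section Estimate.
Context (T W H : R) (a4 a6 z L n N : nat).
Context (T1 : 1 <= T) (H4 : INR a4 <= T ^ 4 < INR a4 + 1) (H6 : INR a6 <= T ^ 6 < INR a6 + 1)
  (Hz : INR z <= T ^ 3 < INR z + 1) (L1 : T ^ 2 <= INR L <= 2 * T ^ 2)
  (Hn : (6 * L ^ 3 < 2 ^ n)%N)
  (HW : forall m, (0 < m <= 31 * L ^ 6)%N -> 3 ^ size (primes m) <= W)
  (HH : \rsum_(e <- iota 1 a4) (/ INR e) <= H)
  (HN : (31 * L ^ 6 < N)%N) (N2 : (2 < N)%N).

Let D := sfprods (primes_below N).

Let D_sqf d : d \in D -> sqf d.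
Proof. by case/(mem_sfprods _ _ (primes_below_uniq N) (primes_below_prime N)). Qed.

Let D_uniq : uniq D.
Proof. exact: sfprods_uniq (primes_below_uniq N) (primes_below_prime N). Qed.

Let z_range : (0 < z <= a4)%N.
Proof.
have t3 : 1 <= T ^ 3 by apply: pow_R1_Rle.
apply/andP; split; last first.
  have : T ^ 3 <= T ^ 4 by apply: Rle_pow => //; lia.
  move=> h; have : INR z < INR a4.+1 by rewrite S_INR; lra.
  by move/INR_lt; lia.
have : INR 0 < INR z.+1 by rewrite S_INR /=; lra.
by case: z Hz => // -[_]; rewrite /=; lra.
Qed.

Let L0 : (0 < L)%N.
Proof.
rewrite lt0n; apply/eqP => l0; case: L1; rewrite l0 /= => L1' _.
have : 0 < T ^ 2 by apply: pow_lt; lra.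
lra.
Qed.

Let a4_le : (a4 <= L ^ 2)%N.
Proof.
apply/leP; apply: INR_le; rewrite INR_expn.
have : (T ^ 2) ^ 2 <= INR L ^ 2 by apply: pow_incr; split; [apply: pow_le; lra | lra].
have -> : (T ^ 2) ^ 2 = T ^ 4 by ring.
lra.
Qed.

Let a6_le : (a6 <= L ^ 3)%N.
Proof.
apply/leP; apply: INR_le; rewrite INR_expn.
have : (T ^ 2) ^ 3 <= INR L ^ 3 by apply: pow_incr; split; [apply: pow_le; lra | lra].
have -> : (T ^ 2) ^ 3 = T ^ 6 by ring.
lra.
Qed.

Let z_le : (z <= 31 * L ^ 6)%N.
Proof.
case/andP: z_range => _ h; apply: (leq_trans h); apply: (leq_trans a4_le).
apply: (leq_trans (n := 1 * L ^ 6)); last by rewrite leq_mul2r orbT.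
by rewrite mul1n leq_pexp2l.
Qed.

Let HWz m : (0 < m <= z)%N -> 3 ^ size (primes m) <= W.
Proof. by case/andP=> m0 mz; apply: HW; rewrite m0 (leq_trans mz). Qed.

Let W1 : 1 <= W.
Proof. by have [z0 _] := andP z_range; have := HWz 1%N z0; rewrite /=; lra. Qed.

Let Delta_le A B : A \in Zrange a4 -> B \in Zrange a6 -> (Z.abs_nat (Delta A B) <= 31 * L ^ 6)%N.
Proof.
rewrite !mem_Zrange => HA HB.
have := Delta_abs_le (Z.of_nat L) A B ltac:(lia).
have hA : (Z.abs A <= Z.of_nat L ^ 2)%Z by move: (leq_trans HA a4_le); clear; lia.
have hB : (Z.abs B <= Z.of_nat L ^ 3)%Z by move: (leq_trans HB a6_le); clear; lia.
by move=> /(_ hA hB); clear; lia.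
Qed.

(** Zero discriminants contribute nothing to [S] but lie in every [boxdiv]. Leaving them out costs 6
    T^4 for each d <= z, in total O(T^7), and keeps the sum over large d finite uniformly in N. *)
Let cnt d : R := \rsum_(A <- Zrange a4) \rsum_(B <- Zrange a6)
  INR ((Delta A B != 0%Z) && dvZ (d ^ 2) (Delta A B)).

Let cnt_ge0 d : 0 <= cnt d.
Proof. by do 2 (apply: rsum_ge0 => ? _); exact: INRb_ge0. Qed.

Let zero_disc_le : \rsum_(A <- Zrange a4) \rsum_(B <- Zrange a6) INR (Delta A B == 0%Z) <= 6 * T ^ 4.
Proof.
apply: (Rle_trans _ (\rsum_(A <- Zrange a4) 2)).
  by apply: rsum_le => A _; apply: zero_disc_column_le; exact: Zrange_uniq.
rewrite rsum_const size_Zrange S_INR mult_INR [INR 2]/=.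
have : 1 <= T ^ 4 by apply: pow_R1_Rle.
lra.
Qed.

Let boxdiv_cnt d : Rabs (boxdiv a4 a6 d - cnt d) <= 6 * T ^ 4.
Proof.
apply: Rle_trans zero_disc_le; rewrite /boxdiv /cnt -rsum_sub.
apply: Rle_trans (rsum_abs _ _ _) _; apply: rsum_le => A _.
rewrite -rsum_sub; apply: Rle_trans (rsum_abs _ _ _) _; apply: rsum_le => B _.
case: eqP => _ /=; last by rewrite Rminus_diag Rabs_R0; lra.
by rewrite Rminus_0_r Rabs_pos_eq; [exact: INRb_le1 | exact: INRb_ge0].
Qed.

Let S_expand : S T = \rsum_(d <- D) (sg d * cnt d).
Proof.
rewrite (S_sqf T a4 a6) //; last lra.
under [RHS]eq_bigr => d _ do rewrite -rsum_mull.
rewrite [RHS]rsum_exchange; apply: eq_big_seq => A HA.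
under [RHS]eq_bigr => d _ do rewrite -rsum_mull.
rewrite [RHS]rsum_exchange; apply: eq_big_seq => B HB.
case: eqP => [->|D0] /=; last first.
  by rewrite (sqf_expand _ N) // (leq_ltn_trans (Delta_le A B HA HB)).
by rewrite big1 // => d _; rewrite Rmult_0_r.
Qed.

Let small_le : \rsum_(d <- D | (d <= z)%N) Rabs (cnt d - 4 * T ^ 10 * gdens d)
  <= 72 * W * H * T ^ 7 + 6 * T ^ 7.
Proof.
pose F d := 6 * W * (4 * T ^ 6 * / INR d + 4 * T ^ 4 + 4 * INR d) + 6 * T ^ 4.
have t4 : 1 <= T ^ 4 by apply: pow_R1_Rle.
have t6 : 1 <= T ^ 6 by apply: pow_R1_Rle.
have t3 : 1 <= T ^ 3 by apply: pow_R1_Rle.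
have ipos := INR_inv_ge0.
have F0 d : 0 <= F d.
  rewrite /F; have := ipos d; have := pos_INR d => *.
  apply: Rplus_le_le_0_compat; last lra.
  apply: Rmult_le_pos; first lra.
  have : 0 <= 4 * T ^ 6 * / INR d by apply: Rmult_le_pos; lra.
  lra.
apply: (Rle_trans _ (\rsum_(d <- [seq d <- D | (d <= z)%N]) F d)).
  rewrite -big_filter; apply: rsum_le_seq => d; rewrite mem_filter => /andP[dz /D_sqf sd] _.
  have d0 := sqf_gt0 _ sd; have d1 := INR_ge1 _ d0.
  have -> : cnt d - 4 * T ^ 10 * gdens d =
    (boxdiv a4 a6 d - 4 * (T ^ 4 * T ^ 6) * gdens d) + - (boxdiv a4 a6 d - cnt d) by ring.
  apply: Rle_trans (Rabs_triang _ _) _; rewrite Rabs_Ropp.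
  apply: Rplus_le_compat (boxdiv_cnt d).
  apply: Rle_trans (boxdiv_approx _ _ _ _ H4 H6 d sd) _.
  have hR : INR (totroots d) <= 6 * W * INR d.
    have := leq_INR _ _ (totroots_le d sd); rewrite (mult_INR (6 * _)) (mult_INR 6) INR_expn.
    have -> : INR 6 = 6 by rewrite /=; lra.
    have -> : INR 3 = 3 by rewrite /=; lra.
    move=> h; apply: Rle_trans h _; apply: Rmult_le_compat_r; first lra.
    by apply: Rmult_le_compat_l; [lra | apply: HWz; rewrite d0].
  have id : 0 < / INR d by apply: Rinv_0_lt_compat; lra.
  have c0 : 0 <= 4 * T ^ 6 / INR d ^ 2 + 4 * T ^ 4 / INR d + 4.
    have := Rdiv_ge0 (4 * T ^ 6) (INR d ^ 2) ltac:(lra) (pow_lt (INR d) 2 ltac:(lra)).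
    have := Rdiv_ge0 (4 * T ^ 4) (INR d) ltac:(lra) ltac:(lra).
    lra.
  apply: (Rle_trans _ (6 * W * INR d * (4 * T ^ 6 / INR d ^ 2 + 4 * T ^ 4 / INR d + 4))).
    exact: Rmult_le_compat_r.
  by apply: Req_le; field; lra.
apply: (Rle_trans _ (\rsum_(d <- iota 1 z) F d)).
  apply: rsum_subset_uniq => //; first exact: filter_uniq.
  move=> d; rewrite mem_filter => /andP[dz /D_sqf /sqf_gt0 d0].
  by rewrite mem_iota d0 add1n ltnS.
have zT : INR z <= T ^ 3 by lra.
have h1 : \rsum_(d <- iota 1 z) F d <=
    \rsum_(d <- iota 1 z) (6 * W * (4 * T ^ 6) * / INR d + (6 * W * (4 * T ^ 4 + 4 * T ^ 3) + 6 * T ^ 4)).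
  apply: rsum_le_seq => d; rewrite mem_iota add1n ltnS => /andP[_ dz] _; rewrite /F.
  have : 6 * W * (4 * INR d) <= 6 * W * (4 * T ^ 3).
    by apply: Rmult_le_compat_l; [lra | have := leq_INR _ _ dz; lra].
  lra.
apply: Rle_trans h1 _; rewrite rsum_add rsum_mull rsum_const size_iota.
have [z0 za] := andP z_range.
have Hz' : \rsum_(m <- iota 1 z) (/ INR m) <= H.
  apply: Rle_trans HH; apply: rsum_subset_uniq => //; first exact: iota_uniq.
  by move=> i; rewrite !mem_iota !add1n !ltnS => /andP[-> iz]; exact: leq_trans za.
have H1 : 1 <= H.
  apply: Rle_trans Hz'; apply: Rle_trans (rsum_term_le _ _ (fun m => / INR m) 1%N ipos _).
    by rewrite /= Rinv_1; lra.
  by rewrite mem_iota; clear -z0; lia.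
have w0 : 0 <= 6 * W * (4 * T ^ 6) by apply: Rmult_le_pos; lra.
have h2 := Rmult_le_compat_l _ _ _ w0 Hz'.
have h3 : INR z * (6 * W * (4 * T ^ 4 + 4 * T ^ 3) + 6 * T ^ 4) <=
    T ^ 3 * (6 * W * (4 * T ^ 4 + 4 * T ^ 3) + 6 * T ^ 4).
  apply: Rmult_le_compat_r => //; apply: Rplus_le_le_0_compat; last lra.
  by apply: Rmult_le_pos; lra.
have t67 : T ^ 6 <= T ^ 7 by apply: Rle_pow => //; lia.
have h4 : 6 * W * (4 * T ^ 6) * H <= 24 * (W * H) * T ^ 7.
  have : W * H * T ^ 6 <= W * H * T ^ 7 by apply: Rmult_le_compat_l => //; apply: Rmult_le_pos; lra.
  lra.
have h5 : T ^ 3 * (6 * W * (4 * T ^ 4 + 4 * T ^ 3) + 6 * T ^ 4) <= 48 * W * T ^ 7 + 6 * T ^ 7.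
  have : W * T ^ 6 <= W * T ^ 7 by apply: Rmult_le_compat_l; lra.
  have -> : T ^ 3 * (6 * W * (4 * T ^ 4 + 4 * T ^ 3) + 6 * T ^ 4) =
    24 * (W * T ^ 7) + 24 * (W * T ^ 6) + 6 * T ^ 7 by ring.
  lra.
have h6 : W * T ^ 7 * 1 <= W * T ^ 7 * H.
  by apply: Rmult_le_compat_l => //; apply: Rmult_le_pos; lra.
lra.
Qed.

(** A pair contributes only if it is [bad], and then through at most W values of d by the divisor
    bound. *)
Let large_le : \rsum_(d <- D | ~~ (d <= z)%N) cnt d
  <= W * (T ^ 7 * (30 + 56 * W * H ^ 2 + 3 * 10 ^ 12 * INR n ^ 2)).
Proof.
have h := bad_pairs_le T W H a4 a6 z L n T1 H4 H6 Hz L1 Hn HWz HH D z_range D_sqf.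
apply: (Rle_trans _ (W * \rsum_(A <- Zrange a4) \rsum_(B <- Zrange a6) INR (bad z D A B))); last first.
  by apply: Rmult_le_compat_l; lra.
rewrite /cnt rsum_exchange -rsum_mull; apply: rsum_le_seq => A HA _.
rewrite rsum_exchange -rsum_mull; apply: rsum_le_seq => B HB _.
rewrite /bad; case: eqP => [_|D0] /=; first by rewrite big1 //; lra.
have m0 : (0 < Z.abs_nat (Delta A B))%N by clear -D0; lia.
case hb : (has _ D) => /=; last first.
  rewrite Rmult_0_r; apply: Req_le; rewrite big_seq_cond big1 // => d /andP[dD dz].
  by move/negbT/hasPn/(_ d dD): hb; rewrite ltnNge dz /= => /negPf ->.
rewrite Rmult_1_r; apply: (Rle_trans _ (\rsum_(d <- D) INR (dvZ (d ^ 2) (Delta A B)))).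
  by apply: rsum_widen => // d _; exact: INRb_ge0.
apply: Rle_trans (sqdiv_count _ N m0) _.
by apply: HW; rewrite m0 Delta_le.
Qed.

Lemma main_estimate : Rabs (S T - 4 * T ^ 10 * euler_partial N) <=
  72 * W * H * T ^ 7 + 6 * T ^ 7
  + W * (T ^ 7 * (30 + 56 * W * H ^ 2 + 3 * 10 ^ 12 * INR n ^ 2))
  + 4 * T ^ 10 * (\rsum_(d <- sfprods (primes_below N) | ~~ (d <= z)%N) gdens d).
Proof.
have t10 : 0 < T ^ 10 by apply: pow_lt; lra.
have -> : S T - 4 * T ^ 10 * euler_partial N = \rsum_(d <- D) (sg d * (cnt d - 4 * T ^ 10 * gdens d)).
  rewrite S_expand euler_partial_sum -/D -rsum_mull -rsum_sub; apply: eq_bigr => d _; ring.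
apply: Rle_trans (rsum_abs _ _ _) _.
have -> : \rsum_(d <- D) Rabs (sg d * (cnt d - 4 * T ^ 10 * gdens d)) =
   (\rsum_(d <- D | (d <= z)%N) Rabs (cnt d - 4 * T ^ 10 * gdens d)) +
   \rsum_(d <- D | ~~ (d <= z)%N) Rabs (cnt d - 4 * T ^ 10 * gdens d).
  rewrite (bigID (fun d => (d <= z)%N)) /=.
  by congr Rplus; apply: eq_bigr => d _; rewrite Rabs_mult sg_abs Rmult_1_l.
rewrite Rplus_assoc; apply: Rplus_le_compat small_le _.
apply: (Rle_trans _ (\rsum_(d <- D | ~~ (d <= z)%N) (cnt d + 4 * T ^ 10 * gdens d))).
  apply: rsum_le => d _; have := cnt_ge0 d; have g0 := gdens_ge0 d => c0.
  have : 0 <= 4 * T ^ 10 * gdens d by apply: Rmult_le_pos; lra.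
  by move=> ?; apply: Rabs_le; lra.
by rewrite rsum_add rsum_mull; apply: Rplus_le_compat_r; exact: large_le.
Qed.
End Estimate.

(** By the divisor bound [gdens d] is at most 6 C d^(s - 2), and the tail of this series does not
    depend on N. *)
Lemma gdens_tail_le C s z N : 0 < s < 1 -> (0 < z)%N ->
  (forall m, (0 < m)%N -> 3 ^ size (primes m) <= C * Rpower (INR m) s) ->
  \rsum_(d <- sfprods (primes_below N) | ~~ (d <= z)%N) gdens d
    <= 6 * C * (Rpower (INR z) (- (1 - s)) / (1 - s)).
Proof.
move=> [s0 s1] z0 HC; set D := sfprods _.
have D_sqf d : d \in D -> sqf d.
  by case/(mem_sfprods _ _ (primes_below_uniq N) (primes_below_prime N)).
have C0 : 0 <= C.
  have := HC 1%N isT; rewrite /= /Rpower ln_1 Rmult_0_r exp_0; lra.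
(* A crude bound for every element of [D]; [power_tail_le] is uniform in the length of the range. *)
pose K := (\sum_(d <- D) d)%N.
pose F d := 6 * C * Rpower (INR d) (- (1 - s) - 1).
have F0 d : 0 <= F d by apply: Rmult_le_pos; [lra | exact: Rlt_le (exp_pos _)].
apply: (Rle_trans _ (\rsum_(d <- iota z.+1 K) F d)); last first.
  by rewrite rsum_mull; apply: Rmult_le_compat_l; [lra | apply: power_tail_le => //; lra].
apply: (Rle_trans _ (\rsum_(d <- [seq d <- D | ~~ (d <= z)%N]) F d)); last first.
  apply: rsum_subset_uniq => //.
    by rewrite filter_uniq // (sfprods_uniq _ (primes_below_uniq N) (primes_below_prime N)).
  move=> d; rewrite mem_filter -ltnNge mem_iota => /andP[-> dD] /=.
  by rewrite addSn ltnS (leq_trans _ (leq_addl _ _)) // /K (big_rem d) //= leq_addr.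
rewrite -big_filter; apply: rsum_le_seq => d; rewrite mem_filter => /andP[_ /D_sqf sd] _.
have d0 := sqf_gt0 _ sd; have d1 := INR_ge1 _ d0.
apply: Rle_trans (gdens_le d sd) _; rewrite /F.
have -> : - (1 - s) - 1 = s + - INR 2 by rewrite /=; ring.
rewrite Rpower_plus Rpower_Ropp Rpower_pow; last lra.
have i2 : 0 <= / INR d ^ 2 by apply: Rlt_le; apply: Rinv_0_lt_compat; apply: pow_lt; lra.
have := Rmult_le_compat_r _ _ _ i2 (HC d d0); rewrite /Rdiv; lra.
Qed.

(** * Choice of parameters *)

Lemma nat_floor x : 0 <= x -> exists a : nat, INR a <= x < INR a + 1.
Proof.
move=> x0; have [h1 h2] := archimed x.
have u0 : (0 < up x)%Z by apply: lt_IZR; lra.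
exists (Z.to_nat (up x - 1)); rewrite INR_IZR_INZ Z2Nat.id; last lia.
by rewrite minus_IZR; lra.
Qed.

Lemma Rpower_powl x k s : 0 < x -> Rpower (x ^ k) s = Rpower x s ^ k.
Proof.
move=> x0; rewrite -Rpower_pow // Rpower_mult Rmult_comm -Rpower_mult Rpower_pow //.
exact: exp_pos.
Qed.

Lemma ln_le x y : 0 < x -> x <= y -> ln x <= ln y.
Proof. by move=> x0 [xy|->]; [apply: Rlt_le; exact: ln_increasing | lra]. Qed.

Lemma trunc_log2_le m : (0 < m)%N -> INR (trunc_log 2 m) <= 2 * ln (INR m).
Proof.
move=> m0; have h := leq_INR _ _ (trunc_logP (isT : (1 < 2)%N) m0).
rewrite INR_expn in h; set k := trunc_log 2 m in h *.
have h0 : 0 < INR 2 ^ k by apply: pow_lt; rewrite /=; lra.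
have h1 : ln (INR 2 ^ k) <= ln (INR m) by apply: ln_le.
rewrite ln_pow in h1; last by rewrite /=; lra.
have e2 : INR 2 = 2 by [].
rewrite e2 in h1; have l2 := ln_lt_2; have k0 := pos_INR k.
have : INR k * / 2 <= INR k * ln 2 by apply: Rmult_le_compat_l; lra.
lra.
Qed.

Theorem theorem1p3 :
  exists P : R,
    Un_cv euler_partial P /\
    forall eps : R, 0 < eps ->
      exists C : R, 0 < C /\
        forall X : R, 1 <= X ->
          Rabs (S X - 4 * X ^ 10 * P) <= C * Rpower X (7 + eps).
Proof.
have [P HP] := euler_partial_cv; exists P; split=> // eps e0.
pose s := Rmin eps 1 / 26.
have [s0 s1 seps] : [/\ 0 < s, s <= / 26 & 26 * s <= eps].
  have := Rmin_glb_lt _ _ _ e0 Rlt_0_1; have := Rmin_l eps 1; have := Rmin_r eps 1.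
  by rewrite /s; split; lra.
have [C [C1 HC]] := omega_bound s s0.
(* |Delta| <= 31 L^6 <= 1984 T^12, as L <= 2 T^2. The harmonic sum is at most 1 + 4 ln T, and n is
   at most 1 + 2 ln(48 T^6) <= 97 + 12 ln T. In both, ln T <= Y / s. *)
pose w := 1984 * C; pose h := 1 + 4 / s; pose k := 97 + 12 / s.
have is0 : 0 < / s by exact: Rinv_0_lt_compat.
pose K := 72 * (w * h) + 6 + 30 * w + 56 * (w * h) ^ 2 + 3 * 10 ^ 12 * (w * k ^ 2) + 96 * C.
have w0 : 1 <= w by rewrite /w; lra.
have h0 : 1 <= h by rewrite /h /Rdiv; lra.
have k0 : 1 <= k by rewrite /k /Rdiv; lra.
have wh0 : 0 < w * h by apply: Rmult_lt_0_compat; lra.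
have wk0 : 0 < w * k ^ 2 by apply: Rmult_lt_0_compat; [lra | apply: pow_lt; lra].
have wh2 : 0 < (w * h) ^ 2 by exact: pow_lt.
exists K; split; first by rewrite /K; lra.
move=> T T1; have T0 : 0 < T by lra.
set Y := Rpower T s; have Y1 : 1 <= Y by apply: Rpower_ge1; lra.
have [a4 H4] := nat_floor (T ^ 4) (pow_le _ 4 (Rlt_le _ _ T0)).
have [a6 H6] := nat_floor (T ^ 6) (pow_le _ 6 (Rlt_le _ _ T0)).
have [z Hz] := nat_floor (T ^ 3) (pow_le _ 3 (Rlt_le _ _ T0)).
have [l Hl] := nat_floor (T ^ 2) (pow_le _ 2 (Rlt_le _ _ T0)).
have t2 : 1 <= T ^ 2 by apply: pow_R1_Rle.
have t3 : 1 <= T ^ 3 by apply: pow_R1_Rle.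
have t4 : 1 <= T ^ 4 by apply: pow_R1_Rle.
have pos a x : 1 <= x -> INR a <= x < INR a + 1 -> (0 < a)%N.
  by case: a => // x1 [_]; rewrite /=; lra.
have a40 := pos _ _ t4 H4; have z0 := pos _ _ t3 Hz.
pose L := l.+1.
have L1 : T ^ 2 <= INR L <= 2 * T ^ 2 by rewrite /L S_INR; lra.
pose n := (trunc_log 2 (6 * L ^ 3)).+1.
have Hn : (6 * L ^ 3 < 2 ^ n)%N by apply: trunc_log_ltn.
have lnT : ln T <= Y * / s by exact: ln_le_Rpower.
pose W := w * Y ^ 12; pose H := h * Y.
have HW m : (0 < m <= 31 * L ^ 6)%N -> 3 ^ size (primes m) <= W.
  move=> /andP[m0 mL]; apply: Rle_trans (HC m m0) _.
  have hm : INR m <= 1984 * T ^ 12.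
    apply: Rle_trans (leq_INR _ _ mL) _; rewrite (mult_INR 31) INR_expn.
    have -> : INR 31 = 31 by rewrite /=; lra.
    have : INR L ^ 6 <= (2 * T ^ 2) ^ 6 by apply: pow_incr; split; [exact: pos_INR | lra].
    have -> : (2 * T ^ 2) ^ 6 = 64 * T ^ 12 by ring.
    lra.
  have h1 : Rpower (INR m) s <= Rpower (1984 * T ^ 12) s.
    by apply: Rle_Rpower_l; [lra | split => //; exact: INR_gt0].
  have h2 : Rpower (1984 * T ^ 12) s = Rpower 1984 s * Y ^ 12.
    by rewrite -Rpower_mult_distr ?Rpower_powl //; [lra | exact: pow_lt].
  have h3 : Rpower 1984 s <= 1984.
    by rewrite -{2}(Rpower_1 1984); [apply: Rle_Rpower; lra | lra].
  have y12 : 0 <= Y ^ 12 by apply: pow_le; lra.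
  have h4 := Rmult_le_compat_r _ _ _ y12 h3.
  rewrite /W /w Rmult_assoc (Rmult_comm 1984) Rmult_assoc.
  by apply: Rmult_le_compat_l; lra.
have HH : \rsum_(e <- iota 1 a4) (/ INR e) <= H.
  apply: Rle_trans (harmonic_le _ a40) _.
  have : ln (INR a4) <= ln (T ^ 4) by apply: ln_le; [exact: INR_gt0 | lra].
  rewrite ln_pow // [INR 4]/= /H /h.
  have -> : (1 + 4 / s) * Y = Y + 4 * (Y * / s) by field; lra.
  lra.
have n_le : INR n <= k * Y.
  have L0 : (0 < 6 * L ^ 3)%N by rewrite muln_gt0 expn_gt0.
  rewrite /n S_INR; have := trunc_log2_le _ L0.
  have : ln (INR (6 * L ^ 3)) <= ln (48 * T ^ 6).
    apply: ln_le; first exact: INR_gt0.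
    rewrite (mult_INR 6) INR_expn; have -> : INR 6 = 6 by rewrite /=; lra.
    have : INR L ^ 3 <= (2 * T ^ 2) ^ 3 by apply: pow_incr; split; [exact: pos_INR | lra].
    have -> : (2 * T ^ 2) ^ 3 = 8 * T ^ 6 by ring.
    lra.
  rewrite ln_mult; [|lra|exact: pow_lt]; rewrite ln_pow // => h1.
  have e6 : INR 6 = 6 by rewrite /=; lra.
  have h2 : ln 48 <= 48.
    have := exp_ineq1_le (ln 48); rewrite exp_ln; lra.
  rewrite e6 in h1; have -> : k * Y = 97 * Y + 12 * (Y * / s) by rewrite /k; field; lra.
  lra.
have tail N : 4 * T ^ 10 * (\rsum_(d <- sfprods (primes_below N) | ~~ (d <= z)%N) gdens d)
    <= 96 * C * Y ^ 3 * T ^ 7.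
  have z1 := INR_ge1 _ z0.
  (* z >= T^3 / 2, so z^(1 - s) is at least T^(3 (1 - s)) / 2, and T^(3 s) = Y^3. *)
  have hz : T ^ 3 <= 2 * Y ^ 3 * Rpower (INR z) (1 - s).
    have e1 : T ^ 3 = Y ^ 3 * Rpower (T ^ 3) (1 - s).
      rewrite -Rpower_powl // -Rpower_plus; have -> : s + (1 - s) = 1 by ring.
      by rewrite Rpower_1 //; exact: pow_lt.
    have e2 : Rpower (T ^ 3) (1 - s) <= Rpower (2 * INR z) (1 - s).
      by apply: Rle_Rpower_l; lra.
    have e3 : Rpower (2 * INR z) (1 - s) = Rpower 2 (1 - s) * Rpower (INR z) (1 - s).
      by rewrite Rpower_mult_distr; lra.
    have e4 : Rpower 2 (1 - s) <= 2.
      by rewrite -{2}(Rpower_1 2); [apply: Rle_Rpower; lra | lra].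
    have zp : 0 < Rpower (INR z) (1 - s) by exact: exp_pos.
    have e5 := Rmult_le_compat_r _ _ _ (Rlt_le _ _ zp) e4.
    have y3 : 0 <= Y ^ 3 by apply: pow_le; lra.
    rewrite {1}e1.
    have -> : 2 * Y ^ 3 * Rpower (INR z) (1 - s) = Y ^ 3 * (2 * Rpower (INR z) (1 - s)) by ring.
    by apply: Rmult_le_compat_l; lra.
  have zp : 0 < Rpower (INR z) (1 - s) by exact: exp_pos.
  have s01 : 0 < s < 1 by lra.
  have := gdens_tail_le C s z N s01 z0 HC.
  rewrite Rpower_Ropp; set v := Rpower (INR z) (1 - s) in hz zp *.
  set G := bigop _ _ _ => hG.
  have t7 : 0 < T ^ 7 by exact: pow_lt.
  have i1 : / (1 - s) <= 2.
    by rewrite -(Rinv_inv 2); apply: Rinv_le_contravar; lra.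
  have iv : T ^ 3 * / v <= 2 * Y ^ 3.
    apply: (Rmult_le_reg_r v) => //; have -> : T ^ 3 * / v * v = T ^ 3 by field; lra.
    lra.
  have iv0 : 0 < / v by exact: Rinv_0_lt_compat.
  have hG2 : G <= 12 * C * / v.
    apply: Rle_trans hG _; have -> : 6 * C * (/ v / (1 - s)) = 6 * C * / v * / (1 - s) by field; lra.
    have -> : 12 * C * / v = 6 * C * / v * 2 by ring.
    by apply: Rmult_le_compat_l => //; repeat apply: Rmult_le_pos; lra.
  apply: (Rle_trans _ (4 * T ^ 10 * (12 * C * / v))).
    by apply: Rmult_le_compat_l => //; have := pow_lt _ 10 T0; lra.
  have -> : 4 * T ^ 10 * (12 * C * / v) = 48 * C * T ^ 7 * (T ^ 3 * / v) by ring.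
  have -> : 96 * C * Y ^ 3 * T ^ 7 = 48 * C * T ^ 7 * (2 * Y ^ 3) by ring.
  by apply: Rmult_le_compat_l => //; repeat apply: Rmult_le_pos; lra.
have bound N : (maxn 3 (31 * L ^ 6).+1 <= N)%N ->
    Rabs (S T - 4 * T ^ 10 * euler_partial N) <= K * Y ^ 26 * T ^ 7.
  rewrite geq_max => /andP[N3 NL].
  apply: Rle_trans (main_estimate T W H a4 a6 z L n N T1 H4 H6 Hz L1 Hn HW HH NL N3) _.
  have t7 : 0 < T ^ 7 by exact: pow_lt.
  have yle j : (j <= 26)%N -> Y ^ j <= Y ^ 26 by move=> hj; apply: Rle_pow => //; lia.
  have y0 j : 0 < Y ^ j by apply: pow_lt; lra.
  have := tail N; set G := 4 * T ^ 10 * _ => hG.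
  have n0 := pos_INR n.
  have b1 : W * H <= w * h * Y ^ 26.
    have -> : W * H = w * h * Y ^ 13 by rewrite /W /H; ring.
    by apply: Rmult_le_compat_l; [lra | exact: yle].
  have b2 : W <= w * Y ^ 26 by rewrite /W; apply: Rmult_le_compat_l; [lra | exact: yle].
  have b3 : W * (W * H ^ 2) = (w * h) ^ 2 * Y ^ 26 by rewrite /W /H; ring.
  have b4 : W * INR n ^ 2 <= w * k ^ 2 * Y ^ 26.
    have : INR n ^ 2 <= (k * Y) ^ 2 by apply: pow_incr.
    move=> hn; apply: (Rle_trans _ (W * (k * Y) ^ 2)).
      by apply: Rmult_le_compat_l => //; apply: Rmult_le_pos; [lra | exact: Rlt_le].
    have -> : W * (k * Y) ^ 2 = w * k ^ 2 * Y ^ 14 by rewrite /W; ring.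
    by apply: Rmult_le_compat_l; [lra | exact: yle].
  have b5 : C * Y ^ 3 <= C * Y ^ 26 by apply: Rmult_le_compat_l; [lra | exact: yle].
  have b6 := yle 0%N isT; rewrite pow_O in b6.
  have b : 72 * (W * H) + 6 + (30 * W + 56 * (W * (W * H ^ 2)) + 3 * 10 ^ 12 * (W * INR n ^ 2))
      + 96 * (C * Y ^ 3) <= K * Y ^ 26 by rewrite /K b3; lra.
  have := Rmult_le_compat_r _ _ _ (Rlt_le _ _ t7) b.
  lra.
(* The bound holds for all large N with the same constant, so it passes to the limit P. *)
have fin := Un_cv_bound _ _ _ (4 * T ^ 10) _ _ HP bound.
apply: Rle_trans fin _; rewrite Rmult_assoc; apply: Rmult_le_compat_l; first by rewrite /K; lra.
rewrite -(Rpower_pow 7 T) // -(Rpower_pow 26 Y); last by exact: exp_pos.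
rewrite /Y Rpower_mult -Rpower_plus.
have -> : INR 26 = 26 by rewrite /=; lra.
have -> : INR 7 = 7 by rewrite /=; lra.
case: (Req_dec T 1) => [->|T1']; first by rewrite /Rpower ln_1 !Rmult_0_r; lra.
by apply: Rle_Rpower; lra.
Qed.
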